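(* Let $$u(x):=\inf_{\tau}\ln\mathbb{E}_x\Big[e^{\int_0^\tau g(X_s)ds+G(X_\tau)}\Big],\qquad w(x):=\inf_{\tau}\liminf_{T\to\infty}\ln\mathbb{E}_x\Big[e^{\int_0^{\tau\wedge T}g(X_s)ds+G(X_{\tau\wedge T})}\Big],\quad x\in E,$$ and let $\underline{w}(x):=\lim_{T\to\infty}\underline{w}_T(x)$, $\overline{w}(x):=\lim_{T\to\infty}\overline{w}_T(x)$, where $$\underline{w}_T(x):=\inf_{\tau\le T}\ln\mathbb{E}_x\Big[e^{\int_0^\tau g(X_s)ds+1_{\{\tau<T\}}G(X_\tau)}\Big],\qquad \overline{w}_T(x):=\inf_{\tau\le T}\ln\mathbb{E}_x\Big[e^{\int_0^\tau g(X_s)ds+G(X_\tau)}\Big].$$ Then $u\equiv\underline{w}$ and $w\equiv\overline{w}$. Moreover, $u$ is lower semicontinuous and $w$ is upper semicontinuous.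
   Context: Setting. $E$ is a locally compact separable metric space; $X=(X_t)_{t\ge0}$ is a time-homogeneous continuous-time standard Markov process with values in $E$ on $(\Omega,\mathcal{F},(\mathcal{F}_t))$ (càdlàg paths, strong Markov, quasi-left continuous, with right-continuous complete filtration); $\mathbb{P}_x$ is its law started from $X_0=x$, with expectation $\mathbb{E}_x$. $X$ is $C_0$-Feller: its transition semigroup maps $\mathcal{C}_0(E)$ (real continuous functions vanishing at infinity) into itself. Standing assumptions. (i) $G:E\to[0,\infty)$ is continuous (possibly unbounded); $g:E\to[0,\infty)$ is continuous and bounded with $g(\cdot)\ge c$ for some $c>0$. (ii) $\mathbb{E}_x[\sup_{t\in[0,T]}e^{G(X_t)}]<\infty$ for all $T\ge0$, $x\in E$. (iii) For every $T\ge0$ and every continuous $h$ with $0\le h(\cdot)\le G(\cdot)$, the map $x\mapsto\mathbb{E}_x[\exp(\int_0^Tg(X_s)ds+h(X_T))]$ is continuous. Infima are over stopping times of $(\mathcal{F}_t)$; on $\{\tau=\infty\}$ the quantity $e^{\int_0^\tau g(X_s)ds+G(X_\tau)}$ equals $+\infty$. The map $T\mapsto\underline{w}_T(x)$ is non-decreasing and $T\mapsto\overline{w}_T(x)$ is non-increasing, so the limits exist. *)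

(* Defs.v *)
From HB Require Import structures.
From mathcomp Require Import all_boot all_order all_algebra.
From mathcomp Require Import all_classical all_reals all_analysis.
From mathcomp Require Import measurable_realfun.

Set Implicit Arguments.
Unset Strict Implicit.
Unset Printing Implicit Defensive.

Import Order.TTheory GRing.Theory Num.Theory.
Import numFieldNormedType.Exports.

Local Open Scope classical_set_scope.
Local Open Scope ring_scope.

(* MathComp-Analysis measurable types are pointed, so the Borel space of [E]
   needs a pointed metric type.  Nothing is lost: a process with values in [E]
   on the (pointed) sample space forces [E] to be nonempty. *)
#[short(type="pmetricType")]
HB.structure Definition PointedMetric (K : numDomainType) :=
  {M of Metric K M & Pointed M}.

Definition separable (T : topologicalType) :=
  exists2 D : set T, countable D & dense D.

Definition borel (T : ptopologicalType) := g_sigma_algebraType (@open T).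

Definition upper_semicontinuous (R : numFieldType) (T : topologicalType)
    (f : T -> \bar R) :=
  forall x a, (f x < a%:E)%E ->
    exists2 V, nbhs x V & forall y, V y -> (f y < a%:E)%E.

(* The space C_0(T). *)
Definition vanishing_at_infinity (R : numFieldType) (T : topologicalType)
    (f : T -> R) :=
  forall e, 0 < e -> exists2 K, compact K & forall x, ~ K x -> `|f x| < e.

Definition C0 (R : numFieldType) (T : topologicalType) : set (T -> R) :=
  [set f | continuous f /\ vanishing_at_infinity f].

(* Time is [0, +oo[: filtrations and processes are indexed by [R], but only
   their values at nonnegative times are constrained or used. *)
Section process.
Context {R : realType} {d : measure_display} {Omega : measurableType d}.
Context {E : pmetricType R}.
Implicit Types (F : R -> set_system Omega) (X : R -> Omega -> E).
Implicit Types (P : E -> probability Omega R) (tau : Omega -> \bar R).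

Record filtration F : Prop := {
  filtration_sigma_algebra : forall t, 0 <= t -> sigma_algebra setT (F t) ;
  filtration_measurable : forall t, 0 <= t -> F t `<=` measurable ;
  filtration_le : forall s t, 0 <= s -> s <= t -> F s `<=` F t }.

Definition right_continuous_filtration F :=
  forall t A, 0 <= t -> (forall s, t < s -> F s A) -> F t A.

(* [A] is included in a null set of the law $P_\mu = \int P_x \mu(dx)$ of the
   process with initial distribution [mu]: for a measurable [N],
   $P_\mu(N) = 0$ iff $P_x(N) = 0$ for [mu]-almost every [x]. *)
Definition law_negligible P (mu : probability (borel E) R) (A : set Omega) :=
  exists N, [/\ measurable N, A `<=` N & {ae mu, forall x, P x N = 0%E}].

(* Completeness relative to the family of laws (Blumenthal-Getoor): an event
   that for every initial distribution coincides, up to a null set, with some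
   event of [F t] belongs to [F t].  Requiring instead that [F t] contain the
   [P x]-null sets for each single [x] would be degenerate, since
   [P x (X 0 != x) = 0]. *)
Definition complete_filtration P F :=
  forall t A, 0 <= t ->
    (forall mu, exists2 B, F t B & law_negligible P mu (A `+` B)) -> F t A.

Definition stopping_time F tau :=
  (forall w, 0 <= tau w)%E /\
  (forall t, 0 <= t -> F t [set w | tau w <= t%:E]%E).

(* The sigma-algebra of events prior to [tau]. *)
Definition stopped_algebra F tau : set_system Omega :=
  [set A | measurable A /\
    forall t, 0 <= t -> F t (A `&` [set w | tau w <= t%:E]%E)].

(* On [tau = +oo] this is the value at time 0; it is only used where [tau] is
   finite. *)
Definition stopped X tau (w : Omega) : E := X (fine (tau w)) w.

Definition adapted F X :=
  forall t (B : set (borel E)), 0 <= t -> measurable B -> F t (X t @^-1` B).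

Definition cadlag (f : R -> E) :=
  (forall t, 0 <= t -> f s @[s --> t^'+] --> f t) /\
  (forall t, 0 < t -> cvg (f s @[s --> t^'-])).

(* Conditional probabilities given the events prior to [tau] are written in
   integral form. *)
Definition strong_markov F X P :=
  forall x tau A s (B : set (borel E)),
    stopping_time F tau -> stopped_algebra F tau A -> 0 <= s -> measurable B ->
    P x (A `&` [set w | (tau w < +oo)%E /\ B (X (fine (tau w) + s) w)]) =
    (\int[P x]_(w in A `&` [set w | tau w < +oo])
       P (stopped X tau w) (X s @^-1` B))%E.

Definition quasi_left_continuous F X P :=
  forall x (tau_ : nat -> Omega -> \bar R) tau,
    (forall n, stopping_time F (tau_ n)) ->
    (forall w, {homo tau_ ^~ w : m n / (m <= n)%N >-> (m <= n)%E}) ->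
    (forall w, tau_ n w @[n --> \oo] --> tau w) ->
    {ae P x, forall w, (tau w < +oo)%E ->
      stopped X (tau_ n) w @[n --> \oo] --> stopped X tau w}.

(* Time-homogeneous standard Markov process with infinite lifetime. *)
Record standard_markov_process F X P : Prop := {
  smp_filtration : filtration F ;
  smp_right_continuous : right_continuous_filtration F ;
  smp_complete : complete_filtration P F ;
  smp_adapted : adapted F X ;
  smp_cadlag : forall w, cadlag (X ^~ w) ;
  smp_start : forall x, P x (X 0 @^-1` [set x]) = 1%E ;
  smp_kernel : forall (t : R) (B : set (borel E)), 0 <= t -> measurable B ->
    measurable_fun [set: borel E]
      (fun x : borel E => P x (X t @^-1` B)) ;
  smp_strong_markov : strong_markov F X P ;
  smp_quasi_left_continuous : quasi_left_continuous F X P }.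

Definition transition_semigroup X P (t : R) (f : E -> R) (x : E) : R :=
  \int[P x]_w f (X t w).

Definition C0_feller X P :=
  forall (t : R) f, 0 <= t -> C0 f -> C0 (transition_semigroup X P t f).

Section values.
Variables (F : R -> set_system Omega) (X : R -> Omega -> E).
Variables (P : E -> probability Omega R) (g G : E -> R).

(* The running integral; finite since [g] is bounded. *)
Definition running (t : R) (w : Omega) : R :=
  \int[lebesgue_measure]_(s in `[0, t]) g (X s w).

Definition payoff tau (w : Omega) : \bar R :=
  if tau w is t%:E then (expR (running t w + G (X t w)))%:E else +oo%E.

(* The exponent has no terminal reward at the horizon [T]. *)
Definition payoff_before (T : R) tau (w : Omega) : \bar R :=
  if tau w is t%:E
  then (expR (running t w + (if t < T then G (X t w) else 0)))%:E else +oo%E.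

Local Open Scope ereal_scope.

Definition value_u (x : E) : \bar R :=
  ereal_inf [set lne (\int[P x]_w payoff tau w) |
             tau in stopping_time F].

Definition value_w (x : E) : \bar R :=
  ereal_inf [set limf_einf (fun T : R =>
               lne (\int[P x]_w payoff (fun w => mine (tau w) T%:E) w))
               (+oo%R : set_system R) | tau in stopping_time F].

Definition bounded_stopping_time (T : R) : set (Omega -> \bar R) :=
  [set tau | stopping_time F tau /\ forall w, tau w <= T%:E].

Definition lower_value_T (T : R) (x : E) : \bar R :=
  ereal_inf [set lne (\int[P x]_w payoff_before T tau w) |
             tau in bounded_stopping_time T].

Definition upper_value_T (T : R) (x : E) : \bar R :=
  ereal_inf [set lne (\int[P x]_w payoff tau w) |
             tau in bounded_stopping_time T].

Definition lower_value (x : E) : \bar R :=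
  lim (lower_value_T T x @[T --> +oo%R]).

Definition upper_value (x : E) : \bar R :=
  lim (upper_value_T T x @[T --> +oo%R]).

End values.
End process.

(* Main.v *)
Require Import Defs.
From mathcomp Require Import all_boot all_order all_algebra.
From mathcomp Require Import all_classical all_reals all_analysis.
From mathcomp Require Import measurable_realfun.
From mathcomp Require Import ring lra.

(** The values are logarithms, and the proof works with their exponentials: the
cost of a stopping time tau is E_x[exp(int_0^tau g) e^G(X_tau)].  Let
Q_h f (x) = E_x[exp(int_0^h g) f(X_h)] be the Feynman-Kac operators.  They form
a semigroup ([growth_semigroup]), and the assumed continuity of the exponential
functionals says that they map continuous functions between 1 and e^G to
continuous functions ([growth_continuous]).  On a time grid of mesh h, optimal
stopping for a reward psi is solved by iterating f |-> min(psi, Q_h f): each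
iterate is continuous, is the cost of a stopping time ([bellman_attained]), and
minorizes the cost of every stopping time with values in the grid
([verification]).  Rounding a stopping time up to finer and finer grids extends
this last bound to all bounded stopping times, by right-continuity of the paths
and domination by sup e^G ([verification_limit]).

The upper value.  That w is the limit of the upper values is formal, since the
stopping times tau /\ T exhaust the bounded ones ([value_wE]).  If a bounded
stopping time costs less than e^a at x, some iterate for the reward e^G, on a
fine enough grid, is less than e^a at x, hence near x by continuity; as it is
itself the cost of a stopping time at each point, w < a near x.

The lower value.  Here a lower bound of all costs by continuous functions is
needed, so the error made by stopping between two nodes of the grid has to be
controlled uniformly.  A Feller semigroup satisfies P_r chi <= chi + e
everywhere, for chi in C_0 and all small r ([transition_uniform_upper]).
Therefore e^G is replaced by rewards psi_j = 1 + chi_j, with chi_j in C_0, that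
agree with e^G near any given point for large j ([truncation_exists]), and the
grid for psi_j is taken so fine that growing during one step costs at most a
factor kappa_j, with kappa_j -> 1.  The iterates v_(j,k), started at the
terminal reward 1, then satisfy v_(j,k) <= kappa_j * cost for every stopping time
up to the time of k steps ([truncated_value_le_cost]).  Let V be the supremum
over j of v_(j,k) / kappa_j, with k steps making up the time j + 1: it is lower
semicontinuous, and ln V is below the limit of the lower values, itself below u.

Conversely, a stopping time of cost at most V(x) + eps is built in stages.
During [n, n + 1] one follows, if not yet stopped, a stopping time that attains
v_(j,k) from X_n.  For j large, v_(j,k) is close to V both at the beginning and
at the end of the stage, because for time j and for time j + 1 these values
tend to V ([cvg_truncated_value]), and psi_j is as good as e^G because a path
stays up to time n + 1 in a region where they agree ([cvg_truncated_cost]).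
So a stage adds an error as small as desired ([near_optimal_extend]).  As
g >= c > 0, a path which is never stopped has cost at least e^(c n) at stage n,
so that Fatou's lemma bounds the cost of the limit of the stages by V(x) + eps,
including on {tau = oo} ([value_u_le_limit]).  Hence u = ln V is the limit of
the lower values. *)

Set Implicit Arguments.
Unset Strict Implicit.
Unset Printing Implicit Defensive.
Import Order.TTheory GRing.Theory Num.Theory.
Import numFieldNormedType.Exports.
Local Open Scope classical_set_scope.
Local Open Scope ring_scope.

(** * Integration along right-continuous paths *)

Section integration.
Import HBNNSimple.
Context {d : measure_display} {T : measurableType d} {R : realType}.

(** Nonnegative measurable functions are increasing limits of nonnegative
combinations of indicators. *)
Lemma ge0_measurable_ind (H : (T -> \bar R) -> Prop) :
  (forall A (k : R), measurable A -> 0 <= k -> H (fun x => (k * \1_A x)%:E)) ->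
  (forall f1 f2, measurable_fun setT f1 -> (forall x, (0 <= f1 x)%E) ->
     measurable_fun setT f2 -> (forall x, (0 <= f2 x)%E) ->
     H f1 -> H f2 -> H (fun x => f1 x + f2 x)%E) ->
  (forall (f_ : nat -> T -> \bar R) f, (forall n, measurable_fun setT (f_ n)) ->
     (forall n x, (0 <= f_ n x)%E) ->
     (forall x, nondecreasing_seq (f_ ^~ x)) ->
     (forall x, f_ ^~ x @ \oo --> f x) -> (forall n, H (f_ n)) -> H f) ->
  forall f, measurable_fun setT f -> (forall x, (0 <= f x)%E) -> H f.
Proof.
move=> Hind Hadd Hlim f mf f0.
pose h_ := nnsfun_approx measurableT mf.
refine (Hlim (fun n x => (h_ n x)%:E) f _ _ _ _ _).
- by move=> n; exact/measurable_EFinP.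
- by move=> n x; rewrite lee_fin.
- by move=> x m n mn; rewrite lee_fin; exact/lefP/nd_nnsfun_approx.
- by move=> x; apply: cvg_nnsfun_approx.
move=> n; pose s : seq R := finmap.enum_fset (fset_set (h_ n @` setT)).
have -> : (fun x => (h_ n x)%:E) = fun x =>
    (\sum_(y <- s) (y * \1_(h_ n @^-1` [set y]) x))%:E.
  by apply/funext => x; rewrite [in LHS]fimfunE fsbig_finite.
have : forall y, y \in s -> 0 <= y.
  by move=> y; rewrite in_fset_set// inE => -[x _ <-].
elim: s => [_|y s IH ys0].
  rewrite (_ : (fun=> _) = (fun x => (0 * \1_set0 x)%:E)).
    exact: Hind.
  by apply/funext => x; rewrite big_nil mul0r.
have y0 : 0 <= y by apply: ys0; rewrite mem_head.
have s0 y' : y' \in s -> 0 <= y' by move=> y's; apply: ys0; rewrite inE y's orbT.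
under eq_fun do rewrite big_cons EFinD.
apply: Hadd.
- by apply/measurable_EFinP; apply: measurable_funM => //; exact: measurable_indic.
- by move=> x; rewrite lee_fin mulr_ge0// indicE.
- apply/measurable_EFinP; apply: measurable_sum => z.
  by apply: measurable_funM => //; exact: measurable_indic.
- move=> x; rewrite lee_fin big_seq sumr_ge0// => z /s0 z0.
  by rewrite mulr_ge0// indicE.
- exact: Hind.
- exact: IH.
Qed.

Context (mu : {measure set T -> \bar R}).

Lemma dominated_integrable_fun (f g : T -> R) : measurable_fun setT f ->
  (forall x, `|f x| <= g x) -> mu.-integrable setT (EFin \o g) ->
  mu.-integrable setT (EFin \o f).
Proof.
move=> mf fg; apply: le_integrable => //; first exact/measurable_EFinP.
by move=> x _ /=; rewrite lee_fin (le_trans (fg x))// ler_norm.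
Qed.

Lemma integrable_scale (k : R) (f : T -> R) : mu.-integrable setT (EFin \o f) ->
  mu.-integrable setT (EFin \o (fun x => k * f x)).
Proof.
by move=> fi; rewrite (_ : _ \o _ = fun x => (k%:E * (f x)%:E)%E)//; exact: integrableZl.
Qed.

Lemma cvg_Rintegral (f_ : nat -> T -> R) (f g : T -> R) :
  (forall n, measurable_fun setT (f_ n)) ->
  (forall x, f_ ^~ x @ \oo --> f x) -> (forall n x, `|f_ n x| <= g x) ->
  mu.-integrable setT (EFin \o g) ->
  \int[mu]_x f_ n x @[n --> \oo] --> \int[mu]_x f x.
Proof.
move=> mf_ f_f f_g ig.
have mf : measurable_fun setT f by exact: measurable_fun_cvg (fun x _ => f_f x).
have [|||intf _] := @dominated_convergence _ _ _ mu _ measurableT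
  (fun n => EFin \o f_ n) (EFin \o f) (EFin \o g) (fun n => (measurable_EFinP _ _).2 (mf_ n))
  ((measurable_EFinP _ _).2 mf).
- by apply/aeW => x _; apply/cvg_EFin; [exact: nearW|exact: f_f].
- exact: ig.
- by apply/aeW => x n _ /=; rewrite lee_fin.
have ifn : (\int[mu]_x (EFin \o f) x \is a fin_num)%E by exact: integrable_fin_num.
rewrite -[X in _ --> X]fineK//.
by move/fine_cvg.
Qed.

End integration.

Section right_continuous_process.
Context {R : realType}.

(** The first multiple of [delta] strictly after [t].  Approaching [t] from the
right, never reaching it, is what right-continuity of paths can exploit. *)
Definition next_tick (delta t : R) : R := delta * (Num.truncn (t / delta)).+1%:R.

Lemma next_tick_gt (delta t : R) : 0 < delta -> t < next_tick delta t.
Proof. by move=> d0; rewrite /next_tick mulrC -ltr_pdivrMr// truncnS_gt. Qed.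

Lemma next_tick_le (delta t : R) : 0 < delta -> 0 <= t -> next_tick delta t <= t + delta.
Proof.
move=> d0 t0; rewrite /next_tick -natr1 mulrDr mulr1 lerD2r mulrC -ler_pdivlMr//.
by rewrite truncn_le divr_ge0// ltW.
Qed.

Lemma cvg_next_tick (h t : R) : 0 < h -> 0 <= t ->
  next_tick (h / n.+1%:R) t @[n --> \oo] --> t.
Proof.
move=> h0 t0; apply: (@squeeze_cvgr _ _ _ _ (fun=> t) (fun n => t + h / n.+1%:R)).
- apply: nearW => n; rewrite ltW ?next_tick_gt ?divr_gt0//=.
  by rewrite next_tick_le// divr_gt0.
- exact: cvg_cst.
- rewrite -[X in _ --> X]addr0; apply: cvgD; first exact: cvg_cst.
  rewrite -[X in _ --> X](mulr0 h); apply: cvgMr.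
  exact: cvg_harmonic.
Qed.

Lemma cvg_right_next_tick (f : R -> R) (h t : R) : 0 < h -> 0 <= t ->
  f s @[s --> t^'+] --> f t -> f (next_tick (h / n.+1%:R) t) @[n --> \oo] --> f t.
Proof.
move=> h0 t0 /cvg_at_rightP; apply; split.
  by move=> n; rewrite next_tick_gt// divr_gt0.
exact: cvg_next_tick.
Qed.

Lemma measurable_next_tick d (T : measurableType d) (Y : R -> T -> R)
    (tau : T -> R) (delta : R) : 0 < delta ->
  (forall t, 0 <= t -> measurable_fun setT (Y t)) ->
  (forall w, 0 <= tau w) -> measurable_fun setT tau ->
  measurable_fun setT (fun w => Y (next_tick delta (tau w)) w).
Proof.
move=> d0 mY tau0 mtau _ A mA; rewrite setTI.
rewrite (_ : _ @^-1` _ = \bigcup_k ([set w | delta * k%:R <= tau w < delta * k.+1%:R] `&`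
    (Y (delta * k.+1%:R) @^-1` A))); last first.
  apply/seteqP; split => w /=.
    move=> Aw; exists (Num.truncn (tau w / delta)) => //; split=> //=.
    have := @truncn_itv R (tau w / delta); rewrite divr_ge0 ?(ltW d0)// => /(_ isT).
    by rewrite ler_pdivlMr// ltr_pdivrMr// !(mulrC delta).
  move=> [k _ [/= kt Yk]]; rewrite /next_tick (_ : Num.truncn _ = k)//.
  by apply: truncn_def; rewrite ler_pdivlMr// ltr_pdivrMr// !(mulrC _ delta).
apply: bigcupT_measurable => k; apply: measurableI; last first.
  by rewrite -[X in measurable X]setTI; apply: mY => //; rewrite mulr_ge0// ltW.
rewrite -[X in measurable X]setTI.
have := mtau measurableT `[delta * k%:R, delta * k.+1%:R[%classic.
rewrite (_ : tau @^-1` _ = [set w | delta * k%:R <= tau w < delta * k.+1%:R]); first exact.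
by apply/seteqP; split => w /=; rewrite in_itv.
Qed.

(** The random time is approximated from the right by times with countably many
values, for which the claim is a countable union over these values. *)
Lemma measurable_random_time d (T : measurableType d) (Y : R -> T -> R) (tau : T -> R) :
  (forall t, 0 <= t -> measurable_fun setT (Y t)) ->
  (forall w t, 0 <= t -> Y s w @[s --> t^'+] --> Y t w) ->
  (forall w, 0 <= tau w) -> measurable_fun setT tau ->
  measurable_fun setT (fun w => Y (tau w) w).
Proof.
move=> mY rY tau0 mtau.
apply: (@measurable_fun_cvg _ _ _ _ (fun n w => Y (next_tick (1 / n.+1%:R) (tau w)) w)).
  by move=> n; apply: measurable_next_tick => //; rewrite divr_gt0.
by move=> w _; apply: (@cvg_right_next_tick (Y ^~ w)) => //; exact: rY.
Qed.

(** A path is a process on the sample space of times, evaluated at the random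
time which is the sample point itself. *)
Lemma right_continuous_measurable (f : R -> R) (a : R) :
  (forall t, a <= t -> f s @[s --> t^'+] --> f t) ->
  measurable_fun `[a, +oo[ f.
Proof.
move=> rf; pose tau (t : R) := Num.max 0 (t - a).
have mtau : measurable_fun setT tau.
  by apply: measurable_maxr => //; apply: measurable_funB.
apply: (@eq_measurable_fun _ _ _ _ _ (fun t => f (a + tau t))).
  move=> t; rewrite inE/= in_itv/= andbT => at_; rewrite /tau max_r ?subr_ge0//.
  by rewrite addrC subrK.
apply: measurable_funTS.
apply: (@measurable_random_time _ _ (fun t _ => f (a + t))) => //.
  move=> _ t t0; have := rf (a + t); rewrite lerDl => /(_ t0) /cvg_at_rightP h.
  apply/cvg_at_rightP => u [ut uc]; apply: h; split.
    by move=> n; rewrite ltrD2l.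
  by apply: cvgD => //; exact: cvg_cst.
by move=> t; rewrite /tau le_max lexx.
Qed.

(** The right Riemann sum is the integral of [f] composed with [next_tick], which
converges pointwise to [f] by right-continuity. *)
Lemma cvg_riemann_sum (f : R -> R) (a h M : R) : 0 < h ->
  (forall t, a <= t -> f s @[s --> t^'+] --> f t) ->
  (forall t, a <= t -> `|f t| <= M) ->
  \sum_(i < n.+1) h / n.+1%:R * f (a + h / n.+1%:R * i.+1%:R) @[n --> \oo] -->
  \int[lebesgue_measure]_(s in `[a, a + h]) f s.
Proof.
move=> h0 rf fM.
have M0 : 0 <= M by rewrite (le_trans _ (fM a _)).
have mf : measurable_fun `[a, +oo[ f by exact: right_continuous_measurable.
pose mu : {measure set (measurableTypeR R) -> \bar R} := @lebesgue_measure R.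
have sub1 b : [set` `[a, b[] `<=` [set` `[a, +oo[].
  by move=> x /=; rewrite !in_itv/= andbT => /andP[].
have fini b : (mu `[a, b[%classic < +oo)%E.
  by rewrite /mu /= lebesgue_measure_itv /= lte_fin; case: ifP => _ //; rewrite -EFinD ltry.
have ib b (k : R -> R) (N : R) : measurable_fun `[a, b[ k -> (forall t, a <= t -> `|k t| <= N) ->
    mu.-integrable `[a, b[ (EFin \o k).
  move=> mk kN; apply: measurable_bounded_integrable => //.
  exists N; split; first exact: num_real.
  by move=> x Nx t /=; rewrite in_itv/= => /andP[/kN kt _]; rewrite (le_trans kt)// ltW.
pose st n t := f (a + next_tick (h / n.+1%:R) (t - a)).
have d0 n : 0 < h / n.+1%:R by rewrite divr_gt0.
have mst n b : measurable_fun `[a, b[ (st n).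
  have mnt : measurable_fun `[a, b[ (fun t => f (a + next_tick (h / n.+1%:R) (Num.max 0 (t - a)))).
    apply: measurable_funTS.
    apply: (@measurable_next_tick _ _ (fun t _ => f (a + t))) => //.
      by move=> t; rewrite le_max lexx.
    by apply: measurable_maxr => //; apply: measurable_funB.
  apply: eq_measurable_fun mnt => t; rewrite inE/= in_itv/= => /andP[at_ _].
  by rewrite max_r ?subr_ge0.
have stM n t : a <= t -> `|st n t| <= M.
  move=> at_; apply: fM; rewrite lerDl ltW// (le_lt_trans _ (next_tick_gt _ _))//.
  by rewrite subr_ge0.
have sumE n k : \int[mu]_(s in `[a, a + h / n.+1%:R * k%:R[) st n s =
    \sum_(i < k) h / n.+1%:R * f (a + h / n.+1%:R * i.+1%:R).
  elim: k => [|k IH].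
    rewrite big_ord0 mulr0 addr0 (_ : [set` _] = set0) ?Rintegral_set0//.
    by apply/seteqP; split => x //=; rewrite in_itv/= => /andP[] /le_lt_trans h1 /h1; rewrite ltxx.
  have lek : a + h / n.+1%:R * k%:R <= a + h / n.+1%:R * k.+1%:R.
    by rewrite lerD2l ler_pM2l// ler_nat.
  have lea : a <= a + h / n.+1%:R * k%:R by rewrite lerDl mulr_ge0// ltW.
  have -> : `[a, a + h / n.+1%:R * k.+1%:R[%classic =
     `[a, a + h / n.+1%:R * k%:R[%classic `|` `[a + h / n.+1%:R * k%:R, a + h / n.+1%:R * k.+1%:R[%classic.
    by rewrite -itv_bndbnd_setU//= bnd_simp.
  rewrite Rintegral_setU//; last 2 first.
  - rewrite -itv_bndbnd_setU//= ?bnd_simp//.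
    exact: ib (mst n _) (stM n).
  - apply/disj_setPS => x /=; rewrite !in_itv/= => -[/andP[_ x1] /andP[x2 _]].
    by move: (lt_le_trans x1 x2); rewrite ltxx.
  rewrite IH big_ord_recr/=; congr (_ + _).
  rewrite (@eq_Rintegral _ _ _ _ _ (cst (f (a + h / n.+1%:R * k.+1%:R)))); last first.
    move=> t; rewrite inE/= in_itv/= => /andP[t1 t2]; rewrite /st /next_tick.
    rewrite (_ : Num.truncn _ = k)//; apply: truncn_def.
    rewrite ler_pdivlMr// ltr_pdivrMr// !(mulrC _ (h / n.+1%:R)).
    by rewrite lerBrDl t1 ltrBlDl t2.
  rewrite Rintegral_cst//= lebesgue_measure_itv/= lte_fin.
  rewrite ltrD2l ltr_pM2l// ltr_nat ltnSn -EFinB/=.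
  by rewrite mulrC; congr (_ * _); rewrite -natr1; ring.
rewrite -Rintegral_itv_bndo_bndc; last first.
  by apply: (ib _ _ M) => //; apply: measurable_funS mf.
have -> : (fun n => \sum_(i < n.+1) h / n.+1%:R * f (a + h / n.+1%:R * i.+1%:R)) =
   (fun n => \int[mu]_(s in `[a, a + h[) st n s).
  by apply/funext => n; rewrite -sumE divfK.
have mres (k : R -> R) : measurable_fun `[a, a + h[ k ->
    measurable_fun setT (k \_ `[a, a + h[).
  by move=> mk; apply/(measurable_restrictT _ _).1.
rewrite Rintegral_mkcond; under eq_fun do rewrite Rintegral_mkcond.
apply: (@cvg_Rintegral _ _ _ mu _ _ (cst M \_ `[a, a + h[)).
- by move=> n; apply: mres.
- move=> t; rewrite patchE; case: ifPn => [|nt].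
    rewrite inE/= in_itv/= => /andP[at_ tb].
    have tS : t \in [set` `[a, a + h[] by rewrite inE/= in_itv/= at_.
    under eq_fun do rewrite patchE tS.
    have /cvg_at_rightP r := rf t at_.
    have := @cvg_right_next_tick (fun s => f (a + s)) h (t - a) h0.
    rewrite subr_ge0 (addrC a (t - a)) subrK => /(_ at_); apply.
    apply/cvg_at_rightP => u [ut uc]; apply: r; split.
      by move=> n; rewrite -ltrBlDl.
    rewrite -[X in _ --> X](subrK a t) [X in _ --> X]addrC.
    by apply: cvgD => //; exact: cvg_cst.
  under eq_fun do rewrite patchE (negbTE nt).
  exact: cvg_cst.
- move=> n t; rewrite !patchE; case: ifPn => [|_]; last by rewrite normr0.
  by rewrite inE/= in_itv/= => /andP[at_ _]; apply: stM.
- rewrite -restrict_EFin; apply/integrable_restrict => //; rewrite ?setTI//.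
  by apply: (ib _ _ M) => // t _; rewrite ger0_norm.
Qed.

End right_continuous_process.

Section path_integral.
Context {R : realType}.
Implicit Types (f : R -> R).

Definition right_continuous_from0 (f : R -> R) :=
  forall t, 0 <= t -> f s @[s --> t^'+] --> f t.

Lemma integrable_path f (M a b : R) : right_continuous_from0 f ->
  (forall t, 0 <= t -> `|f t| <= M) -> 0 <= a ->
  lebesgue_measure.-integrable `[a, b] (EFin \o f).
Proof.
move=> rf fM a0.
have mf : measurable_fun `[a, b] f.
  apply: (measurable_funS _ _ (@right_continuous_measurable _ f 0 rf)) => //.
  by move=> x/=; rewrite !in_itv/= andbT => /andP[/(le_trans a0)].
apply: measurable_bounded_integrable => //.
  rewrite /= lebesgue_measure_itv /= lte_fin; case: ifP => _ //.
  by rewrite -EFinD ltry.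
exists M; split; first exact: num_real.
move=> x Mx t /=; rewrite in_itv/= => /andP[at_ _].
by rewrite (le_trans (fM _ (le_trans a0 at_)))// ltW.
Qed.

Lemma path_integralD f (M a b h : R) : right_continuous_from0 f ->
  (forall t, 0 <= t -> `|f t| <= M) -> 0 <= a -> a <= b -> 0 <= h ->
  \int[lebesgue_measure]_(s in `[a, b + h]) f s =
  \int[lebesgue_measure]_(s in `[a, b]) f s +
  \int[lebesgue_measure]_(s in `[b, b + h]) f s.
Proof.
move=> rf fM a0 ab h0; apply/eqP; rewrite [eqbRHS]addrC -subr_eq; apply/eqP.
have ibh : (BRight b <= BRight (b + h))%O by rewrite bnd_simp lerDl.
have iab : (BLeft a <= BRight b)%O by rewrite bnd_simp.
rewrite (Rintegral_itvB (@integrable_path f M a (b + h) rf fM a0) iab ibh).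
rewrite Rintegral_itv_obnd_cbnd//.
apply: (integrableS _ _ _ (@integrable_path f M a (b + h) rf fM a0)) => //.
by apply: subset_itvr; rewrite bnd_simp.
Qed.

Lemma path_integral_bounds_on f (m M B a h : R) : right_continuous_from0 f ->
  (forall t, 0 <= t -> `|f t| <= B) ->
  (forall t, a <= t <= a + h -> m <= f t <= M) -> 0 <= a -> 0 <= h ->
  m * h <= \int[lebesgue_measure]_(s in `[a, a + h]) f s <= M * h.
Proof.
move=> rf fB fM a0 h0.
have cstE (k : R) : \int[lebesgue_measure]_(s in `[a, a + h]) (cst k s) = k * h.
  rewrite Rintegral_cst//= lebesgue_measure_itv/= lte_fin; case: ifPn => [_|].
    by rewrite -EFinB/=; congr (_ * _); lra.
  rewrite -leNgt gerDl => h0'; rewrite /= (_ : h = 0) ?mulr0//.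
  by apply/eqP; rewrite eq_le h0 h0'.
have ic (k : R) : lebesgue_measure.-integrable `[a, a + h] (EFin \o cst k).
  apply: (@integrable_path (cst k) `|k|) => // t _; exact: cvg_cst.
rewrite -(cstE m) -(cstE M); apply/andP; split; apply: le_Rintegral => //.
- exact: integrable_path fB a0.
- by move=> t /=; rewrite in_itv/= => /fM /andP[].
- exact: integrable_path fB a0.
- by move=> t /=; rewrite in_itv/= => /fM /andP[].
Qed.

Lemma path_integral_bounds f (m M a h : R) : right_continuous_from0 f ->
  (forall t, 0 <= t -> m <= f t <= M) -> 0 <= a -> 0 <= h ->
  m * h <= \int[lebesgue_measure]_(s in `[a, a + h]) f s <= M * h.
Proof.
move=> rf fM a0 h0.
apply: (@path_integral_bounds_on f m M (`|m| + `|M|)) => //.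
  by move=> t /fM /andP[]; rewrite ler_norml; move: (ler_norm M) (ler_norm (- m));
     rewrite normrN; move: (normr_ge0 m) (normr_ge0 M); lra.
by move=> t /andP[/(le_trans a0) /fM].
Qed.

Lemma path_integral_right_continuous f (M : R) : right_continuous_from0 f ->
  (forall t, 0 <= t -> 0 <= f t <= M) ->
  right_continuous_from0 (fun t => \int[lebesgue_measure]_(s in `[0, t]) f s).
Proof.
move=> rf fM t t0.
have fM' s : 0 <= s -> `|f s| <= M by move=> /fM /andP[? ?]; rewrite ger0_norm.
apply/cvg_at_rightP => u [ut ucvg].
apply: (@squeeze_cvgr _ _ _ _ (fun=> \int[lebesgue_measure]_(s in `[0, t]) f s)
   (fun n => \int[lebesgue_measure]_(s in `[0, t]) f s + M * (u n - t))).
- apply: nearW => n.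
  have un0 : 0 <= u n - t by rewrite subr_ge0 ltW.
  have -> : u n = t + (u n - t) by rewrite addrC subrK.
  rewrite (@path_integralD f M 0 t (u n - t))//.
  have /andP[] := @path_integral_bounds f 0 M t (u n - t) rf fM t0 un0.
  by rewrite mul0r lerDl lerD2l [t + _]addrC addrK => -> ->.
- exact: cvg_cst.
- rewrite -[X in _ --> X]addr0; apply: cvgD; first exact: cvg_cst.
  rewrite -[X in _ --> X](mulr0 M); apply: cvgMr.
  by rewrite -(subrr t); apply: cvgB => //; exact: cvg_cst.
Qed.

End path_integral.

(** * The Markov property in integral form *)

Section sub_sigma_algebra.
Context {d : measure_display} {T : measurableType d} {R : realType}.
Context (S : set_system T).
Hypothesis sS : sigma_algebra setT S.

Lemma generated_measurableE (A : set T) :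
  measurable (A : set (g_sigma_algebraType S)) = S A.
Proof. by rewrite /measurable/= sigma_algebra_id. Qed.

Hypothesis Sm : S `<=` measurable.

Lemma sub_measurable_fun d' (T' : sigmaRingType d') (Z : T -> T') :
  measurable_fun setT (Z : g_sigma_algebraType S -> T') -> measurable_fun setT Z.
Proof.
move=> mZ _ B mB; rewrite setTI; apply: Sm; rewrite -generated_measurableE.
by rewrite -[X in measurable X]setTI; exact: mZ.
Qed.

(** The weights for which the conclusion holds contain the indicators of [S] and
are stable under sums and increasing limits. *)
Lemma eq_integral_weight (mu : {measure set T -> \bar R}) (Y1 Y2 Z : T -> R) :
  measurable_fun setT Y1 -> measurable_fun setT Y2 ->
  (forall w, 0 <= Y1 w) -> (forall w, 0 <= Y2 w) ->
  (forall A, S A -> \int[mu]_(w in A) (Y1 w)%:E = \int[mu]_(w in A) (Y2 w)%:E)%E ->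
  measurable_fun setT (Z : g_sigma_algebraType S -> R) -> (forall w, 0 <= Z w) ->
  (\int[mu]_w (Z w * Y1 w)%:E = \int[mu]_w (Z w * Y2 w)%:E)%E.
Proof.
move=> mY1 mY2 Y10 Y20 Y12 mZ Z0.
pose H (V : g_sigma_algebraType S -> \bar R) :=
  (\int[mu]_w (V w * (Y1 w)%:E) = \int[mu]_w (V w * (Y2 w)%:E))%E.
suff : H (fun w => (Z w)%:E) by rewrite /H; under eq_integral do rewrite -EFinM;
  under [in RHS]eq_integral do rewrite -EFinM.
have subm (V : g_sigma_algebraType S -> \bar R) : measurable_fun setT V ->
    measurable_fun setT (V : T -> \bar R) by exact: sub_measurable_fun.
have mY (Y : T -> R) : measurable_fun setT Y -> measurable_fun setT (EFin \o Y).
  by move=> mY; apply/measurable_EFinP.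
apply: (@ge0_measurable_ind _ (g_sigma_algebraType S) R H); last 2 first.
- exact/measurable_EFinP.
- by move=> w; rewrite lee_fin.
- move=> A k mA k0; rewrite /H.
  have SA : S A by rewrite -generated_measurableE.
  have mA' : measurable (A : set T) by exact: Sm.
  have aux (B : set T) (Y : T -> R) : measurable B -> measurable_fun setT Y ->
      (forall w, 0 <= Y w) ->
      (\int[mu]_w ((k * \1_B w)%:E * (Y w)%:E) = k%:E * \int[mu]_(w in B) (Y w)%:E)%E.
    move=> mB mYY YY0; rewrite (integral_mkcond B) -ge0_integralZl_EFin//; last 2 first.
    - by move=> w _; apply: erestrict_ge0 => w' _; rewrite lee_fin.
    - apply/(measurable_restrictT _ _).1 => //.
      by apply: measurable_funTS; exact: mY.
    apply: eq_integral => w _; rewrite patchE indicE.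
    case: (w \in B); first by rewrite mulr1.
    by rewrite mulr0 mul0e mule0.
  by rewrite (aux A Y1)// (aux A Y2)// Y12.
- move=> V1 V2 mV1 V10 mV2 V20 H1 H2; rewrite /H.
  have aux (Y : T -> R) : measurable_fun setT Y -> (forall w, 0 <= Y w) ->
      (\int[mu]_w ((V1 w + V2 w) * (Y w)%:E) =
       \int[mu]_w (V1 w * (Y w)%:E) + \int[mu]_w (V2 w * (Y w)%:E))%E.
    move=> mYY YY0; under eq_integral do rewrite ge0_muleDl//.
    apply: ge0_integralD => //.
    - by move=> w _; rewrite mule_ge0// lee_fin.
    - by apply: emeasurable_funM; [exact: subm|exact: mY].
    - by move=> w _; rewrite mule_ge0// lee_fin.
    - by apply: emeasurable_funM; [exact: subm|exact: mY].
  by rewrite !aux// H1 H2.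
move=> V_ V mV_ V_0 ndV cV HV; rewrite /H.
have aux (Y : T -> R) : measurable_fun setT Y -> (forall w, 0 <= Y w) ->
    (\int[mu]_w (V_ n w * (Y w)%:E) @[n --> \oo] --> \int[mu]_w (V w * (Y w)%:E))%E.
  move=> mYY YY0.
  have -> : (\int[mu]_w (V w * (Y w)%:E) =
      \int[mu]_w (limn (fun n => V_ n w * (Y w)%:E)))%E.
    apply: eq_integral => w _; apply/esym/cvg_lim => //.
    by apply: cvgeZr => //; exact: cV.
  apply: cvg_monotone_convergence => //.
  - by move=> n; apply: emeasurable_funM; [apply: subm; exact: mV_|exact: mY].
  - by move=> n w _; rewrite mule_ge0// lee_fin.
  - by move=> w _ m n mn; rewrite lee_wpmul2r ?lee_fin//; exact: ndV.
have c2 := aux _ mY2 Y20.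
have e : (fun n => \int[mu]_w (V_ n w * (Y2 w)%:E))%E =
         (fun n => \int[mu]_w (V_ n w * (Y1 w)%:E))%E by apply/funext => n; rewrite (HV n).
rewrite e in c2.
exact: (cvg_unique _ (aux _ mY1 Y10) c2).
Qed.

End sub_sigma_algebra.

Section markov.
Context {R : realType} {d : measure_display} {Omega : measurableType d}.
Context {E : pmetricType R}.
Context (F : R -> set_system Omega) (X : R -> Omega -> E).
Context (P : E -> probability Omega R).
Hypothesis X_markov : standard_markov_process F X P.

Notation Fspace t := (g_sigma_algebraType (F t)).

Let sF t : 0 <= t -> sigma_algebra setT (F t).
Proof. exact: (filtration_sigma_algebra (smp_filtration X_markov)). Qed.
Let Fm t : 0 <= t -> F t `<=` measurable.
Proof. exact: (filtration_measurable (smp_filtration X_markov)). Qed.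

Lemma continuous_measurable_borel (f : E -> R) : continuous f ->
  measurable_fun [set: borel E] (f : borel E -> R).
Proof.
move=> cf; apply: (measurability _ (RGenOpens.measurableE R)).
move=> _ [_ [a [b ->] <-]]; rewrite setTI.
apply: sub_sigma_algebra; move/continuousP : cf; apply.
exact: interval_open.
Qed.

Lemma adapted_measurable t : 0 <= t ->
  measurable_fun setT (X t : Fspace t -> borel E).
Proof.
move=> t0 _ B mB; rewrite setTI; rewrite generated_measurableE; last exact: sF.
exact: (smp_adapted X_markov).
Qed.

Lemma F_measurable_fun t d' (T' : sigmaRingType d') (Z : Omega -> T') : 0 <= t ->
  measurable_fun setT (Z : Fspace t -> T') -> measurable_fun setT Z.
Proof. by move=> t0; apply: sub_measurable_fun; [exact: sF|exact: Fm]. Qed.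

Lemma F_measurable_funS s t d' (T' : sigmaRingType d') (Z : Omega -> T') :
  0 <= s -> s <= t ->
  measurable_fun setT (Z : Fspace s -> T') -> measurable_fun setT (Z : Fspace t -> T').
Proof.
move=> s0 st mZ _ B mB; rewrite setTI generated_measurableE; last exact/sF/(le_trans s0).
apply: (filtration_le (smp_filtration X_markov) s0 st).
have := mZ measurableT _ mB; rewrite setTI generated_measurableE//; exact: sF.
Qed.

Lemma measurable_X t : 0 <= t -> measurable_fun setT (X t : Omega -> borel E).
Proof. by move=> t0; apply: F_measurable_fun (adapted_measurable t0). Qed.

Lemma F_measurable_comp t (f : E -> R) : 0 <= t ->
  measurable_fun [set: borel E] (f : borel E -> R) ->
  measurable_fun setT ((fun w => f (X t w)) : Fspace t -> R).
Proof.
by move=> t0 mf; apply: (measurableT_comp mf (adapted_measurable t0)).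
Qed.

Lemma measurable_comp_X t (f : E -> R) : 0 <= t ->
  measurable_fun [set: borel E] (f : borel E -> R) ->
  measurable_fun setT (fun w => f (X t w)).
Proof.
by move=> t0 mf; apply: (measurableT_comp mf (measurable_X t0)).
Qed.

(** Singletons are closed, hence Borel, so that [smp_start] is a statement about
an event. *)
Lemma start_ae y : {ae P y, forall w, X 0 w = y}.
Proof.
have m0 : measurable (X 0 @^-1` [set y]).
  have my : measurable ([set y] : set (borel E)).
    rewrite -[X in measurable X]setCK; apply: measurableC.
    apply: sub_sigma_algebra; apply: closed_openC.
    by apply: accessible_closed_set1; apply/hausdorff_accessible/metric_hausdorff.
  by have := measurable_X (lexx 0) measurableT my; rewrite setTI.
exists (~` (X 0 @^-1` [set y])); split; first exact: measurableC.
- by rewrite probability_setC// (smp_start X_markov) subee.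
- by move=> w /= /contra_not; apply.
Qed.

Lemma Rintegral_ae_eq (mu : probability Omega R) (f1 f2 : Omega -> R) :
  measurable_fun setT f1 -> measurable_fun setT f2 ->
  {ae mu, forall w, f1 w = f2 w} -> \int[mu]_w f1 w = \int[mu]_w f2 w.
Proof.
move=> m1 m2 f12; rewrite /Rintegral; congr fine.
apply: ae_eq_integral => //; [exact/measurable_EFinP|exact/measurable_EFinP|].
by apply: filterS f12 => w /= -> _.
Qed.

(** On these functions the transition operators and the operators [growth] below
act as on bounded ones; since [s] ranges over all times, the operators
preserve the class. *)
Definition everywhere_integrable (f : E -> R) :=
  [/\ measurable_fun [set: borel E] (f : borel E -> R), forall y, 0 <= f y &
   forall s y, 0 <= s -> (P y).-integrable setT (fun w => (f (X s w))%:E)].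

Lemma transition_start (f : E -> R) y :
  measurable_fun [set: borel E] (f : borel E -> R) ->
  transition_semigroup X P 0 f y = f y.
Proof.
move=> mf; rewrite /transition_semigroup.
rewrite (@Rintegral_ae_eq (P y) _ (cst (f y))) ?Rintegral_cst//.
- by have e := @probability_setT _ _ _ (P y); rewrite /= in e *; rewrite e mulr1.
- exact: measurable_comp_X.
- by apply: filterS (start_ae y) => w ->.
Qed.

(** A constant time is a stopping time. *)
Lemma markov_set x t s A (B : set (borel E)) : 0 <= t -> 0 <= s -> F t A ->
  measurable B ->
  (P x (A `&` (X (t + s) @^-1` B)) =
   \int[P x]_(w in A) P (X t w) (X s @^-1` B))%E.
Proof.
move=> t0 s0 FA mB.
have st : stopping_time F (fun=> t%:E).
  split => [w|u u0]; first by rewrite lee_fin.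
  have [F0 FC _] := sF u0.
  have [tu|ut] := leP t u.
    rewrite (_ : [set _ | _] = setT); first by rewrite -(setD0 setT); exact: FC.
    by apply/seteqP; split => w //= _; rewrite lee_fin.
  rewrite (_ : [set _ | _] = set0)//.
  by apply/seteqP; split => w //=; rewrite lee_fin leNgt ut.
have sA : stopped_algebra F (fun=> t%:E) A.
  split; first exact: (Fm t0).
  move=> u u0; have [tu|ut] := leP t u.
    rewrite (_ : [set _ | _] = setT).
      by rewrite setIT; exact: (filtration_le (smp_filtration X_markov) t0 tu).
    by apply/seteqP; split => w //= _; rewrite lee_fin.
  rewrite (_ : [set _ | _] = set0) ?setI0; first by have [] := sF u0.
  by apply/seteqP; split => w //=; rewrite lee_fin leNgt ut.
have := smp_strong_markov X_markov x st sA s0 mB.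
have -> : A `&` [set _ | (t%:E < +oo)%E] = A.
  by apply/seteqP; split => w /=; [case|split => //; exact: ltry].
move=> <-; congr (P x _); apply/seteqP; split => w /= [Aw Bw]; split => //.
  by split => //; exact: ltry.
by case: Bw.
Qed.

(** For indicators this is the measurability of the kernel and [markov_set]; both
claims pass to sums and to increasing limits. *)
Lemma markov_integral (f : E -> \bar R) s : 0 <= s ->
  measurable_fun [set: borel E] (f : borel E -> \bar R) ->
  (forall y, 0 <= f y)%E ->
  measurable_fun [set: borel E] ((fun y => \int[P y]_w f (X s w))%E : borel E -> \bar R) /\
  forall x t A, 0 <= t -> F t A ->
    (\int[P x]_(w in A) f (X (t + s) w) =
     \int[P x]_(w in A) \int[P (X t w)]_w' f (X s w'))%E.
Proof.
move=> s0 mf f0.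
pose H (f : borel E -> \bar R) :=
  measurable_fun [set: borel E] ((fun y => \int[P y]_w f (X s w))%E : borel E -> \bar R) /\
  forall x t A, 0 <= t -> F t A ->
    (\int[P x]_(w in A) f (X (t + s) w) =
     \int[P x]_(w in A) \int[P (X t w)]_w' f (X s w'))%E.
have mfX (k : borel E -> \bar R) t (D : set Omega) : 0 <= t -> measurable_fun setT k ->
    measurable_fun D (fun w => k (X t w)).
  move=> t0 mk; apply: measurable_funTS.
  exact: (measurableT_comp mk (measurable_X t0)).
suff : H f by [].
apply: (@ge0_measurable_ind _ (borel E) R H) mf f0.
- move=> B k mB k0; rewrite /H.
  have mXB t : 0 <= t -> measurable (X t @^-1` B).
    by move=> t0; rewrite -[X in measurable X]setTI; apply: (measurable_X t0).
  have aux y t A : 0 <= t -> measurable A ->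
      (\int[P y]_(w in A) (k * \1_B (X t w))%:E = k%:E * P y (A `&` X t @^-1` B))%E.
    move=> t0 mA; under eq_integral do rewrite EFinM.
    rewrite ge0_integralZl_EFin//.
    - by rewrite (_ : (fun x => _) = (fun x => (\1_(X t @^-1` B) x)%:E)) ?integral_indic// 1?setIC//; apply: mXB.
    - have mi : measurable_fun setT (fun y : borel E => (\1_B y)%:E : \bar R).
        by apply/measurable_EFinP/measurable_indic.
      by have := mfX _ t A t0 mi.
  split.
    under eq_fun do rewrite aux// setTI.
    apply: measurable_funeM; exact: (smp_kernel X_markov).
  move=> x t A t0 FA; have mA := Fm t0 FA.
  rewrite aux ?addr_ge0// markov_set//.
  under [in RHS]eq_integral do rewrite aux// setTI.
  rewrite ge0_integralZl_EFin//.
  apply: (mfX (fun y : borel E => P y (X s @^-1` B))) => //; exact: (smp_kernel X_markov).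
- move=> f1 f2 m1 f10 m2 f20 [mH1 H1] [mH2 H2]; rewrite /H.
  have aux y t A : 0 <= t -> measurable A -> (\int[P y]_(w in A) (f1 (X t w) + f2 (X t w)) =
      \int[P y]_(w in A) f1 (X t w) + \int[P y]_(w in A) f2 (X t w))%E.
    by move=> t0 mA; apply: ge0_integralD => //; exact: mfX.
  split.
    by under eq_fun do rewrite aux//; apply: emeasurable_funD.
  move=> x t A t0 FA; have mA := Fm t0 FA.
  rewrite aux ?addr_ge0// H1// H2//.
  under [in RHS]eq_integral do rewrite aux//.
  have n1 := mfX _ t A t0 mH1; have n2 := mfX _ t A t0 mH2.
  have q1 w : (0 <= \int[P (X t w)]_w' f1 (X s w'))%E by apply: integral_ge0 => w' _; exact: f10.
  have q2 w : (0 <= \int[P (X t w)]_w' f2 (X s w'))%E by apply: integral_ge0 => w' _; exact: f20.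
  by apply/esym/ge0_integralD.
move=> f_ k mf_ f_0 ndf cf Hf; rewrite /H.
have aux y t A : 0 <= t -> measurable A ->
   (\int[P y]_(w in A) f_ n (X t w) @[n --> \oo] --> \int[P y]_(w in A) k (X t w))%E.
  move=> t0 mA; have -> : (\int[P y]_(w in A) k (X t w) =
      \int[P y]_(w in A) limn (fun n => f_ n (X t w)))%E.
    by apply: eq_integral => w _; apply/esym/cvg_lim => //; exact: cf.
  by apply: cvg_monotone_convergence => // n; exact: mfX.
have aux' y : (\int[P y]_w f_ n (X s w) @[n --> \oo] --> \int[P y]_w k (X s w))%E.
  exact: aux.
split.
  by apply: emeasurable_fun_cvg (fun n => (Hf n).1) _ => y _; exact: aux'.
move=> x t A t0 FA; have mA := Fm t0 FA.
have c1 := aux x (t + s) A (addr_ge0 t0 s0) mA.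
have e : (fun n => \int[P x]_(w in A) f_ n (X (t + s) w))%E =
    (fun n => \int[P x]_(w in A) \int[P (X t w)]_w' f_ n (X s w'))%E.
  by apply/funext => n; exact: (Hf n).2.
rewrite e in c1; apply: (cvg_unique _ c1) => //.
have -> : (\int[P x]_(w in A) (\int[P (X t w)]_w' k (X s w')) =
    \int[P x]_(w in A) limn (fun n => \int[P (X t w)]_w' f_ n (X s w')))%E.
  by apply: eq_integral => w _; apply/esym/cvg_lim => //; exact: aux'.
apply: cvg_monotone_convergence => //.
- by move=> n; apply: (mfX (fun y => \int[P y]_w f_ n (X s w))%E) => //; exact: (Hf n).1.
- by move=> n w _; exact: integral_ge0.
- move=> w _ m n mn; apply: ge0_le_integral => //; try exact: mfX.
  by move=> *; exact: ndf.
Qed.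

End markov.

(** * The Feynman-Kac semigroup *)

Section running.
Context {R : realType} {d : measure_display} {Omega : measurableType d}.
Context {E : pmetricType R}.
Context (F : R -> set_system Omega) (X : R -> Omega -> E).
Context (P : E -> probability Omega R) (g : E -> R) (c M : R).
Hypothesis X_markov : standard_markov_process F X P.
Hypothesis g_cont : continuous g.
Hypothesis c_ge0 : 0 <= c.
Hypothesis g_bounds : forall x, c <= g x <= M.

Notation Fspace t := (g_sigma_algebraType (F t)).

Lemma path_right_continuous (f : E -> R) w : continuous f ->
  right_continuous_from0 (fun t => f (X t w)).
Proof.
move=> cf t t0; have [rX _] := smp_cadlag X_markov w.
by apply: continuous_cvg; [exact: cf|exact: rX].
Qed.

Let M_ge0 : 0 <= M.
Proof. by have /andP[h1 h2] := g_bounds point; rewrite (le_trans c_ge0)// (le_trans h1). Qed.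

Let g_path_norm w t : 0 <= t -> `|g (X t w)| <= M.
Proof.
by move=> _; have /andP[h1 h2] := g_bounds (X t w); rewrite ger0_norm// (le_trans c_ge0).
Qed.

Lemma running0 w : running X g 0 w = 0.
Proof. by rewrite /running set_itv1 Rintegral_set1. Qed.

Lemma runningD t h w : 0 <= t -> 0 <= h ->
  running X g (t + h) w = running X g t w +
    \int[lebesgue_measure]_(s in `[t, t + h]) g (X s w).
Proof.
move=> t0 h0; rewrite /running (@path_integralD _ (fun s => g (X s w)) M)//.
  exact: path_right_continuous.
by move=> s; exact: g_path_norm.
Qed.

Lemma running_increment t h w : 0 <= t -> 0 <= h ->
  c * h <= running X g (t + h) w - running X g t w <= M * h.
Proof.
move=> t0 h0; rewrite runningD// addrAC subrr add0r.
by apply: (@path_integral_bounds _ (fun s => g (X s w))) => //; exact: path_right_continuous.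
Qed.

Lemma running_bounds t w : 0 <= t -> c * t <= running X g t w <= M * t.
Proof.
by move=> t0; have := running_increment w (lexx 0) t0; rewrite add0r running0 subr0.
Qed.

Lemma running_ge0 t w : 0 <= t -> 0 <= running X g t w.
Proof. by move=> t0; have /andP[+ _] := running_bounds w t0; apply: le_trans; rewrite mulr_ge0. Qed.

Lemma running_nondecreasing s t w : 0 <= s -> s <= t -> running X g s w <= running X g t w.
Proof.
move=> s0 st; have h0 : 0 <= t - s by rewrite subr_ge0.
have /andP[h1 _] := running_increment w s0 h0.
rewrite [s + _]addrC subrK in h1.
by rewrite -subr_ge0; apply: le_trans h1; exact: mulr_ge0.
Qed.

Lemma running_right_continuous w : right_continuous_from0 (fun t => running X g t w).
Proof.
apply: (@path_integral_right_continuous _ (fun s => g (X s w)) M).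
  exact: path_right_continuous.
by move=> t t0; have /andP[h1 ->] := g_bounds (X t w); rewrite (le_trans c_ge0).
Qed.

Lemma cvg_running_riemann t h w : 0 <= t -> 0 < h ->
  \sum_(i < n.+1) h / n.+1%:R * g (X (t + h / n.+1%:R * i.+1%:R) w) @[n --> \oo] -->
  running X g (t + h) w - running X g t w.
Proof.
move=> t0 h0; rewrite runningD// ?ltW// addrAC subrr add0r.
apply: (@cvg_riemann_sum _ (fun s => g (X s w)) _ _ M) => //.
- by move=> s ts; apply: path_right_continuous => //; exact: le_trans ts.
- by move=> s ts; apply: g_path_norm; exact: le_trans ts.
Qed.

Lemma riemann_bounds (delta t : R) n w : 0 <= delta ->
  0 <= \sum_(i < n) delta * g (X (t + delta * i.+1%:R) w) <= M * (delta * n%:R).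
Proof.
move=> d0; apply/andP; split.
  apply: sumr_ge0 => i _; rewrite mulr_ge0//.
  by have /andP[h1 _] := g_bounds (X (t + delta * i.+1%:R) w); rewrite (le_trans c_ge0).
rewrite (_ : M * _ = \sum_(i < n) delta * M); last first.
  by rewrite sumr_const card_ord -mulr_natr; ring.
apply: ler_sum => i _; rewrite ler_wpM2l//.
by have /andP[_ h1] := g_bounds (X (t + delta * i.+1%:R) w).
Qed.

(** The integral up to [t] is a limit of Riemann sums, which involve the states
at times up to [t] only. *)
Lemma F_measurable_running t : 0 <= t ->
  measurable_fun setT (running X g t : Fspace t -> R).
Proof.
rewrite le_eqVlt => /predU1P[<-|t0].
  by rewrite (_ : running X g 0 = cst 0)//; apply/funext => w; rewrite running0.
apply: (@measurable_fun_cvg _ (Fspace t) R setT (fun n w =>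
    \sum_(i < n.+1) t / n.+1%:R * g (X (0 + t / n.+1%:R * i.+1%:R) w))); last first.
  by move=> w _; have := @cvg_running_riemann 0 t w (lexx 0) t0; rewrite add0r running0 subr0.
move=> n; apply: measurable_sum => i; apply: measurable_funM => //.
have i0 : 0 <= 0 + t / n.+1%:R * i.+1%:R by rewrite add0r mulr_ge0 ?divr_ge0 ?ltW.
apply: (F_measurable_funS X_markov i0).
  by rewrite add0r mulrAC ler_pdivrMr// ler_pM2l// ler_nat ltn_ord.
by apply: (F_measurable_comp X_markov) => //; exact: continuous_measurable_borel.
Qed.

Lemma measurable_running t : 0 <= t -> measurable_fun setT (running X g t).
Proof. by move=> t0; apply: (F_measurable_fun X_markov t0); exact: F_measurable_running. Qed.

Local Notation D := (everywhere_integrable X P).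

Lemma transitionE s (f : E -> R) y : 0 <= s -> D f ->
  (transition_semigroup X P s f y)%:E = (\int[P y]_w (f (X s w))%:E)%E.
Proof.
move=> s0 [_ _ intf]; rewrite /transition_semigroup /Rintegral fineK//.
by apply: integrable_fin_num => //; exact: intf.
Qed.

Lemma transition_ge0 s (f : E -> R) y : D f -> 0 <= transition_semigroup X P s f y.
Proof. by move=> [_ f0 _]; apply: Rintegral_ge0. Qed.

Lemma measurable_transition s (f : E -> R) : 0 <= s -> D f ->
  measurable_fun [set: borel E] (transition_semigroup X P s f : borel E -> R).
Proof.
move=> s0 [mf f0 intf].
have [] := @markov_integral _ _ _ _ _ _ _ X_markov (EFin \o f) s s0.
- exact/measurable_EFinP.
- by move=> y; rewrite lee_fin.
by move=> mt _; apply: (measurableT_comp (fine_measurable measurableT) mt).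
Qed.

Lemma markov_weight x t s (f : E -> R) (Z : Omega -> R) : 0 <= t -> 0 <= s -> D f ->
  measurable_fun setT (Z : Fspace t -> R) -> (forall w, 0 <= Z w) ->
  (\int[P x]_w (Z w * f (X (t + s) w))%:E =
   \int[P x]_w (Z w * transition_semigroup X P s f (X t w))%:E)%E.
Proof.
move=> t0 s0 Df mZ Z0; have [mf f0 intf] := Df.
have ts0 : 0 <= t + s by rewrite addr_ge0.
apply: (@eq_integral_weight _ _ _ (F t)) => //.
- exact: (filtration_sigma_algebra (smp_filtration X_markov)).
- exact: (filtration_measurable (smp_filtration X_markov)).
- exact: (measurable_comp_X X_markov).
- by apply: (measurable_comp_X X_markov) => //; exact: measurable_transition.
- by move=> w; exact: transition_ge0.
move=> A FA.
have [] := @markov_integral _ _ _ _ _ _ _ X_markov (EFin \o f) s s0.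
- exact/measurable_EFinP.
- by move=> y; rewrite lee_fin.
move=> _ /(_ x t A t0 FA) /= ->.
by apply: eq_integral => w _; rewrite transitionE.
Qed.

Lemma ge0_integrable (mu : probability Omega R) (f : Omega -> R) :
  measurable_fun setT f -> (forall w, 0 <= f w) ->
  (\int[mu]_w (f w)%:E < +oo)%E -> mu.-integrable setT (EFin \o f).
Proof.
move=> mf f0 fo; apply/integrableP; split; first exact/measurable_EFinP.
by under eq_integral do rewrite /= ger0_norm//.
Qed.

Lemma integrable_ltoo (mu : probability Omega R) (f : Omega -> R) :
  (forall w, 0 <= f w) -> mu.-integrable setT (EFin \o f) ->
  (\int[mu]_w (f w)%:E < +oo)%E.
Proof. by move=> f0 fi; apply: integrable_lty. Qed.

Lemma transition_everywhere_integrable s (f : E -> R) : 0 <= s -> D f -> D (transition_semigroup X P s f).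
Proof.
move=> s0 Df; split.
- exact: measurable_transition.
- by move=> y; exact: transition_ge0.
move=> r y r0; apply: ge0_integrable.
- by apply: (measurable_comp_X X_markov) => //; exact: measurable_transition.
- by move=> w; exact: transition_ge0.
have := @markov_weight y r s f (cst 1) r0 s0 Df (@measurable_cst _ _ _ _ _ _) (fun=> ler01).
under eq_integral do rewrite mul1r; under [in RHS]eq_integral do rewrite mul1r.
move=> <-; apply: integrable_ltoo; first by have [_ f0 _] := Df.
by have [_ _] := Df; apply; exact: addr_ge0.
Qed.

Lemma everywhere_integrable_le (f k : E -> R) : measurable_fun [set: borel E] (f : borel E -> R) ->
  (forall y, 0 <= f y <= k y) -> D k -> D f.
Proof.
move=> mf fk [_ _ intk]; split => //; first by move=> y; have /andP[] := fk y.
move=> s y s0; apply: (@dominated_integrable_fun _ _ _ _ _ (fun w => k (X s w))) => //.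
- exact: (measurable_comp_X X_markov).
- by move=> w; have /andP[f0 ?] := fk (X s w); rewrite ger0_norm.
- exact: intk.
Qed.

Lemma everywhere_integrableZ (f : E -> R) (k : R) : 0 <= k -> D f -> D (fun y => k * f y).
Proof.
move=> k0 [mf f0 intf]; split.
- by apply: measurable_funM.
- by move=> y; rewrite mulr_ge0.
by move=> s y s0; apply: integrable_scale; exact: intf.
Qed.

(** One step of length [delta] in the product formula for [growth], where the
potential acts at the end of the step. *)
Definition euler_step (delta : R) (f : E -> R) : E -> R :=
  transition_semigroup X P delta (fun z => expR (delta * g z) * f z).

Lemma everywhere_integrable_weight delta f : 0 <= delta -> D f -> D (fun z => expR (delta * g z) * f z).
Proof.
move=> d0 Df; have [mf f0 _] := Df.
apply: (@everywhere_integrable_le _ (fun y => expR (delta * M) * f y)); last first.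
- by apply: everywhere_integrableZ => //; exact: expR_ge0.
- move=> y; rewrite mulr_ge0 ?expR_ge0//= ler_wpM2r// ler_expR ler_wpM2l//.
  by have /andP[] := g_bounds y.
- apply: measurable_funM => //; apply: measurableT_comp => //.
  by apply: measurable_funM => //; exact: continuous_measurable_borel.
Qed.

Lemma euler_step_everywhere_integrable delta f : 0 <= delta -> D f -> D (euler_step delta f).
Proof. by move=> d0 Df; apply: transition_everywhere_integrable => //; exact: everywhere_integrable_weight. Qed.

Lemma iter_euler_step_everywhere_integrable delta n f : 0 <= delta -> D f -> D (iter n (euler_step delta) f).
Proof. by move=> d0 Df; elim: n => //= n; exact: euler_step_everywhere_integrable. Qed.

(** The Markov property is applied at each node of the Riemann sum. *)
Lemma markov_riemann x delta (f : E -> R) n : 0 <= delta -> D f ->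
  forall t (Z : Omega -> R), 0 <= t ->
  measurable_fun setT (Z : Fspace t -> R) -> (forall w, 0 <= Z w) ->
  (\int[P x]_w (Z w * (expR (\sum_(i < n) delta * g (X (t + delta * i.+1%:R) w)) *
      f (X (t + delta * n%:R) w)))%:E =
   \int[P x]_w (Z w * iter n (euler_step delta) f (X t w))%:E)%E.
Proof.
move=> d0 Df; elim: n => [|n IH] t Z t0 mZ Z0.
  by apply: eq_integral => w _; rewrite big_ord0 expR0 mul1r mulr0 addr0.
rewrite iterS.
have Dn := iter_euler_step_everywhere_integrable n d0 Df.
rewrite -(@markov_weight x t delta _ Z t0 d0 (everywhere_integrable_weight d0 Dn) mZ Z0).
have td0 : 0 <= t + delta by rewrite addr_ge0.
have mZ' : measurable_fun setT
    ((fun w => Z w * expR (delta * g (X (t + delta) w))) : Fspace (t + delta) -> R).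
  apply: measurable_funM; first by apply: (F_measurable_funS X_markov t0 _ mZ); rewrite lerDl.
  apply: measurableT_comp => //; apply: measurable_funM => //.
  by apply: (F_measurable_comp X_markov) => //; exact: continuous_measurable_borel.
under [RHS]eq_integral do rewrite mulrA.
rewrite -(IH _ _ td0 mZ'); last by move=> w; rewrite mulr_ge0 ?expR_ge0.
apply: eq_integral => w _; rewrite big_ord_recl/= mulr1 expRD -!mulrA.
congr ((_ * (_ * (expR _ * f (X _ w))))%:E).
  apply: eq_bigr => i _; congr (_ * g (X _ w)).
  by rewrite /bump/= add1n -addrA -[in RHS]natr1 -[in LHS]natr1; congr (_ + _); rewrite -natr1; ring.
by rewrite -natr1; ring.
Qed.

(** The Feynman-Kac operator with potential [g]. *)
Definition growth (h : R) (f : E -> R) (y : E) : R :=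
  \int[P y]_w (expR (running X g h w) * f (X h w)).

Lemma iter_euler_stepE delta n f y : 0 <= delta -> D f ->
  iter n (euler_step delta) f y =
  \int[P y]_w (expR (\sum_(i < n) delta * g (X (0 + delta * i.+1%:R) w)) *
      f (X (delta * n%:R) w)).
Proof.
move=> d0 Df.
have := @markov_riemann y delta f n d0 Df 0 (cst 1) (lexx 0) (@measurable_cst _ _ _ _ _ _) (fun=> ler01).
under eq_integral do rewrite mul1r; under [in RHS]eq_integral do rewrite mul1r.
have [mi _ _] := iter_euler_step_everywhere_integrable n d0 Df.
have e := transition_start X_markov y mi; rewrite -[in X in _ -> X]e.
rewrite /transition_semigroup /Rintegral => <-.
by under eq_integral do rewrite add0r.
Qed.

Lemma measurable_riemann t delta n : 0 <= t -> 0 <= delta ->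
  measurable_fun setT (fun w => \sum_(i < n) delta * g (X (t + delta * i.+1%:R) w)).
Proof.
move=> t0 d0; apply: measurable_sum => i; apply: measurable_funM => //.
apply: (measurable_comp_X X_markov); first by rewrite addr_ge0// mulr_ge0.
exact: continuous_measurable_borel.
Qed.

Lemma iter_euler_step_bound h n f y : 0 < h -> D f ->
  0 <= iter n.+1 (euler_step (h / n.+1%:R)) f y <= expR (M * h) * transition_semigroup X P h f y.
Proof.
move=> h0 Df; have d0 : 0 <= h / n.+1%:R by rewrite divr_ge0// ltW.
have [mf f0 intf] := Df.
apply/andP; split; first by have [] := iter_euler_step_everywhere_integrable n.+1 d0 Df.
rewrite iter_euler_stepE// divfK// -RintegralZl//; last exact/intf/ltW.
have mfX : measurable_fun setT (fun w => f (X h w)) by apply: (measurable_comp_X X_markov) => //; exact: ltW.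
have iZ : (P y).-integrable setT (fun w => (expR (M * h) * f (X h w))%:E).
  exact/integrable_scale/intf/ltW.
have bnd w : expR (\sum_(i < n.+1) h / n.+1%:R * g (X (0 + h / n.+1%:R * i.+1%:R) w)) *
   f (X h w) <= expR (M * h) * f (X h w).
  rewrite ler_wpM2r// ler_expR.
  by have /andP[_] := @riemann_bounds (h / n.+1%:R) 0 n.+1 w d0; rewrite divfK.
apply: le_Rintegral => //.
apply: dominated_integrable_fun iZ => //.
  apply: measurable_funM => //; apply: measurableT_comp => //.
  exact: measurable_riemann.
by move=> w; rewrite ger0_norm ?mulr_ge0 ?expR_ge0.
Qed.

Lemma cvg_iter_euler_step h f y : 0 < h -> D f ->
  iter n.+1 (euler_step (h / n.+1%:R)) f y @[n --> \oo] --> growth h f y.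
Proof.
move=> h0 Df; have [mf f0 intf] := Df.
have d0 n : 0 <= h / n.+1%:R by rewrite divr_ge0// ltW.
have mfX : measurable_fun setT (fun w => f (X h w)) by apply: (measurable_comp_X X_markov) => //; exact: ltW.
have iZ : (P y).-integrable setT (fun w => (expR (M * h) * f (X h w))%:E).
  exact/integrable_scale/intf/ltW.
rewrite (_ : (fun n => _) = fun n => \int[P y]_w
  (expR (\sum_(i < n.+1) h / n.+1%:R * g (X (0 + h / n.+1%:R * i.+1%:R) w)) * f (X h w))); last first.
  by apply/funext => n; rewrite iter_euler_stepE// divfK.
apply: cvg_Rintegral iZ.
- move=> n; apply: measurable_funM => //; apply: measurableT_comp => //.
  exact: measurable_riemann.
- move=> w; apply: cvgMl; apply: continuous_cvg; first exact: continuous_expR.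
  by have := @cvg_running_riemann 0 h w (lexx 0) h0; rewrite running0 subr0 add0r.
- move=> n w; rewrite ger0_norm ?mulr_ge0 ?expR_ge0// ler_wpM2r// ler_expR.
  by have /andP[_] := @riemann_bounds (h / n.+1%:R) 0 n.+1 w (d0 n); rewrite divfK.
Qed.

Lemma growth0 f y : measurable_fun [set: borel E] (f : borel E -> R) -> growth 0 f y = f y.
Proof.
move=> mf; rewrite /growth; under eq_Rintegral do rewrite running0 expR0 mul1r.
exact: (transition_start X_markov).
Qed.

Lemma measurable_growth h f : 0 <= h -> D f ->
  measurable_fun [set: borel E] (growth h f : borel E -> R).
Proof.
rewrite le_eqVlt => /predU1P[<-|h0] Df.
  have [mf _ _] := Df.
  by rewrite (_ : growth 0 f = f)//; apply/funext => y; rewrite growth0.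
apply: (@measurable_fun_cvg _ (borel E) R setT (fun n => iter n.+1 (euler_step (h / n.+1%:R)) f)).
  by move=> n; have [] := @iter_euler_step_everywhere_integrable (h / n.+1%:R) n.+1 f (divr_ge0 (ltW h0) (ler0n _ _)) Df.
by move=> y _; exact: cvg_iter_euler_step.
Qed.

Lemma integrable_growth h f y : 0 <= h -> D f ->
  (P y).-integrable setT (EFin \o (fun w => expR (running X g h w) * f (X h w))).
Proof.
move=> h0 [mf f0 intf].
apply: (@dominated_integrable_fun _ _ _ _ _ (fun w => expR (M * h) * f (X h w))).
- apply: measurable_funM; last exact: (measurable_comp_X X_markov).
  by apply: measurableT_comp => //; exact: measurable_running.
- move=> w; rewrite ger0_norm ?mulr_ge0 ?expR_ge0// ler_wpM2r// ler_expR.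
  by have /andP[] := running_bounds w h0.
- exact/integrable_scale/intf.
Qed.

Lemma growth_le h f1 f2 y : 0 <= h -> D f1 -> D f2 -> (forall z, f1 z <= f2 z) ->
  growth h f1 y <= growth h f2 y.
Proof.
move=> h0 D1 D2 f12; apply: le_Rintegral => //; [exact: integrable_growth..|].
by move=> w _; rewrite ler_wpM2l ?expR_ge0.
Qed.

Lemma growth_bounds h f y : 0 <= h -> D f ->
  transition_semigroup X P h f y <= growth h f y <= expR (M * h) * transition_semigroup X P h f y.
Proof.
move=> h0 Df; have [mf f0 intf] := Df; have iQ := integrable_growth y h0 Df.
have iZ : (P y).-integrable setT (fun w => (expR (M * h) * f (X h w))%:E).
  exact/integrable_scale/intf.
apply/andP; split.
  apply: le_Rintegral => //; first exact: intf.
  by move=> w _; rewrite ler_peMl// -expR0 ler_expR running_ge0.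
rewrite -RintegralZl//; last exact: intf.
apply: le_Rintegral => // w _; rewrite ler_wpM2r// ler_expR.
by have /andP[] := running_bounds w h0.
Qed.

Lemma growth_everywhere_integrable h f : 0 <= h -> D f -> D (growth h f).
Proof.
move=> h0 Df; apply: (@everywhere_integrable_le _ (fun y => expR (M * h) * transition_semigroup X P h f y)).
- exact: measurable_growth.
- move=> y; have /andP[h1 ->] := growth_bounds y h0 Df.
  by rewrite (le_trans _ h1)//; exact: transition_ge0.
- by apply: everywhere_integrableZ; [exact: expR_ge0|exact: transition_everywhere_integrable].
Qed.

(** The limit, as the mesh of the Riemann sums tends to 0, of [markov_riemann];
on the right-hand side the iterates of [euler_step] converge to [growth]. *)
Lemma markov_growth x t h (f : E -> R) (Z : Omega -> R) (C : R) : 0 <= t -> 0 <= h -> D f ->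
  measurable_fun setT (Z : Fspace t -> R) -> (forall w, 0 <= Z w <= C) ->
  \int[P x]_w (Z w * (expR (running X g (t + h) w) * f (X (t + h) w))) =
  \int[P x]_w (Z w * (expR (running X g t w) * growth h f (X t w))).
Proof.
move=> t0; rewrite le_eqVlt => /predU1P[<-|h0] Df mZ ZC.
  have [mf _ _] := Df; rewrite addr0.
  by apply: eq_Rintegral => w _; rewrite growth0.
have h0' := ltW h0; have [mf f0 intf] := Df.
have th0 : 0 <= t + h by rewrite addr_ge0.
pose Z' w := Z w * expR (running X g t w).
have mZ' : measurable_fun setT (Z' : Fspace t -> R).
  by apply: measurable_funM => //; apply: measurableT_comp => //; exact: F_measurable_running.
have mZ'' : measurable_fun setT Z' by apply: (F_measurable_fun X_markov t0).
have C0 : 0 <= C by have /andP[/le_trans h1 /h1] := ZC point.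
have Z'0 w : 0 <= Z' w by rewrite mulr_ge0 ?expR_ge0//; have /andP[] := ZC w.
have Z'C w : Z' w <= C * expR (M * t).
  have /andP[h1 h2] := ZC w; rewrite ler_pM ?expR_ge0// ler_expR.
  by have /andP[] := running_bounds w t0.
have d0 n : 0 <= h / n.+1%:R by rewrite divr_ge0.
have mfX : measurable_fun setT (fun w => f (X (t + h) w)) by exact: (measurable_comp_X X_markov).
have iZ k s : 0 <= s -> D k ->
    (P x).-integrable setT (fun w => (C * expR (M * t) * (expR (M * h) * k (X s w)))%:E).
  move=> s0 [_ _ intk]; exact/integrable_scale/integrable_scale/intk.
have c1 : \int[P x]_w (Z' w * (expR (\sum_(i < n.+1) h / n.+1%:R * g (X (t + h / n.+1%:R * i.+1%:R) w)) *
      f (X (t + h) w))) @[n --> \oo] -->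
   \int[P x]_w (Z' w * (expR (running X g (t + h) w - running X g t w) * f (X (t + h) w))).
  apply: cvg_Rintegral (iZ f _ th0 Df).
  - move=> n; apply: measurable_funM => //; apply: measurable_funM => //.
    by apply: measurableT_comp => //; exact: measurable_riemann.
  - move=> w; apply: cvgMr; apply: cvgMl; apply: continuous_cvg; first exact: continuous_expR.
    exact: cvg_running_riemann.
  - move=> n w; rewrite ger0_norm; last exact: (mulr_ge0 (Z'0 w) (mulr_ge0 (expR_ge0 _) (f0 _))).
    have b : expR (\sum_(i < n.+1) h / n.+1%:R * g (X (t + h / n.+1%:R * i.+1%:R) w)) *
        f (X (t + h) w) <= expR (M * h) * f (X (t + h) w).
      rewrite ler_wpM2r// ler_expR.
      by have /andP[_] := @riemann_bounds (h / n.+1%:R) t n.+1 w (d0 n); rewrite divfK.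
    by apply: ler_pM => //; rewrite mulr_ge0 ?expR_ge0.
have c2 : \int[P x]_w (Z' w * iter n.+1 (euler_step (h / n.+1%:R)) f (X t w)) @[n --> \oo] -->
   \int[P x]_w (Z' w * growth h f (X t w)).
  apply: cvg_Rintegral (iZ _ t t0 (transition_everywhere_integrable h0' Df)).
  - move=> n; apply: measurable_funM => //; apply: (measurable_comp_X X_markov) => //.
    by have [] := iter_euler_step_everywhere_integrable n.+1 (d0 n) Df.
  - by move=> w; apply: cvgMr; exact: cvg_iter_euler_step.
  - move=> n w; have /andP[b1 b2] := iter_euler_step_bound n (X t w) h0 Df.
    by rewrite ger0_norm; [exact: ler_pM|exact: mulr_ge0].
have e : (fun n => \int[P x]_w (Z' w * (expR (\sum_(i < n.+1) h / n.+1%:R * g (X (t + h / n.+1%:R * i.+1%:R) w)) *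
      f (X (t + h) w)))) = (fun n => \int[P x]_w (Z' w * iter n.+1 (euler_step (h / n.+1%:R)) f (X t w))).
  apply/funext => n; have := @markov_riemann x (h / n.+1%:R) f n.+1 (d0 n) Df t Z' t0 mZ' Z'0.
  by rewrite divfK// /Rintegral => ->.
rewrite e in c1; have h1 := cvg_unique (@Rhausdorff R) c1 c2.
under [RHS]eq_Rintegral do rewrite mulrA.
rewrite -[RHS]h1; apply: eq_Rintegral => w _; rewrite /Z' -[RHS]mulrA; congr (_ * _).
rewrite mulrA; congr (_ * _).
by rewrite -expRD [running X g t w + _]addrC subrK.
Qed.

Lemma growth_semigroup s t f y : 0 <= s -> 0 <= t -> D f ->
  growth (s + t) f y = growth s (growth t f) y.
Proof.
move=> s0 t0 Df.
have := @markov_growth y s t f (cst 1) 1 s0 t0 Df (@measurable_cst _ _ _ _ _ _).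
have h w : 0 <= @cst Omega R 1 w <= 1 by rewrite /= ler01 lexx.
move=> /(_ h).
by under eq_Rintegral do rewrite mul1r; under [in RHS]eq_Rintegral do rewrite mul1r.
Qed.

End running.

(** * Functions vanishing at infinity *)

Section compactness.
Context {R : realType} {E : pmetricType R}.
Implicit Types (f : E -> R) (K : set E).

Lemma compact_increasing_cover K (U : nat -> set E) : compact K ->
  (forall n, open (U n)) -> (forall n, U n `<=` U n.+1) ->
  (forall x, K x -> exists n, U n x) -> exists n, K `<=` U n.
Proof.
move=> cK oU ndU cov.
have ndU' := homo_leq (r := subset) (fun _ _ => id) (fun _ _ _ AB BC y Ay => BC y (AB y Ay)) ndU.
have : \forall n \near \oo, K `<=` U n.
  move/compact_near_coveringP : cK; apply => x Kx; have [m Umx] := cov x Kx.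
  exists (U m, [set n | (m <= n)%N]) => /=.
    by split; [exact: open_nbhs_nbhs|exact: nbhs_infty_ge].
  by move=> [y n] /= [Umy mn]; exact: ndU' Umy.
by case=> N _ /(_ N (leqnn N)) KN; exists N.
Qed.

(** Compactness is used where [u n] is not yet small; off a compact, the bound
holds for one index and so for the later ones. *)
Lemma dini (u : nat -> E -> R) : (forall n, continuous (u n)) ->
  (forall n x, u n.+1 x <= u n x) ->
  (forall x e, 0 < e -> exists n, u n x < e) ->
  (forall e, 0 < e -> exists n, exists2 K, compact K & forall x, ~ K x -> u n x < e) ->
  forall e, 0 < e -> exists n, forall x, u n x < e.
Proof.
move=> cu ndu u0 uK e e0; have [m [K cK Km]] := uK e e0.
have ndu' x : nonincreasing_seq (u ^~ x) by apply/nonincreasing_seqP => n; exact: ndu.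
have [|||n Kn] := @compact_increasing_cover K (fun n => [set x | u n x < e]) cK.
- move=> n; apply: (@open_comp _ _ (u n) [set y | y < e]); first by move=> x _; exact: cu.
  exact: open_lt.
- by move=> n x /=; apply: le_lt_trans.
- by move=> x _; exact: u0.
exists (maxn m n) => x; have [/Kn|nKx] := pselect (K x).
  by apply: le_lt_trans; apply: ndu'; exact: leq_maxr.
by apply: le_lt_trans (Km x nKx); apply: ndu'; exact: leq_maxl.
Qed.

(** Integrals depending on a point are controlled by dominated convergence, that
is, along sequences of points. *)
Lemma cvg_seq_continuous f :
  (forall x (u : nat -> E), u @ \oo --> x -> f \o u @ \oo --> f x) -> continuous f.
Proof.
move=> fu x; apply/cvgrPdist_lt => e e0; apply: contrapT => nfx.
have bad (n : nat) : exists y, ball x (n.+1%:R^-1) y /\ e <= `|f x - f y|.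
  apply: contrapT => nex; apply: nfx.
  apply/nbhs_ballP; exists (n.+1%:R^-1) => /=; first by rewrite invr_gt0.
  by move=> y xy /=; rewrite ltNge; apply/negP => h; apply: nex; exists y.
have [u hu] := choice bad.
have ux : u @ \oo --> x.
  apply/cvg_ballP => r r0; near=> n.
  have [h1 _] := hu n; apply: le_ball h1; apply: ltW.
  by near: n; exact: near_infty_natSinv_lt (PosNum r0).
have /cvgrPdist_lt /(_ e e0) [N _ /(_ N (leqnn N)) /=] := fu x u ux.
by have [_] := hu N; rewrite leNgt => /negP.
Unshelve. all: by end_near. Qed.

Lemma mdist_continuous (x : E) : continuous (fun y => mdist x y : R).
Proof.
move=> y; apply/cvgrPdist_lt => e e0.
apply/nbhs_ballP; exists e => //= z; rewrite ballEmdist/= => yz.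
have t1 := metric_triangle x z y; have t2 := metric_triangle x y z.
rewrite (metric_sym z y) in t1.
by apply: le_lt_trans yz; rewrite ler_norml; move: t1 t2; lra.
Qed.

Lemma vanishing_of_compact_support f K : compact K -> (forall x, ~ K x -> f x = 0) ->
  vanishing_at_infinity f.
Proof. by move=> cK fK e e0; exists K => // x /fK ->; rewrite normr0. Qed.

Lemma C0_bounded f : C0 f -> exists2 B, 0 <= B & forall x, `|f x| <= B.
Proof.
move=> [cf vf]; have [K cK fK] := vf 1 ltr01.
have : compact (f @` K).
  by apply: continuous_compact => //; exact: continuous_subspaceT.
move/compact_bounded => [B [_ hB]].
exists (Num.max 1 (B + 1)); first by rewrite le_max ler01.
move=> x; have [Kx|nKx] := pselect (K x).
  by rewrite le_max; apply/orP; right; apply: hB; rewrite ?ltrDl//; exists x.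
by rewrite le_max (ltW (fK x nKx)).
Qed.

Lemma C0D f1 f2 : C0 f1 -> C0 f2 -> C0 (fun x => f1 x + f2 x).
Proof.
move=> [c1 v1] [c2 v2]; split; first by move=> x; apply: cvgD; [exact: c1|exact: c2].
move=> e e0; have e20 : 0 < e / 2 by rewrite divr_gt0.
have [K1 cK1 h1] := v1 _ e20; have [K2 cK2 h2] := v2 _ e20.
exists (K1 `|` K2); first exact: compactU.
move=> x /not_orP[nK1 nK2]; rewrite (splitr e).
by apply: le_lt_trans (ler_normD _ _) _; apply: ltrD; [exact: h1|exact: h2].
Qed.

Lemma C0N f : C0 f -> C0 (fun x => - f x).
Proof.
move=> [cf vf]; split; first by move=> x; apply: cvgN; exact: cf.
by move=> e /vf[K cK fK]; exists K => // x /fK; rewrite normrN.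
Qed.

Lemma C0B f1 f2 : C0 f1 -> C0 f2 -> C0 (fun x => f1 x - f2 x).
Proof. by move=> h1 h2; apply: C0D => //; exact: C0N. Qed.

Lemma C0_cst0 : C0 (fun _ : E => 0 : R).
Proof.
split; first by move=> x; exact: cvg_cst.
by apply: (vanishing_of_compact_support (@compact0 E)).
Qed.

Lemma C0Z f (k : R) : C0 f -> C0 (fun x => k * f x).
Proof.
move=> [cf vf]; split; first by move=> x; apply: cvgMr; exact: cf.
move=> e e0; have k1 : 0 < `|k| + 1 by rewrite ltr_wpDl.
have [K cK fK] := vf (e / (`|k| + 1)) (divr_gt0 e0 k1).
exists K => // x /fK; rewrite ltr_pdivlMr// normrM => h.
by apply: le_lt_trans h; rewrite mulrC ler_wpM2l// lerDl.
Qed.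

Lemma C0_min f1 f2 : C0 f1 -> C0 f2 -> C0 (fun x => Num.min (f1 x) (f2 x)).
Proof.
move=> [c1 v1] [c2 v2]; split; first by move=> x; apply: continuous_min; [exact: c1|exact: c2].
move=> e e0; have [K1 cK1 h1] := v1 _ e0; have [K2 cK2 h2] := v2 _ e0.
exists (K1 `|` K2); first exact: compactU.
by move=> x /not_orP[nK1 nK2]; rewrite minEle; case: ifP => _; [exact: h1|exact: h2].
Qed.

(** The sets [rho n > 0] are open, relatively compact, increasing, and cover the
space. *)
Definition is_cutoff_sequence (rho : nat -> E -> R) :=
  [/\ forall n, continuous (rho n), forall n x, 0 <= rho n x,
      forall n x, rho n x <= rho n.+1 x,
      forall n, exists2 K, compact K & forall x, ~ K x -> rho n x = 0 &
      forall x, exists n, 0 < rho n x].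

Definition bump (x : E) (r : R) (y : E) : R := Num.max 0 (1 - mdist x y / r).

Lemma bump_continuous x r : continuous (bump x r).
Proof.
move=> y; apply: (@continuous_max _ _ (cst 0) (fun y => 1 - mdist x y / r)).
  exact: cvg_cst.
by apply: cvgB; [exact: cvg_cst|apply: cvgMl; exact: mdist_continuous].
Qed.

Lemma bump_eq0 x r y : 0 < r -> ~ ball x r y -> bump x r y = 0.
Proof.
move=> r0; rewrite ballEmdist/= => /negP; rewrite -leNgt => h.
by rewrite /bump max_l// subr_le0 ler_pdivlMr// mul1r.
Qed.

Lemma bump_gt0 x r y : 0 < r -> ball x r y -> 0 < bump x r y.
Proof.
move=> r0; rewrite ballEmdist/= => h.
by rewrite /bump lt_max subr_gt0 ltr_pdivrMr// mul1r h orbT.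
Qed.

(** [rho n] is a sum of bumps around the first [n] points of a dense sequence,
with radii [1 / k.+1] for [k < n], keeping only the balls contained in a
compact.  By local compactness, a small enough ball around a point of the
sequence close to [x] is one of them. *)
Lemma cutoff_sequence_exists : locally_compact [set: E] -> separable E ->
  exists rho, is_cutoff_sequence rho.
Proof.
move=> lc [D /countable_injP[num injnum] dD].
pose p n : E := xget point [set x | D x /\ num x = n].
have pD x : D x -> p (num x) = x.
  move=> Dx; rewrite /p; case: xgetP => [y -> [Dy]|/(_ x)]; last by case.
  by apply: injnum; rewrite inE.
pose r k : R := k.+1%:R^-1.
have r0 k : 0 < r k by rewrite invr_gt0.
pose good i k := `[< exists2 K, compact K & ball (p i) (r k) `<=` K >].
pose phi i k x := if good i k then bump (p i) (r k) x else 0.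
have cphi i k : continuous (phi i k).
  rewrite /phi; case: (good i k); first exact: bump_continuous.
  by move=> x; exact: cvg_cst.
have phi0 i k x : 0 <= phi i k x.
  by rewrite /phi; case: ifP => // _; rewrite /bump le_max lexx.
have supp i k : exists2 K, compact K & forall x, ~ K x -> phi i k x = 0.
  rewrite /phi /good; case: asboolP => [[K cK sK]|_].
    by exists K => // x nKx; apply: bump_eq0 => // /sK.
  by exists set0 => //; exact: compact0.
pose rho n x := \sum_(i < n) \sum_(k < n) phi i k x.
exists rho; split.
- have csum (N : nat) (u : nat -> E -> R) : (forall i, continuous (u i)) ->
      continuous (fun x => \sum_(i < N) u i x).
    move=> cu; elim: N => [|N IH] x.
      by under eq_fun do rewrite big_ord0; exact: cvg_cst.
    by under eq_fun do rewrite big_ord_recr/=; apply: cvgD; [exact: IH|exact: cu].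
  move=> n; apply: (csum n (fun i x => \sum_(k < n) phi i k x)) => i.
  by apply: (csum n (phi i)) => k; exact: cphi.
- by move=> n x; apply: sumr_ge0 => i _; exact: sumr_ge0.
- move=> n x; rewrite /rho big_ord_recr/= -[leLHS]addr0 lerD//; last exact: sumr_ge0.
  by apply: ler_sum => i _; rewrite big_ord_recr/= lerDl.
- move=> n.
  have sum_supp (N : nat) (u : nat -> E -> R) :
      (forall i, exists2 K, compact K & forall x, ~ K x -> u i x = 0) ->
      exists2 K, compact K & forall x, ~ K x -> \sum_(i < N) u i x = 0.
    move=> hu; elim: N => [|N [K cK hK]].
      by exists set0 => [|x _]; [exact: compact0|rewrite big_ord0].
    have [K' cK' hK'] := hu N; exists (K `|` K'); first exact: compactU.
    by move=> x /not_orP[nK nK']; rewrite big_ord_recr/= hK// hK'// addr0.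
  by apply: (sum_supp n (fun i x => \sum_(k < n) phi i k x)) => i; exact: sum_supp.
- move=> x; have [C + [cC _]] := lc x Logic.I.
  rewrite withinET => /nbhs_ballP[e /= e0 xe].
  pose k := Num.truncn (2 / e).
  have rk : r k < e / 2.
    rewrite /r -[ltRHS]invrK ltf_pV2 ?posrE ?invr_gt0 ?divr_gt0// invf_div.
    exact: truncnS_gt.
  have [y [xy Dy]] : ball x (r k) `&` D !=set0.
    apply: dD; first by exists x; exact: ballxx.
    rewrite ballEmdist; apply: (@open_comp _ _ (fun y => mdist x y : R) [set z | z < r k]).
      by move=> z _; exact: mdist_continuous.
    exact: open_lt.
  have gd : good (num y) k.
    apply/asboolP; exists C => // z; rewrite pD// => yz; apply: xe.
    have := ball_triangle xy yz; apply: le_ball; move: rk; lra.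
  exists (maxn (num y) k).+1; rewrite /rho.
  have ly : (num y < (maxn (num y) k).+1)%N by rewrite ltnS leq_maxl.
  have lk : (k < (maxn (num y) k).+1)%N by rewrite ltnS leq_maxr.
  rewrite (bigD1 (Ordinal ly))//= (bigD1 (Ordinal lk))//= -addrA.
  rewrite ltr_pwDl//; last by rewrite addr_ge0// sumr_ge0// => i _; rewrite sumr_ge0.
  by rewrite /phi gd bump_gt0// pD//; exact: ball_sym.
Qed.

Context (rho : nat -> E -> R).
Hypothesis rhoP : is_cutoff_sequence rho.

Lemma cutoff_compact K : compact K -> exists n, forall x, K x -> 0 < rho n x.
Proof.
move=> cK; have [crho _ ndrho _ rho_gt0] := rhoP.
have [|||n Kn] := @compact_increasing_cover K (fun n => [set x | 0 < rho n x]) cK.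
- move=> n; apply: (@open_comp _ _ (rho n) [set y | 0 < y]); first by move=> x _; exact: crho.
  exact: open_gt.
- by move=> n x /=; move/lt_le_trans; apply.
- by move=> x _; exact: rho_gt0.
by exists n.
Qed.

(** Such a sequence eventually leaves each compact; vanishing at infinity is
equivalent to tending to 0 along these sequences, which again suits dominated
convergence. *)
Definition escaping (u : nat -> E) := forall n, rho n (u n) = 0.

Lemma vanishing_escaping f (u : nat -> E) : vanishing_at_infinity f -> escaping u ->
  f \o u @ \oo --> 0.
Proof.
move=> vf eu; apply/cvgrPdist_lt => e e0; have [K cK fK] := vf e e0.
have [n Kn] := cutoff_compact cK; have [_ _ ndrho _ _] := rhoP.
have ndrho' x : nondecreasing_seq (rho ^~ x) by apply/nondecreasing_seqP => k; exact: ndrho.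
exists n => // m nm /=; rewrite sub0r normrN; apply: fK => /Kn.
by rewrite ltNge => /negP; apply; rewrite -(eu m); exact: ndrho'.
Qed.

Lemma escaping_vanishing f :
  (forall u, escaping u -> f \o u @ \oo --> 0) -> vanishing_at_infinity f.
Proof.
move=> fu e e0; apply: contrapT => nK; have [_ _ _ supp _] := rhoP.
have bad n : exists x, rho n x = 0 /\ e <= `|f x|.
  have [K cK hK] := supp n; apply: contrapT => nex; apply: nK; exists K => // x /hK rx.
  by rewrite ltNge; apply/negP => h; apply: nex; exists x.
have [u hu] := choice bad.
have /cvgrPdist_lt /(_ e e0) [N _ /(_ N (leqnn N)) /=] := fu u (fun n => (hu n).1).
by rewrite sub0r normrN ltNge (hu N).2.
Qed.

End compactness.

Section lattice_approximation.
Context {R : realType} {E : pmetricType R}.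
Context (V : set (E -> R)).
Hypothesis V_C0 : V `<=` @C0 R E.
Hypothesis V_min : forall u v, V u -> V v -> V (fun x => Num.min (u x) (v x)).
Hypothesis V_max : forall u v, V u -> V v -> V (fun x => Num.max (u x) (v x)).

(** In a lattice of functions in C_0, pointwise approximation of a function of
C_0 can be made uniform: by Dini's theorem, finite minima of the approximations
are uniformly below [f + e / 2], and then finite maxima of these minima are
moreover uniformly above [f - e]. *)
Lemma lattice_approximation (v : nat -> E -> R) (f : E -> R) : C0 f ->
  (forall n, V (v n)) -> (forall x, v ^~ x @ \oo --> f x) ->
  forall e, 0 < e -> exists2 w, V w & forall x, `|w x - f x| < e.
Proof.
move=> Cf Vv vf e e0; have e20 : 0 < e / 2 by rewrite divr_gt0.
pose wmin m := fix wmin N : E -> R := if N is N'.+1 then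
  (fun x => Num.min (wmin N' x) (v (m + N)%N x)) else v m.
have Vmin m N : V (wmin m N) by elim: N => [|N IH] /=; [exact: Vv|exact: V_min].
have stepmin m : exists N, forall x, wmin m N x - f x < e / 2.
  apply: (@dini _ _ (fun N x => wmin m N x - f x)) => //.
  - by move=> N x; apply: cvgB; [have [+ _] := V_C0 (Vmin m N); exact|have [+ _] := Cf; exact].
  - by move=> N x; rewrite lerD2r/= ge_min lexx.
  - move=> x r r0; have /cvgrPdist_lt /(_ r r0) [N _ hN] := vf x.
    exists N; rewrite ltrBlDl; apply: (@le_lt_trans _ _ (v (m + N)%N x)).
      by case: N {hN} => [|N] /=; rewrite ?addn0// ge_min lexx orbT.
    by have := hN (m + N)%N (leq_addl _ _); rewrite /= ltr_norml => /andP[]; lra.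
  - move=> r r0; exists 0%N; have [_ van] := C0B (V_C0 (Vmin m 0%N)) Cf.
    have [K cK hK] := van r r0; exists K => // x /hK; exact: le_lt_trans (ler_norm _).
have [N hN] := choice stepmin; pose w m := wmin m (N m).
have wlow m x : (forall n, (m <= n)%N -> `|f x - v n x| < e / 2) -> f x - e / 2 < w m x.
  move=> h; rewrite /w; elim: (N m) => [|k IH] /=.
    by have := h m (leqnn m); rewrite ltr_norml => /andP[]; lra.
  rewrite lt_min IH/=.
  by have := h (m + k.+1)%N (leq_addr _ _); rewrite ltr_norml => /andP[]; lra.
pose wmax := fix wmax k : E -> R := if k is k'.+1 then
  (fun x => Num.max (wmax k' x) (w k x)) else w 0%N.
have Vmax k : V (wmax k) by elim: k => [|k IH] /=; [exact: Vmin|apply: V_max => //; exact: Vmin].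
have maxup k x : wmax k x < f x + e / 2.
  elim: k => [|k IH] /=; first by have := hN 0%N x; rewrite -/(w 0%N); lra.
  by rewrite gt_max IH/=; have := hN k.+1 x; rewrite -/(w k.+1); lra.
have [k hk] : exists k, forall x, (f x - e / 2) - wmax k x < e / 2.
  apply: (@dini _ _ (fun k x => (f x - e / 2) - wmax k x)) => //.
  - move=> k x; apply: cvgB; last by have [+ _] := V_C0 (Vmax k); exact.
    by apply: cvgB; [have [+ _] := Cf; exact|exact: cvg_cst].
  - by move=> k x; rewrite lerD2l/= lerN2 le_max lexx.
  - move=> x r r0; have /cvgrPdist_lt /(_ _ e20) [m _ hm] := vf x.
    exists m; rewrite ltrBlDr; apply: (@lt_le_trans _ _ (w m x)).
      exact: (wlow m x (fun n mn => hm n mn)).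
    have : w m x <= wmax m x by case: m {hm} => [|m] //=; rewrite le_max lexx orbT.
    by move: r0; lra.
  - move=> r r0; exists 0%N; have [_ van] := C0B Cf (V_C0 (Vmax 0%N)).
    have [K cK hK] := van r r0; exists K => // x /hK /ltr_normlP[_]; move: e20; lra.
exists (wmax k) => // x; rewrite ltr_norml; have := hk x; have := maxup k x; move: e0; lra.
Qed.

End lattice_approximation.

(** * Uniform one-sided continuity of a Feller semigroup *)

Section feller.
Context {R : realType} {d : measure_display} {Omega : measurableType d}.
Context {E : pmetricType R}.
Context (F : R -> set_system Omega) (X : R -> Omega -> E).
Context (P : E -> probability Omega R).
Hypothesis X_markov : standard_markov_process F X P.
Hypothesis X_feller : C0_feller X P.
Context (rho : nat -> E -> R).
Hypothesis rhoP : is_cutoff_sequence rho.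

Notation T := (transition_semigroup X P).

Lemma integrable_bounded_comp (f : E -> R) (B s : R) y : 0 <= s ->
  measurable_fun [set: borel E] (f : borel E -> R) -> (forall x, `|f x| <= B) ->
  (P y).-integrable setT (EFin \o (fun w => f (X s w))).
Proof.
move=> s0 mf fB; apply: (@dominated_integrable_fun _ _ _ _ _ (cst B)) => //.
  exact: (measurable_comp_X X_markov).
by apply: finite_measure_integrable_cst.
Qed.

Lemma C0_measurable (f : E -> R) : C0 f -> measurable_fun [set: borel E] (f : borel E -> R).
Proof. by move=> [cf _]; apply: continuous_measurable_borel. Qed.

Lemma C0_integrable (f : E -> R) s y : 0 <= s -> C0 f ->
  (P y).-integrable setT (EFin \o (fun w => f (X s w))).
Proof.
move=> s0 Cf; have [B _ fB] := C0_bounded Cf.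
by apply: integrable_bounded_comp fB => //; exact: C0_measurable.
Qed.

Lemma transition_cst s (k : R) y : T s (cst k) y = k.
Proof.
rewrite /transition_semigroup Rintegral_cst//.
by have e := @probability_setT _ _ _ (P y); rewrite /= in e *; rewrite e mulr1.
Qed.

Lemma transition_le s (f1 f2 : E -> R) y : 0 <= s -> C0 f1 -> C0 f2 ->
  (forall x, f1 x <= f2 x) -> T s f1 y <= T s f2 y.
Proof.
by move=> s0 C1 C2 f12; apply: le_Rintegral => //; [exact: C0_integrable|exact: C0_integrable].
Qed.

Lemma transition_le_cst s (f : E -> R) (k : R) y : 0 <= s -> C0 f ->
  (forall x, f x <= k) -> T s f y <= k.
Proof.
move=> s0 Cf fk; rewrite -[leRHS](transition_cst s k y); apply: le_Rintegral => //.
  exact: C0_integrable.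
by apply: finite_measure_integrable_cst.
Qed.

Lemma transitionD s (f1 f2 : E -> R) y : 0 <= s -> C0 f1 -> C0 f2 ->
  T s (fun x => f1 x + f2 x) y = T s f1 y + T s f2 y.
Proof. by move=> s0 C1 C2; apply: RintegralD => //; exact: C0_integrable. Qed.

Lemma transitionB s (f1 f2 : E -> R) y : 0 <= s -> C0 f1 -> C0 f2 ->
  T s (fun x => f1 x - f2 x) y = T s f1 y - T s f2 y.
Proof. by move=> s0 C1 C2; apply: RintegralB => //; exact: C0_integrable. Qed.

Lemma transitionZ s (f : E -> R) (k : R) y : 0 <= s -> C0 f ->
  T s (fun x => k * f x) y = k * T s f y.
Proof. by move=> s0 C1; apply: RintegralZl => //; exact: C0_integrable. Qed.

Lemma transitionDcst s (f : E -> R) (k : R) y : 0 <= s -> C0 f ->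
  T s (fun x => f x + k) y = T s f y + k.
Proof.
move=> s0 Cf; rewrite /transition_semigroup RintegralD//.
- by congr (_ + _); exact: (transition_cst s).
- exact: C0_integrable.
- by apply: finite_measure_integrable_cst.
Qed.

Lemma transition_norm_le s (f : E -> R) (B : R) y : 0 <= s -> C0 f ->
  (forall x, `|f x| <= B) -> `|T s f y| <= B.
Proof.
move=> s0 Cf fB; rewrite ler_norml; apply/andP; split; last first.
  by apply: transition_le_cst => // x; exact: le_trans (ler_norm _) (fB x).
rewrite lerNl -mulN1r -transitionZ//; apply: transition_le_cst => //; first exact: C0Z.
by move=> x; rewrite mulN1r; apply: le_trans (fB x); rewrite -normrN ler_norm.
Qed.

Lemma transition_comp s r (f : E -> R) y : 0 <= s -> 0 <= r -> C0 f ->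
  T (s + r) f y = T s (T r f) y.
Proof.
move=> s0 r0 Cf; have [B B0 fB] := C0_bounded Cf.
have sr0 : 0 <= s + r by rewrite addr_ge0.
have Df : everywhere_integrable X P (fun x => f x + B).
  split.
  - by apply: measurable_funD => //; exact: C0_measurable.
  - by move=> x; have := fB x; rewrite ler_norml => /andP[]; lra.
  - move=> t x t0; apply: (@integrable_bounded_comp (fun x => f x + B) (B + B)) => //.
      by apply: measurable_funD => //; exact: C0_measurable.
    by move=> z; rewrite (le_trans (ler_normD _ _))// (ger0_norm B0) lerD2r.
have m1 : measurable_fun setT (cst 1 : g_sigma_algebraType (F s) -> R) by [].
have := @markov_weight _ _ _ _ _ _ _ X_markov y s r _ (cst 1) s0 r0 Df m1 (fun=> ler01).
under eq_integral do rewrite mul1r.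
under [in RHS]eq_integral => w _ do rewrite mul1r transitionDcst//.
move=> /(congr1 fine); rewrite -/(Rintegral _ _ _) -/(T _ _ y) => h.
have : T (s + r) f y + B = T s (T r f) y + B.
  by rewrite -!transitionDcst//; exact: X_feller.
by move/addIr.
Qed.

Lemma cvg_transition (f : E -> R) x (t : R) (u : nat -> R) : 0 <= t -> C0 f ->
  (forall n, t < u n) -> u @ \oo --> t -> T (u n) f x @[n --> \oo] --> T t f x.
Proof.
move=> t0 Cf tu ut; have [B B0 fB] := C0_bounded Cf.
apply: (@cvg_Rintegral _ _ _ (P x) (fun n w => f (X (u n) w)) _ (cst B)).
- move=> n; apply: (measurable_comp_X X_markov); last exact: C0_measurable.
  exact: le_trans (ltW (tu n)).
- move=> w; have [cf _] := Cf.
  have h : right_continuous_from0 (fun t => f (X t w)) by exact: (path_right_continuous X_markov).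
  by have /cvg_at_rightP := h t t0; apply.
- by move=> n w; exact: fB.
- by apply: finite_measure_integrable_cst.
Qed.

Lemma transition_right_continuous (f : E -> R) x : C0 f ->
  right_continuous_from0 (fun t => T t f x).
Proof.
by move=> Cf t t0; apply/cvg_at_rightP => u [tu ut]; exact: cvg_transition.
Qed.

(** Up to the factor [delta], the average of the semigroup over [0, delta]: this
regularizes [f] in time. *)
Definition occupation (delta : R) (f : E -> R) (x : E) : R :=
  \int[lebesgue_measure]_(t in `[0, delta]) T t f x.

Lemma cvg_occupation delta (f : E -> R) a x : 0 <= a -> 0 < delta -> C0 f ->
  \sum_(i < n.+1) delta / n.+1%:R * T (a + delta / n.+1%:R * i.+1%:R) f x @[n --> \oo] -->
  \int[lebesgue_measure]_(t in `[a, a + delta]) T t f x.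
Proof.
move=> a0 d0 Cf; have [B B0 fB] := C0_bounded Cf.
apply: (@cvg_riemann_sum _ (fun t => T t f x) _ _ B) => //.
  by move=> t at_; apply: transition_right_continuous => //; exact: le_trans at_.
by move=> t at_; apply: transition_norm_le => //; exact: le_trans at_.
Qed.

Lemma occupation_bound delta (f : E -> R) (B a : R) x : 0 <= a -> 0 <= delta -> C0 f ->
  (forall x, `|f x| <= B) ->
  `|\int[lebesgue_measure]_(t in `[a, a + delta]) T t f x| <= B * delta.
Proof.
move=> a0 d0 Cf fB; rewrite ler_norml -mulNr.
apply: (@path_integral_bounds _ (fun t => T t f x)) => //.
  exact: transition_right_continuous.
by move=> t t0; rewrite -ler_norml; exact: transition_norm_le.
Qed.

Lemma cvg_occupation_seq delta (f : E -> R) (u : nat -> E) (l : R -> R) : 0 < delta -> C0 f ->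
  (forall t, 0 <= t -> T t f (u n) @[n --> \oo] --> l t) ->
  occupation delta f (u n) @[n --> \oo] --> \int[lebesgue_measure]_(t in `[0, delta]) l t.
Proof.
move=> d0 Cf fl; have [B B0 fB] := C0_bounded Cf.
rewrite /occupation Rintegral_mkcond; under eq_fun do rewrite Rintegral_mkcond.
have cB : lebesgue_measure.-integrable (`[0, delta]%classic : set (measurableTypeR R)) (EFin \o cst B).
  apply: (@integrable_path _ (cst B) B) => //; first by move=> t _; exact: cvg_cst.
  by move=> t _; rewrite /= ger0_norm.
apply: (@cvg_Rintegral _ _ _ lebesgue_measure _ _ (cst B \_ `[0, delta])).
- move=> n; apply/(measurable_restrictT _ _).1 => //.
  apply: (measurable_funS _ _ (@right_continuous_measurable _ (fun t => T t f (u n)) 0 _)) => //.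
    by move=> t /=; rewrite !in_itv/= andbT => /andP[].
  exact: transition_right_continuous.
- move=> t; rewrite patchE; case: ifPn => [|nt].
    rewrite inE => tD; have /andP[t0 _] : 0 <= t <= delta by rewrite /= in_itv/= in tD.
    have tD' : t \in [set` `[0, delta]] by rewrite inE.
    by under eq_fun do rewrite patchE tD'; exact: fl.
  by under eq_fun do rewrite patchE (negbTE nt); exact: cvg_cst.
- move=> n t; rewrite !patchE; case: ifPn => [|_]; last by rewrite normr0.
  rewrite inE /= in_itv/= => /andP[t0 _]; exact: transition_norm_le.
- by rewrite -restrict_EFin; apply/integrable_restrict => //; rewrite ?setTI.
Qed.

Lemma occupation_C0 delta (f : E -> R) : 0 < delta -> C0 f -> C0 (occupation delta f).
Proof.
move=> d0 Cf; split.
  apply: cvg_seq_continuous => x u ux; apply: cvg_occupation_seq => // t t0.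
  have [cT _] := X_feller t0 Cf.
  by apply: continuous_cvg; [exact: cT|exact: ux].
apply: (escaping_vanishing rhoP) => u eu.
have -> : 0 = \int[lebesgue_measure]_(t in `[0, delta]) (fun _ : R => 0 : R) t.
  by rewrite Rintegral_cst//= mul0r.
apply: cvg_occupation_seq => // t t0; have [_ vT] := X_feller t0 Cf.
exact: (vanishing_escaping rhoP vT eu).
Qed.

(** The semigroup commutes with the Riemann sums of the integral over time. *)
Lemma transition_occupation r delta (f : E -> R) x : 0 <= r -> 0 < delta -> C0 f ->
  T r (occupation delta f) x = \int[lebesgue_measure]_(t in `[r, r + delta]) T t f x.
Proof.
move=> r0 d0 Cf; have [B B0 fB] := C0_bounded Cf.
have t0 n (i : 'I_n.+1) : 0 <= delta / n.+1%:R * i.+1%:R.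
  by rewrite mulr_ge0 ?divr_ge0 ?(ltW d0).
pose S n (y : E) := \sum_(i < n.+1) delta / n.+1%:R * T (0 + delta / n.+1%:R * i.+1%:R) f y.
have CSk n k : (k <= n.+1)%N ->
  C0 (fun y => \sum_(i < k) delta / n.+1%:R * T (0 + delta / n.+1%:R * i.+1%:R) f y) /\
  T r (fun y => \sum_(i < k) delta / n.+1%:R * T (0 + delta / n.+1%:R * i.+1%:R) f y) x =
  \sum_(i < k) delta / n.+1%:R * T (r + delta / n.+1%:R * i.+1%:R) f x.
  elim: k => [_|k IH kn].
    under eq_fun do rewrite big_ord0.
    split; [exact: C0_cst0|rewrite big_ord0; exact: (transition_cst r 0)].
  have [C1 T1] := IH (ltnW kn); have tk := t0 n (Ordinal kn).
  have Ck : C0 (fun y => delta / n.+1%:R * T (0 + delta / n.+1%:R * k.+1%:R) f y).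
    by apply: C0Z; apply: X_feller => //; rewrite add0r.
  under eq_fun do rewrite big_ord_recr/=; split; first exact: C0D.
  rewrite transitionD// T1 big_ord_recr/= transitionZ//; last first.
    by apply: X_feller => //; rewrite add0r.
  by rewrite add0r transition_comp.
have c1 : T r (S n) x @[n --> \oo] --> T r (occupation delta f) x.
  apply: (@cvg_Rintegral _ _ _ (P x) (fun n w => S n (X r w)) _ (cst (B * delta))).
  - move=> n; apply: (measurable_comp_X X_markov) => //; apply: C0_measurable.
    by have [] := CSk n n.+1 (leqnn _).
  - by move=> w; have := @cvg_occupation delta f 0 (X r w) (lexx 0) d0 Cf; rewrite add0r.
  - move=> n w; rewrite /S (le_trans (ler_norm_sum _ _ _))//.
    rewrite (_ : B * delta = \sum_(i < n.+1) delta / n.+1%:R * B); last first.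
      by rewrite sumr_const card_ord -[RHS]mulr_natr [RHS]mulrAC divfK// mulrC.
    apply: ler_sum => i _; rewrite normrM ger0_norm ?divr_ge0 ?(ltW d0)//.
    rewrite ler_wpM2l ?divr_ge0 ?(ltW d0)//; apply: transition_norm_le => //.
    by rewrite add0r.
  - by apply: finite_measure_integrable_cst.
have e : (fun n => T r (S n) x) = (fun n => \sum_(i < n.+1) delta / n.+1%:R * T (r + delta / n.+1%:R * i.+1%:R) f x).
  by apply/funext => n; have [_] := CSk n n.+1 (leqnn _).
have c2 := @cvg_occupation delta f r x r0 d0 Cf; rewrite -e in c2.
exact: (cvg_unique (@Rhausdorff R) c1 c2).
Qed.

(** For such functions [T r s - C * r] is nonincreasing in [r].  This monotonicity
allows Dini's theorem to turn the pointwise continuity of the semigroup at time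
0 into a uniform one. *)
Definition almost_supermedian (s : E -> R) := C0 s /\
  exists2 C, 0 <= C & forall r x, 0 <= r -> T r s x <= s x + C * r.

(** Translating the window of integration by [r] changes it by two intervals of
length [r], on which the integrand is bounded. *)
Lemma occupation_almost_supermedian delta (f : E -> R) : 0 < delta -> C0 f ->
  almost_supermedian (occupation delta f).
Proof.
move=> d0 Cf; split; first exact: occupation_C0.
have [B B0 fB] := C0_bounded Cf.
exists (B + B); first by rewrite addr_ge0.
move=> r x r0; rewrite transition_occupation//.
have rc := @transition_right_continuous f x Cf.
have bd t : 0 <= t -> `|T t f x| <= B by move=> t0; exact: transition_norm_le.
pose J (a b : R) := \int[lebesgue_measure]_(t in `[a, b]) T t f x.
have e1 : J 0 (delta + r) = J 0 delta + J delta (delta + r).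
  exact: (@path_integralD _ (fun t => T t f x) B 0 delta r rc bd (lexx 0) (ltW d0) r0).
have e2 : J 0 (r + delta) = J 0 r + J r (r + delta).
  exact: (@path_integralD _ (fun t => T t f x) B 0 r delta rc bd (lexx 0) r0 (ltW d0)).
have b1 : `|J 0 (0 + r)| <= B * r := @occupation_bound r f B 0 x (lexx 0) r0 Cf fB.
have b2 : `|J delta (delta + r)| <= B * r := @occupation_bound r f B delta x (ltW d0) r0 Cf fB.
rewrite -/(J r (r + delta)) /occupation -/(J 0 delta).
move: b1 b2 e2; rewrite (addrC r delta) e1 add0r => /ler_normlP[b1 _] /ler_normlP[_ b2].
by move: b1 b2; lra.
Qed.

Lemma almost_supermedianD s1 s2 : almost_supermedian s1 -> almost_supermedian s2 ->
  almost_supermedian (fun x => s1 x + s2 x).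
Proof.
move=> [C1 [c1 c10 h1]] [C2 [c2 c20 h2]]; split; first exact: C0D.
exists (c1 + c2); first exact: addr_ge0.
move=> r x r0; rewrite transitionD//.
by have := h1 r x r0; have := h2 r x r0; lra.
Qed.

Lemma almost_supermedianZ s (k : R) : 0 <= k -> almost_supermedian s ->
  almost_supermedian (fun x => k * s x).
Proof.
move=> k0 [Cs [c1 c10 h1]]; split; first exact: C0Z.
exists (k * c1); first exact: mulr_ge0.
move=> r x r0; rewrite transitionZ// -mulrA -mulrDr ler_wpM2l//.
exact: h1.
Qed.

Lemma almost_supermedian_min s1 s2 : almost_supermedian s1 -> almost_supermedian s2 ->
  almost_supermedian (fun x => Num.min (s1 x) (s2 x)).
Proof.
move=> [C1 [c1 c10 h1]] [C2 [c2 c20 h2]]; split; first exact: C0_min.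
exists (c1 + c2); first exact: addr_ge0.
move=> r x r0; have Cm := C0_min C1 C2.
have m1 : T r (fun x => Num.min (s1 x) (s2 x)) x <= T r s1 x.
  by apply: transition_le => // y; rewrite ge_min lexx.
have m2 : T r (fun x => Num.min (s1 x) (s2 x)) x <= T r s2 x.
  by apply: transition_le => // y; rewrite ge_min lexx orbT.
have r1 := mulr_ge0 c10 r0; have r2 := mulr_ge0 c20 r0.
rewrite -lerBlDr le_min; apply/andP; split.
  by have := h1 r x r0; lra.
by have := h2 r x r0; lra.
Qed.

(** Dini's theorem, applied along [r = 1 / n.+1]; all smaller times follow by the
same monotonicity. *)
Lemma almost_supermedian_lower s : almost_supermedian s -> forall e, 0 < e ->
  exists2 h, 0 < h & forall r x, 0 <= r -> r <= h -> s x - e <= T r s x.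
Proof.
move=> [Cs [C C0_ hC]] e e0.
pose t n : R := n.+1%:R^-1.
have t0 n : 0 < t n by rewrite invr_gt0.
have tc : t @ \oo --> 0 by exact: cvg_harmonic.
have mono q r x : 0 <= q -> q <= r -> T r s x - C * r <= T q s x - C * q.
  move=> q0 qr; have rq0 : 0 <= r - q by rewrite subr_ge0.
  have -> : r = q + (r - q) by rewrite addrC subrK.
  rewrite transition_comp//.
  have : T q (T (r - q) s) x <= T q (fun y => s y + C * (r - q)) x.
    apply: le_Rintegral => //; first by apply: C0_integrable => //; exact: X_feller.
      have [B _ sB] := C0_bounded Cs.
      apply: (@integrable_bounded_comp (fun y => s y + C * (r - q)) (B + `|C * (r - q)|)) => //.
        by apply: measurable_funD => //; exact: C0_measurable.
      by move=> y; apply: le_trans (ler_normD _ _) _; rewrite lerD2r.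
    by move=> w _; exact: hC.
  by rewrite transitionDcst//; lra.
pose u n x := s x - (T (t n) s x - C * t n).
have [n hn] : exists n, forall x, u n x < e.
  apply: (@dini _ _ u) => //.
  - move=> n x; have [cs _] := Cs; have [cT _] := X_feller (ltW (t0 n)) Cs.
    apply: cvgB; first exact: cs.
    by apply: cvgB; [exact: cT|exact: cvg_cst].
  - move=> n x; rewrite lerD2l lerN2; apply: mono; first exact/ltW.
    by rewrite lef_pV2 ?posrE// ler_nat.
  - move=> x r r0.
    have cu : u ^~ x @ \oo --> s x - (T 0 s x - C * 0).
      apply: cvgB; first exact: cvg_cst.
      by apply: cvgB; [exact: cvg_transition|apply: cvgMr].
    rewrite (transition_start X_markov) in cu; last exact: C0_measurable.
    rewrite mulr0 subr0 subrr in cu.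
    have /cvgrPdist_lt /(_ r r0) [N _ /(_ N (leqnn N))] := cu.
    by rewrite /= sub0r normrN => h; exists N; exact: le_lt_trans (ler_norm _) h.
  - move=> r r0; have r20 : 0 < r / 2 by rewrite divr_gt0.
    have c0 : (fun n => C * t n) @ \oo --> C * 0 by apply: cvgMr.
    rewrite mulr0 in c0; have /cvgrPdist_lt /(_ _ r20) [N _ /(_ N (leqnn N))] := c0.
    rewrite /= sub0r normrN => h; exists N.
    have [_ van] := C0B Cs (X_feller (ltW (t0 N)) Cs).
    have [K cK hK] := van _ r20; exists K => // x /hK h2.
    have := le_lt_trans (ler_norm _) h; have := le_lt_trans (ler_norm _) h2.
    by rewrite /u; lra.
exists (t n) => // r x r0 rt.
have := mono r (t n) x r0 rt; have := hn x; rewrite /u.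
have := mulr_ge0 C0_ r0; lra.
Qed.

(** Almost supermedian functions are stable under minima but not under maxima;
their differences form a lattice. *)
Definition supermedian_difference (v : E -> R) := exists a b,
  [/\ almost_supermedian a, almost_supermedian b & v = fun x => a x - b x].

Lemma supermedian_difference_C0 v : supermedian_difference v -> C0 v.
Proof. by move=> [a [b [[Ca _] [Cb _] ->]]]; exact: C0B. Qed.

Lemma supermedian_difference_min u v : supermedian_difference u -> supermedian_difference v ->
  supermedian_difference (fun x => Num.min (u x) (v x)).
Proof.
move=> [a [b [sa sb ->]]] [a' [b' [sa' sb' ->]]].
exists (fun x => Num.min (a x + b' x) (a' x + b x)), (fun x => b x + b' x); split.
- by apply: almost_supermedian_min; exact: almost_supermedianD.
- exact: almost_supermedianD.
- by apply/funext => x; case: leP => ?; case: leP => ?; lra.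
Qed.

Lemma supermedian_difference_max u v : supermedian_difference u -> supermedian_difference v ->
  supermedian_difference (fun x => Num.max (u x) (v x)).
Proof.
move=> [a [b [sa sb ->]]] [a' [b' [sa' sb' ->]]].
exists (fun x => a x + a' x), (fun x => Num.min (a x + b' x) (a' x + b x)); split.
- exact: almost_supermedianD.
- by apply: almost_supermedian_min; exact: almost_supermedianD.
- by apply/funext => x; case: leP => ?; case: leP => ?; lra.
Qed.

Lemma cvg_occupation_average (f : E -> R) x : C0 f ->
  n.+1%:R * occupation n.+1%:R^-1 f x @[n --> \oo] --> f x.
Proof.
move=> Cf; have [B B0 fB] := C0_bounded Cf.
apply/cvgrPdist_lt => e e0; have e20 : 0 < e / 2 by rewrite divr_gt0.
have /cvgrPdist_lt /(_ _ e20) := @transition_right_continuous f x Cf 0 (lexx 0).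
rewrite (transition_start X_markov); last exact: C0_measurable.
move=> /nbhs_ballP[r /= r0 hr].
near=> n.
have tn0 : 0 < n.+1%:R^-1 :> R by rewrite invr_gt0.
have tnr : n.+1%:R^-1 < r by near: n; exact: near_infty_natSinv_lt (PosNum r0).
have bd t : 0 <= t <= 0 + n.+1%:R^-1 -> f x - e / 2 <= T t f x <= f x + e / 2.
  rewrite add0r => /andP[]; rewrite le_eqVlt => /predU1P[<- _|t0 tn].
    rewrite (transition_start X_markov); last exact: C0_measurable.
    by move: e0; lra.
  have : `|f x - T t f x| < e / 2.
    apply: hr => //=; rewrite /ball/= sub0r normrN gtr0_norm//; exact: le_lt_trans tnr.
  by rewrite ltr_norml => /andP[]; lra.
have := @path_integral_bounds_on _ (fun t => T t f x) (f x - e / 2) (f x + e / 2) B 0 n.+1%:R^-1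
  (@transition_right_continuous f x Cf) (fun t t0 => transition_norm_le x t0 Cf fB) bd (lexx 0) (ltW tn0).
rewrite add0r -/(occupation _ _ _) ler_pdivrMr// ler_pdivlMr// => /andP[h1 h2].
by rewrite ltr_norml [n.+1%:R * _]mulrC; move: h1 h2 e0; lra.
Unshelve. all: by end_near. Qed.

(** The time averages of [f] tend pointwise to [f], so [f] is within [e / 4] of
some [a - b] with [a] and [b] almost supermedian ([lattice_approximation]).  Then
[T r a] exceeds [a] by at most a multiple of [r], and [T r b] is nowhere much
smaller than [b]. *)
Lemma transition_uniform_upper (f : E -> R) (e : R) : C0 f -> 0 < e ->
  exists2 h, 0 < h & forall r x, 0 <= r -> r <= h -> T r f x <= f x + e.
Proof.
move=> Cf e0; have e40 : 0 < e / 4 by rewrite divr_gt0.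
have [||v [a [b [sa sb ->]]] vf] := @lattice_approximation _ _ supermedian_difference
  supermedian_difference_C0 supermedian_difference_min supermedian_difference_max
  (fun n x => n.+1%:R * occupation n.+1%:R^-1 f x - 0) f Cf _ _ (e / 4) e40.
- move=> n; exists (fun x => n.+1%:R * occupation n.+1%:R^-1 f x), (cst 0); split => //.
    by apply: almost_supermedianZ => //; apply: occupation_almost_supermedian.
  split; first exact: C0_cst0.
  by exists 0 => // r x r0; rewrite transition_cst mul0r addr0.
- by move=> x; under eq_fun do rewrite subr0; exact: cvg_occupation_average.
have [Ca [C C0_ hC]] := sa; have [Cb _] := sb.
have [h h0 hb] := almost_supermedian_lower sb e40.
have C1 : 0 < C + 1 by rewrite ltr_wpDl.
exists (Num.min h (e / 4 / (C + 1))); first by rewrite lt_min h0 divr_gt0.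
move=> r x r0; rewrite le_min => /andP[rh]; rewrite ler_pdivlMr// => rC.
have Cab := C0B Ca Cb.
have q1 : T r f x <= T r (fun x => a x - b x) x + e / 4.
  rewrite -transitionDcst//; apply: le_Rintegral => //; first exact: C0_integrable.
    have [B _ sB] := C0_bounded Cab.
    apply: (@integrable_bounded_comp (fun y => a y - b y + e / 4) (B + `|e / 4|)) => //.
      by apply: measurable_funD => //; exact: C0_measurable.
    by move=> y; apply: le_trans (ler_normD _ _) _; rewrite lerD2r.
  by move=> w _; have := vf (X r w); rewrite ltr_norml => /andP[]; lra.
rewrite transitionB// in q1.
have := hb r x r0 rh; have := hC r x r0; have := vf x; rewrite ltr_norml => /andP[].
by move: q1 rC r0; rewrite mulrDr mulr1 (mulrC r); lra.
Qed.

End feller.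

(** * Integrable envelopes of the reward *)

Section reward.
Context {R : realType} {d : measure_display} {Omega : measurableType d}.
Context {E : pmetricType R}.
Context (F : R -> set_system Omega) (X : R -> Omega -> E).
Context (P : E -> probability Omega R) (G : E -> R).
Hypothesis X_markov : standard_markov_process F X P.
Hypothesis G_cont : continuous G.

(** A cadlag path has relatively compact range on a bounded time interval: around
each time it stays near its value or near its left limit, and finitely many such
neighbourhoods cover the interval. *)
Lemma path_increasing_cover (U : nat -> set E) w (T : R) :
  (forall n, U n `<=` U n.+1) -> (forall y : E, exists n, nbhs y (U n)) ->
  exists n, forall t, 0 <= t <= T -> U n (X t w).
Proof.
move=> ndU nU.
have ndU' := homo_leq (r := subset) (fun _ _ => id) (fun _ _ _ AB BC y Ay => BC y (AB y Ay)) ndU.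
have [rX lX] := smp_cadlag X_markov w.
have : \forall n \near \oo, `[0, T]%classic `<=` (fun t => 0 <= t -> U n (X t w)).
  have /compact_near_coveringP := @segment_compact _ 0 T; apply => t.
  rewrite /= in_itv/= => /andP[t0 _].
  have [n1 hn1] := nU (X t w).
  have right : \forall s \near t^'+, U n1 (X s w) by exact: rX hn1.
  have [n2 left] : exists n2, \forall s \near t^'-, 0 <= s -> U n2 (X s w).
    move: t0; rewrite le_eqVlt => /predU1P[<-|t0].
      exists 0%N; apply/nbhs_ballP; exists 1 => //= s _ s0 s0'.
      by move: s0'; rewrite leNgt s0.
    have := lX t t0; set l := lim _ => cl.
    have [n2 hn2] := nU l; exists n2.
    have lf : \forall s \near t^'-, U n2 (X s w) by exact: cl hn2.
    by apply: filterS lf => s.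
  have near_t : \forall s \near t, 0 <= s -> U (maxn n1 n2) (X s w).
    move: right left => /nbhs_ballP[e1 /= e10 h1] /nbhs_ballP[e2 /= e20 h2].
    apply/nbhs_ballP; exists (Num.min e1 e2); first by rewrite /= lt_min e10.
    move=> s /= ts s0; case: (ltgtP s t) => st.
    - apply: (ndU' n2); first exact: leq_maxr.
      by apply: h2 => //; apply: le_ball ts; rewrite ge_min lexx orbT.
    - apply: (ndU' n1); first exact: leq_maxl.
      by apply: h1 => //; apply: le_ball ts; rewrite ge_min lexx.
    - by apply: (ndU' n1); [exact: leq_maxl|rewrite st; exact: nbhs_singleton].
  exists ([set s | 0 <= s -> U (maxn n1 n2) (X s w)], [set n | (maxn n1 n2 <= n)%N]) => /=.
    by split => //; exact: nbhs_infty_ge.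
  by move=> [s n] /= [h mn] s0; apply: (ndU' _ _ mn); exact: h.
case=> N _ /(_ N (leqnn N)) h; exists N => t /andP[t0 tT].
by apply: (h t) => //=; rewrite in_itv/= t0.
Unshelve. all: by end_near. Qed.

Hypothesis G_sup : forall (T : R) x, 0 <= T ->
    (\int[P x]_w ereal_sup [set (expR (G (X t w)))%:E | t in `[0%R, T]]
      < +oo)%E.

(** The supremum of [e^G] over [0, T] is finite by [path_increasing_cover], and
measurable because right-continuity reduces it to countably many times. *)
Lemma dominator_exists (T : R) : 0 <= T -> exists D : Omega -> R,
  [/\ measurable_fun setT D, forall w t, 0 <= t <= T -> expR (G (X t w)) <= D w &
   forall x, (P x).-integrable setT (EFin \o D)].
Proof.
move=> T0.
have bounded_path w : exists n : nat, forall t, 0 <= t <= T -> G (X t w) < n%:R.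
  apply: (@path_increasing_cover (fun n => [set y | G y < n%:R])).
    by move=> n y /= h; apply: lt_le_trans h _; rewrite ler_nat.
  move=> y; exists (Num.truncn (G y)).+1.
  apply: open_nbhs_nbhs; split; last by rewrite /= truncnS_gt.
  apply: (@open_comp _ _ G [set z | z < (Num.truncn (G y)).+1%:R]).
    by move=> z _; exact: G_cont.
  exact: open_lt.
have [B hB] := choice bounded_path.
(* The countably many times: the ticks of all the grids, and T itself. *)
pose q n : R := if @unpickle (nat * nat)%type n is Some (i, j) then
   Num.min T (i%:R / j.+1%:R) else 0.
have q0 n : 0 <= q n <= T.
  rewrite /q; case: unpickle => [[i j]|]; last by rewrite lexx.
  by rewrite le_min T0 divr_ge0//= ge_min lexx.
pose S w := ereal_sup [set (expR (G (X t w)))%:E | t in `[0%R, T]].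
have SE : S = fun w => esups (fun n => (expR (G (X (q n) w)))%:E) 0%N.
  apply/funext => w; apply/eqP; rewrite eq_le; apply/andP; split; last first.
    apply: ge_ereal_sup => _ [n _ <-]; apply: ereal_sup_ubound.
    by exists (q n) => //=; rewrite in_itv/= q0.
  apply: ge_ereal_sup => _ [t /= + <-]; rewrite in_itv/= => /andP[t0 tT].
  move: tT; rewrite le_eqVlt => /predU1P[->|tT].
    apply: ereal_sup_ubound; exists (pickle ((Num.truncn T).+1, 0%N)) => //.
    by rewrite /q pickleK/= min_l// divr1 ltW// truncnS_gt.
  apply: (@le_trans _ _ (ereal_sup [set (expR (G (X (q n) w)))%:E | n in setT])); last first.
    by rewrite /esups /sdrop/= le_eqVlt; apply/orP; left; apply/eqP; congr ereal_sup;
       apply/seteqP; split => _ [n _ <-]; exists n.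
  have c : expR (G (X (next_tick (1 / n.+1%:R) t) w)) @[n --> \oo] --> expR (G (X t w)).
    have rc : right_continuous_from0 (fun s => expR (G (X s w))).
      apply: (path_right_continuous X_markov (f := fun y => expR (G y))) => y.
      by apply: continuous_cvg; [exact: continuous_expR|exact: G_cont].
    by apply: (cvg_right_next_tick (f := fun s => expR (G (X s w)))) => //; exact: rc.
  have cE : (expR (G (X (next_tick (1 / n.+1%:R) t) w)))%:E @[n --> \oo] --> (expR (G (X t w)))%:E.
    by apply/cvg_EFin => //; exact: nearW.
  rewrite -(cvg_lim _ cE)//; apply: lime_le; first by apply/cvg_ex; eexists; exact: cE.
  have tT0 : 0 < T - t by rewrite subr_gt0.
  near=> n; apply: ereal_sup_ubound.
  exists (pickle ((Num.truncn (t / (1 / n.+1%:R))).+1, n)) => //.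
  rewrite /q pickleK min_r; first by rewrite /next_tick mulrC mul1r.
  have nt : next_tick (1 / n.+1%:R) t <= T.
    apply: le_trans (next_tick_le _ t0) _; first by rewrite divr_gt0.
    rewrite -lerBrDl mul1r ltW//; near: n; exact: near_infty_natSinv_lt (PosNum tT0).
  by move: nt; rewrite /next_tick mulrC mul1r.
have mS : measurable_fun setT S.
  rewrite SE; apply: measurable_fun_esups => n; apply/measurable_EFinP.
  apply: measurableT_comp => //; apply: (measurable_comp_X X_markov); first by have /andP[] := q0 n.
  exact: continuous_measurable_borel.
have S_ge w t : 0 <= t <= T -> ((expR (G (X t w)))%:E <= S w)%E.
  by move=> tT; apply: ereal_sup_ubound; exists t => //=; rewrite in_itv.
have S_fin w : S w \is a fin_num.
  have z0 : 0 <= (0 : R) <= T by rewrite lexx.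
  have S0 := S_ge w 0 z0.
  rewrite ge0_fin_numE; last by apply: le_trans S0; rewrite lee_fin expR_ge0.
  apply: (@le_lt_trans _ _ (expR (B w)%:R)%:E); last exact: ltry.
  apply: ge_ereal_sup => _ [t /= + <-]; rewrite in_itv/= => tT.
  by rewrite lee_fin ler_expR ltW// hB.
have SfE w : S w = (fine (S w))%:E by rewrite fineK.
exists (fun w => fine (S w)); split.
- exact: (measurableT_comp (fine_measurable measurableT) mS).
- by move=> w t tT; rewrite -lee_fin -SfE; exact: S_ge.
- move=> x; apply: ge0_integrable.
  + exact: (measurableT_comp (fine_measurable measurableT) mS).
  + move=> w; have z0 : 0 <= (0 : R) <= T by rewrite lexx.
    rewrite -lee_fin -SfE; apply: le_trans (S_ge w 0 z0).
    by rewrite lee_fin expR_ge0.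
  + by under eq_integral do rewrite -SfE; exact: G_sup.
Unshelve. all: by end_near. Qed.

Lemma expG_everywhere_integrable : everywhere_integrable X P (fun y => expR (G y)).
Proof.
have mG : measurable_fun [set: borel E] ((fun y => expR (G y)) : borel E -> R).
  by apply: measurableT_comp => //; exact: continuous_measurable_borel.
split; [exact: mG|by move=> y; exact: expR_ge0|].
move=> s y s0; have [D [_ hD iD]] := dominator_exists s0.
apply: (@dominated_integrable_fun _ _ _ (P y) _ D) => //.
  exact: (measurable_comp_X X_markov (f := fun y => expR (G y)) s0).
  by move=> w; rewrite ger0_norm ?expR_ge0// hD// s0 lexx.
exact: iD.
Qed.

End reward.

(** * Stopping times *)

Section stopping.
Context {R : realType} {d : measure_display} {Omega : measurableType d}.
Context {E : pmetricType R}.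
Context (F : R -> set_system Omega) (X : R -> Omega -> E).
Context (P : E -> probability Omega R).
Hypothesis X_markov : standard_markov_process F X P.

Let sF t : 0 <= t -> sigma_algebra setT (F t).
Proof. exact: (filtration_sigma_algebra (smp_filtration X_markov)). Qed.
Let Fm t : 0 <= t -> F t `<=` measurable.
Proof. exact: (filtration_measurable (smp_filtration X_markov)). Qed.

Lemma F_set0 t : 0 <= t -> F t set0.
Proof. by move=> t0; have [] := sF t0. Qed.

Lemma F_setC t A : 0 <= t -> F t A -> F t (~` A).
Proof. by move=> t0 FA; have [_ FC _] := sF t0; rewrite -setTD; exact: FC. Qed.

Lemma F_setT t : 0 <= t -> F t setT.
Proof. by move=> t0; rewrite -setC0; apply: F_setC => //; exact: F_set0. Qed.

Lemma F_bigcup t (A : nat -> set Omega) : 0 <= t -> (forall n, F t (A n)) -> F t (\bigcup_n A n).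
Proof. by move=> t0 FA; have [_ _ FU] := sF t0; exact: FU. Qed.

Lemma F_setU t A B : 0 <= t -> F t A -> F t B -> F t (A `|` B).
Proof.
move=> t0 FA FB; rewrite -bigcup2E; apply: F_bigcup => // -[|[|n]] //=.
exact: F_set0.
Qed.

Lemma F_setI t A B : 0 <= t -> F t A -> F t B -> F t (A `&` B).
Proof.
move=> t0 FA FB; rewrite -[A `&` B]setCK setCI; apply: F_setC => //.
by apply: F_setU => //; exact: F_setC.
Qed.

Lemma F_le s t A : 0 <= s -> s <= t -> F s A -> F t A.
Proof. by move=> s0 st; exact: (filtration_le (smp_filtration X_markov)). Qed.

(** Real-valued stopping times, at which a process can be evaluated directly. *)
Definition finite_stopping_time (tau : Omega -> R) :=
  (forall w, 0 <= tau w) /\ forall t, 0 <= t -> F t [set w | tau w <= t].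

Lemma finite_stopping_timeP tau : stopping_time F (fun w => (tau w)%:E) <->
  finite_stopping_time tau.
Proof.
split=> [[h0 hF]|[h0 hF]]; split.
- by move=> w; have := h0 w; rewrite lee_fin.
- by move=> t t0; have := hF t t0; under eq_set do rewrite lee_fin.
- by move=> w; rewrite lee_fin.
- by move=> t t0; under eq_set do rewrite lee_fin; exact: hF.
Qed.

Lemma stopping_time_min tau (T : R) : 0 <= T -> stopping_time F tau ->
  bounded_stopping_time F T (fun w => mine (tau w) T%:E).
Proof.
move=> T0 [tau0 tauF]; split; last by move=> w; rewrite ge_min lexx orbT.
split; first by move=> w; rewrite le_min tau0 lee_fin.
move=> t t0; have [Tt|tT] := leP T t.
  rewrite (_ : [set _ | _] = setT); first exact: F_setT.
  by apply/seteqP; split => w //= _; rewrite ge_min lee_fin Tt orbT.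
rewrite (_ : [set _ | _] = [set w | (tau w <= t%:E)%E]); first exact: tauF.
by apply/seteqP; split => w /=; rewrite ge_min lee_fin (leNgt T) tT orbF.
Qed.

Lemma stopping_lt tau t : finite_stopping_time tau -> 0 <= t -> F t [set w | tau w < t].
Proof.
move=> [tau0 tauF]; rewrite le_eqVlt => /predU1P[<-|t0].
  rewrite (_ : [set _ | _] = set0); first exact: F_set0.
  by apply/seteqP; split => w //=; rewrite ltNge tau0.
rewrite (_ : [set _ | _] = \bigcup_n [set w | 0 <= t - n.+1%:R^-1 /\ tau w <= t - n.+1%:R^-1]).
  apply: F_bigcup; first exact: ltW.
  move=> n; have [tn|tn] := leP 0 (t - n.+1%:R^-1).
    apply: (F_le tn); first by rewrite gerBl invr_ge0.
    rewrite (_ : [set _ | _] = [set w | tau w <= t - n.+1%:R^-1]); first exact: tauF.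
    by apply/seteqP; split => w /= => [[]//|].
  rewrite (_ : [set _ | _] = set0); first exact/F_set0/ltW.
  by apply/seteqP; split => w //= -[].
apply/seteqP; split => w /=.
  move=> wt; have wt0 : 0 < t - tau w by rewrite subr_gt0.
  have [n _ /(_ n (leqnn n)) /= hn] := near_infty_natSinv_lt (PosNum wt0).
  exists n => //=; have := tau0 w; have {}hn : n.+1%:R^-1 < t - tau w := hn.
  move: hn; set i : R := n.+1%:R^-1 => hn h0; split; lra.
move=> [n _ [_ h]]; apply: le_lt_trans h _.
by rewrite gtrBl invr_gt0.
Qed.

Lemma stopping_ge tau t : finite_stopping_time tau -> 0 <= t -> F t [set w | t <= tau w].
Proof.
move=> htau t0; rewrite (_ : [set _ | _] = ~` [set w | tau w < t]).
  by apply: F_setC => //; exact: stopping_lt.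
by apply/seteqP; split => w /=; rewrite leNgt => /negP.
Qed.

Lemma measurable_stopping tau : finite_stopping_time tau -> measurable_fun setT tau.
Proof.
move=> [tau0 tauF]; apply: (measurability _ (RGenOInfty.measurableE R)).
move=> _ [_ [a ->] <-]; rewrite setTI.
have -> : tau @^-1` `]a, +oo[ = ~` [set w | tau w <= a].
  by apply/seteqP; split => w /=; rewrite in_itv/= andbT ltNge => /negP.
apply: measurableC; have [a0|a0] := leP 0 a; first exact: (Fm a0 (tauF a a0)).
rewrite (_ : [set _ | _] = set0); first exact: measurable0.
apply/seteqP; split => w //= h.
by have := le_lt_trans (le_trans (tau0 w) h) a0; rewrite ltxx.
Qed.

Lemma finite_stopping_cst t : 0 <= t -> finite_stopping_time (fun=> t).
Proof.
move=> t0; split => // s s0; have [ts|st] := leP t s.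
  by rewrite (_ : [set _ | _] = setT); [exact: F_setT|apply/seteqP; split].
by rewrite (_ : [set _ | _] = set0); [exact: F_set0|apply/seteqP; split].
Qed.

(** The choice between the two times depends on an event known at time [t], before
either of them occurs. *)
Lemma finite_stopping_piece t (A : set Omega) tau1 tau2 : 0 <= t -> F t A ->
  finite_stopping_time tau1 -> finite_stopping_time tau2 ->
  (forall w, A w -> t <= tau1 w) -> (forall w, A w -> t <= tau2 w) ->
  finite_stopping_time (fun w => if w \in A then tau2 w else tau1 w).
Proof.
move=> t0 FA [h10 h1] [h20 h2] A1 A2; split; first by move=> w; case: ifP.
move=> s s0; have [ts|st] := leP t s.
  rewrite (_ : [set _ | _] = (A `&` [set w | tau2 w <= s]) `|` (~` A `&` [set w | tau1 w <= s])).
    apply: F_setU => //; apply: F_setI => //; [exact: F_le FA|exact: h2| |exact: h1].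
    by apply: F_setC => //; exact: F_le FA.
  apply/seteqP; split => w /=.
    by case: ifPn => [|/negP]; rewrite inE => Aw ?; [left|right].
  by case=> -[Aw h]; [rewrite mem_set|rewrite memNset].
rewrite (_ : [set _ | _] = [set w | tau1 w <= s]); first exact: h1.
apply/seteqP; split => w /=.
  case: ifPn => //; rewrite inE => Aw h.
  by have := lt_le_trans st (le_trans (A2 w Aw) h); rewrite ltxx.
by case: ifPn => //; rewrite inE => Aw h; have := lt_le_trans st (le_trans (A1 w Aw) h); rewrite ltxx.
Qed.

End stopping.

(** * Optimal stopping on a time grid *)

Section optimal_stopping.
Context {R : realType} {d : measure_display} {Omega : measurableType d}.
Context {E : pmetricType R}.
Context (F : R -> set_system Omega) (X : R -> Omega -> E).
Context (P : E -> probability Omega R) (g G : E -> R) (c M : R).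
Hypothesis X_markov : standard_markov_process F X P.
Hypothesis g_cont : continuous g.
Hypothesis c_ge0 : 0 <= c.
Hypothesis g_bounds : forall x, c <= g x <= M.
Hypothesis G_cont : continuous G.
Hypothesis G_ge0 : forall x, 0 <= G x.
Hypothesis G_sup : forall (T : R) x, 0 <= T ->
    (\int[P x]_w ereal_sup [set (expR (G (X t w)))%:E | t in `[0%R, T]]
      < +oo)%E.
Hypothesis exp_cont : forall (T : R) (h : E -> R), 0 <= T -> continuous h ->
    (forall x, 0 <= h x <= G x) ->
    continuous (fun x =>
      'E_(P x)[fun w => expR (running X g T w + h (X T w))]%E).

Notation Fspace t := (g_sigma_algebraType (F t)).
Notation Q := (growth X P g).
Notation run := (running X g).
Notation expG := (fun y => expR (G y)).

(** Rewards whose cost has an integrable envelope, by [dominator_exists]. *)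
Definition dominated (C : R) (f : E -> R) :=
  measurable_fun [set: borel E] (f : borel E -> R) /\
  forall y, 0 <= f y <= C * expR (G y).

Lemma dominated_everywhere_integrable C f : 0 <= C -> dominated C f -> everywhere_integrable X P f.
Proof.
move=> C0 [mf fC]; apply: (everywhere_integrable_le X_markov (k := fun y => C * expR (G y))) => //.
by apply: everywhere_integrableZ => //; exact: (expG_everywhere_integrable X_markov G_cont G_sup).
Qed.

(** The reward is [phi] before the horizon and [f] at the horizon: [phi = e^G]
with [f = e^G] gives the upper problem, and with [f = 1] the lower one. *)
Definition stopped_value (T : R) (phi f : E -> R) (tau : Omega -> R) (w : Omega) : R :=
  if tau w < T then phi (X (tau w) w) else f (X T w).

Definition cost (T : R) (phi f : E -> R) (tau : Omega -> R) (w : Omega) : R :=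
  expR (run (tau w) w) * stopped_value T phi f tau w.

Section cost_properties.
Context (C T : R) (phi f : E -> R) (tau : Omega -> R).
Hypothesis C_ge0 : 0 <= C.
Hypothesis T_ge0 : 0 <= T.
Hypothesis phi_cont : continuous phi.
Hypothesis phi_dom : forall y, 0 <= phi y <= C * expR (G y).
Hypothesis f_dom : dominated C f.
Hypothesis tau_bnd : forall w, 0 <= tau w <= T.
Hypothesis tau_meas : measurable_fun setT tau.

Lemma measurable_stopped_value : measurable_fun setT (stopped_value T phi f tau).
Proof.
have tau0 w : 0 <= tau w by have /andP[] := tau_bnd w.
apply: measurable_fun_ifT.
- exact: measurable_fun_ltr.
- apply: (@measurable_random_time _ _ _ (fun t w => phi (X t w))) => //.
    by move=> t t0; apply: (measurable_comp_X X_markov) => //; exact: continuous_measurable_borel.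
  move=> w t t0.
  have h : right_continuous_from0 (fun t => phi (X t w)) by exact: (path_right_continuous X_markov).
  exact: h.
- by have [mf _] := f_dom; apply: (measurable_comp_X X_markov).
Qed.

Lemma measurable_cost : measurable_fun setT (cost T phi f tau).
Proof.
have tau0 w : 0 <= tau w by have /andP[] := tau_bnd w.
apply: measurable_funM; last exact: measurable_stopped_value.
apply: measurableT_comp => //.
apply: (@measurable_random_time _ _ _ run) => //.
- by move=> t t0; exact: (measurable_running X_markov g_cont c_ge0 g_bounds).
- by move=> w t t0; exact: (running_right_continuous X_markov g_cont c_ge0 g_bounds t0).
Qed.

Lemma cost_bounds D w : (forall w t, 0 <= t <= T -> expR (G (X t w)) <= D w) ->
  0 <= cost T phi f tau w <= C * expR (M * T) * D w.
Proof.
move=> hD; have /andP[t0 tT] := tau_bnd w; have [_ fC] := f_dom.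
have /andP[s0 s1] : 0 <= stopped_value T phi f tau w <= C * D w.
  rewrite /stopped_value; case: ifP => _.
    have /andP[-> h] := phi_dom (X (tau w) w); rewrite (le_trans h)//.
    by rewrite ler_wpM2l// hD// t0.
  have /andP[-> h] := fC (X T w); rewrite (le_trans h)//.
  by rewrite ler_wpM2l// hD// T_ge0 lexx.
rewrite mulr_ge0 ?expR_ge0//=.
rewrite (mulrC C) -mulrA; apply: ler_pM; rewrite ?expR_ge0// ler_expR.
have /andP[_ h] := running_bounds X_markov g_cont c_ge0 g_bounds w t0.
rewrite (le_trans h)// ler_wpM2l//.
by have /andP[h1 h2] := g_bounds point; rewrite (le_trans c_ge0)// (le_trans h1).
Qed.

Lemma cost_ge0 w : 0 <= cost T phi f tau w.
Proof.
have [_ fC] := f_dom; rewrite mulr_ge0 ?expR_ge0// /stopped_value.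
case: ifP => _; first by have /andP[] := phi_dom (X (tau w) w).
by have /andP[] := fC (X T w).
Qed.

Lemma integrable_cost x : (P x).-integrable setT (EFin \o cost T phi f tau).
Proof.
have [D [mD hD iD]] := dominator_exists X_markov G_cont G_sup T_ge0.
apply: (@dominated_integrable_fun _ _ _ (P x) _ (fun w => C * expR (M * T) * D w)).
- exact: measurable_cost.
- by move=> w; have /andP[h1 h2] := cost_bounds w hD; rewrite ger0_norm.
- exact/integrable_scale/iD.
Qed.

Lemma integrable_cost_indic x (A : set Omega) : measurable A ->
  (P x).-integrable setT (EFin \o (fun w => \1_A w * cost T phi f tau w)).
Proof.
move=> mA; apply: (@dominated_integrable_fun _ _ _ (P x) _ (cost T phi f tau)).
- by apply: measurable_funM; [exact: measurable_indic|exact: measurable_cost].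
- move=> w; have := cost_ge0 w => h; rewrite normrM (ger0_norm h) indicE.
  by case: (w \in A); rewrite ?normr1 ?mul1r// normr0 mul0r.
- exact: integrable_cost.
Qed.

End cost_properties.

(** One step of backward induction: stop, or continue for a time [h]. *)
Definition bellman (psi : E -> R) (h : R) (f : E -> R) (y : E) : R :=
  Num.min (psi y) (Q h f y).

Lemma indic_F_measurable t (A : set Omega) : 0 <= t -> F t A ->
  measurable_fun setT (\1_A : Fspace t -> R).
Proof.
move=> t0 FA; apply: measurable_indic; rewrite generated_measurableE//.
exact: (filtration_sigma_algebra (smp_filtration X_markov)).
Qed.

Lemma markov_cost x t h f (A : set Omega) C : 0 <= t -> 0 <= h -> F t A -> 0 <= C ->
  dominated C f ->
  \int[P x]_w (\1_A w * (expR (run (t + h) w) * f (X (t + h) w))) =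
  \int[P x]_w (\1_A w * (expR (run t w) * Q h f (X t w))).
Proof.
move=> t0 h0 FA C0 df.
apply: (@markov_growth _ _ _ _ _ _ _ _ c M X_markov g_cont c_ge0 g_bounds x t h f \1_A 1) => //.
- exact: dominated_everywhere_integrable df.
- exact: indic_F_measurable.
- by move=> w; rewrite indicE; case: (w \in A); rewrite ?lexx ?ler01.
Qed.

Lemma integral_at_start (f : E -> R) x : measurable_fun [set: borel E] (f : borel E -> R) ->
  \int[P x]_w (\1_setT w * (expR (run 0 w) * f (X 0 w))) = f x.
Proof.
move=> mf; rewrite -[RHS](transition_start X_markov x mf); apply: eq_Rintegral => w _.
by rewrite indicT mul1r (running0 X g) expR0 mul1r.
Qed.

Lemma dominated_bellman (psi : E -> R) h (f : E -> R) : 0 <= h -> continuous psi ->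
  (forall y, 0 <= psi y <= expR (G y)) -> dominated 1 f -> dominated 1 (bellman psi h f).
Proof.
move=> h0 cpsi psiG df; have Df := dominated_everywhere_integrable ler01 df.
have [mQ Q0 _] := growth_everywhere_integrable X_markov g_cont c_ge0 g_bounds h0 Df.
split.
  by apply: measurable_minr => //; exact: continuous_measurable_borel.
move=> y; have /andP[p0 pG] := psiG y.
by rewrite /bellman le_min p0 Q0/= mul1r ge_min pG.
Qed.

Lemma dominated_iter_bellman (psi : E -> R) h (f : E -> R) n : 0 <= h -> continuous psi ->
  (forall y, 0 <= psi y <= expR (G y)) -> dominated 1 f ->
  dominated 1 (iter n (bellman psi h) f).
Proof. by move=> h0 cpsi psiG df; elim: n => //= n; exact: dominated_bellman. Qed.

Lemma Rintegral_indic_split x (A B : set Omega) (f : Omega -> R) :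
  measurable A -> measurable B -> (P x).-integrable setT (EFin \o f) ->
  \int[P x]_w (\1_A w * f w) =
  \int[P x]_w (\1_(A `&` B) w * f w) + \int[P x]_w (\1_(A `\` B) w * f w).
Proof.
move=> mA mB fi.
have ii (S : set Omega) : measurable S -> (P x).-integrable setT (EFin \o (fun w => \1_S w * f w)).
  have /measurable_EFinP mf := measurable_int _ fi.
  move=> mS; apply: le_integrable fi => //.
    by apply/measurable_EFinP/measurable_funM => //; exact: measurable_indic.
  move=> w _ /=; rewrite lee_fin normrM indicE.
  by case: (w \in S); rewrite ?normr1 ?mul1r// normr0 mul0r.
rewrite -RintegralD//; [|exact/ii/measurableI|exact/ii/measurableD].
apply: eq_Rintegral => w _; rewrite -mulrDl; congr (_ * _).
rewrite !indicE in_setI in_setD; case: (w \in A) => //=; rewrite ?addr0//.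
by case: (w \in B); rewrite ?addr0 ?add0r.
Qed.

Lemma Rintegral_setC_split x (A : set Omega) (f : Omega -> R) :
  measurable A -> (P x).-integrable setT (EFin \o f) ->
  \int[P x]_w f w = \int[P x]_w (\1_A w * f w) + \int[P x]_w (\1_(~` A) w * f w).
Proof.
move=> mA fi; have := Rintegral_indic_split measurableT mA fi.
by rewrite setTI setTD => <-; apply: eq_Rintegral => w _; rewrite indicT mul1r.
Qed.

Lemma eq_Rintegral_indic (mu : probability Omega R) (A : set Omega) (f1 f2 : Omega -> R) :
  (forall w, A w -> f1 w = f2 w) ->
  \int[mu]_w (\1_A w * f1 w) = \int[mu]_w (\1_A w * f2 w).
Proof.
move=> f12; apply: eq_Rintegral => w _; rewrite indicE.
by case: (boolP (w \in A)) => [|_]; rewrite ?mul0r// inE => /f12 ->.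
Qed.

(** Stop at [t] where [psi] is at most the value [Q h v] of continuing, and
elsewhere follow from time [t + h] the stopping time of the problem with one step
less.  The claim concerns an event of [F t], and one stopping time for all
starting points, so that the decision from time [t] on can be concatenated with
earlier decisions. *)
Lemma bellman_attained (psi : E -> R) h (f : E -> R) n : 0 < h -> continuous psi ->
  (forall y, 0 <= psi y <= expR (G y)) -> dominated 1 f ->
  forall t (A : set Omega), 0 <= t -> F t A -> exists tau : Omega -> R,
  [/\ finite_stopping_time F tau, forall w, t <= tau w <= t + n%:R * h &
   forall x, \int[P x]_w (\1_A w * (expR (run t w) * iter n (bellman psi h) f (X t w))) =
             \int[P x]_w (\1_A w * cost (t + n%:R * h) psi f tau w)].
Proof.
move=> h0 cpsi psiG df; have h0' := ltW h0.
have psiG' y : 0 <= psi y <= 1 * expR (G y) by rewrite mul1r.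
elim: n => [|n IH] t A t0 FA.
  exists (fun=> t); split; first exact: (finite_stopping_cst X_markov).
    by move=> w; rewrite mul0r addr0 lexx.
  move=> x; rewrite mul0r addr0; apply: eq_Rintegral => w _.
  by rewrite /cost /stopped_value ltxx.
rewrite iterS; set v := iter n _ f.
have dv : dominated 1 v by exact: dominated_iter_bellman.
have Dv := dominated_everywhere_integrable ler01 dv.
have [mQ Q0 _] := growth_everywhere_integrable X_markov g_cont c_ge0 g_bounds h0' Dv.
pose B := [set w | psi (X t w) <= Q h v (X t w)].
have FB : F t B.
  rewrite -(generated_measurableE (filtration_sigma_algebra (smp_filtration X_markov) t0)).
  rewrite -[X in measurable X]setTI.
  apply: (measurable_fun_le (d := (F t).-sigma) (T := Fspace t)) => //.
    by apply: (F_measurable_comp X_markov) => //; exact: continuous_measurable_borel.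
  exact: (F_measurable_comp X_markov).
have th0 : 0 <= t + h by rewrite addr_ge0.
have FAB : F t (A `\` B).
  by rewrite setDE; apply: (F_setI X_markov) => //; exact: (F_setC X_markov).
have FAB' : F (t + h) (A `\` B) by apply: (F_le X_markov t0 _ FAB); rewrite lerDl.
have [tau' [st' bnd' int']] := IH (t + h) (A `\` B) th0 FAB'.
have Tn : t + h + n%:R * h = t + n.+1%:R * h by rewrite -natr1 mulrDl mul1r addrA addrAC.
rewrite Tn in bnd' int'.
have tT : t < t + n.+1%:R * h by rewrite ltrDl mulr_gt0.
pose tau w := if w \in ~` B then tau' w else t.
have st : finite_stopping_time F tau.
  apply: (@finite_stopping_piece _ _ _ _ _ _ _ X_markov t (~` B) (fun=> t) tau') => //.
  - exact: (F_setC X_markov).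
  - exact: (finite_stopping_cst X_markov).
  - by move=> w _; have /andP[+ _] := bnd' w; apply: le_trans; rewrite lerDl.
have bnd w : t <= tau w <= t + n.+1%:R * h.
  rewrite /tau; case: ifP => _; last by rewrite lexx ltW.
  by have /andP[h1 ->] := bnd' w; rewrite (le_trans _ h1)// lerDl.
have Fm := filtration_measurable (smp_filtration X_markov) t0.
have mA := Fm _ FA; have mB := Fm _ FB.
exists tau; split => // x.
have bnd0 w : 0 <= tau w <= t + n.+1%:R * h.
  by have /andP[h1 ->] := bnd w; rewrite (le_trans t0).
have mtau := measurable_stopping X_markov st.
rewrite (@Rintegral_indic_split x A B)//; last first.
  have dbv : dominated 1 (bellman psi h v) by exact: dominated_bellman.
  have tt (w : Omega) : 0 <= t <= t by rewrite t0 lexx.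
  have := @integrable_cost 1 t psi (bellman psi h v) (fun=> t) ler01 t0 cpsi psiG' dbv tt
    (@measurable_cst _ _ _ _ _ _) x.
  by rewrite (_ : cost _ _ _ _ = fun w => expR (run t w) * bellman psi h v (X t w))//;
     apply/funext => w; rewrite /cost /stopped_value ltxx.
rewrite (@Rintegral_indic_split x A B _ mA mB
  (integrable_cost ler01 _ cpsi psiG' df bnd0 mtau x)); last first.
  by rewrite addr_ge0// mulr_ge0.
congr (_ + _).
  apply: eq_Rintegral_indic => w [Aw Bw].
  rewrite /cost /stopped_value /tau memNset ?tT; last by move=> /(_ Bw).
  by rewrite /bellman min_l.
transitivity (\int[P x]_w (\1_(A `\` B) w * (expR (run t w) * Q h v (X t w)))).
  apply: eq_Rintegral_indic => w [Aw nBw]; rewrite /bellman min_r// ltW// ltNge.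
  exact/negP.
rewrite -(markov_cost x t0 h0' FAB ler01 dv) int'.
apply: eq_Rintegral_indic => w [Aw nBw].
by rewrite /cost /stopped_value /tau mem_set.
Qed.

(** Let the cost be computed with the time [minn kappa k], and with the value
[v (N - k)] for the paths not stopped before step [k].  It equals [v N x] for
[k = 0] and is nondecreasing in [k]: on [k < kappa] because
[v i.+1 <= Q delta (v i)], on [k = kappa] because [v (N - k) <= B]. *)
Lemma verification (delta C : R) (B : E -> R) (v : nat -> E -> R) (N : nat)
    (kappa : Omega -> nat) x : 0 < delta -> 0 <= C -> continuous B ->
  (forall y, 0 <= B y <= C * expR (G y)) ->
  (forall i, dominated C (v i)) -> (forall i y, v i y <= B y) ->
  (forall i y, v i.+1 y <= Q delta (v i) y) ->
  (forall w, (kappa w <= N)%N) ->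
  (forall k, (k < N)%N -> F (delta * k%:R) [set w | (k < kappa w)%N]) ->
  v N x <= \int[P x]_w cost (delta * N%:R) B (v 0%N) (fun w => delta * (kappa w)%:R) w.
Proof.
move=> d0 C0 cB BC dv vB vQ kN Fk; have d0' := ltW d0.
have dk0 k : 0 <= delta * k%:R by rewrite mulr_ge0.
have mk k : measurable [set w | (k < kappa w)%N].
  have [kN'|Nk] := ltnP k N; first exact: (filtration_measurable (smp_filtration X_markov) (dk0 k) (Fk k kN')).
  rewrite (_ : [set _ | _] = set0)//; apply/seteqP; split => w //=.
  by rewrite ltnNge (leq_trans (kN w) Nk).
pose tk k w : R := delta * (minn (kappa w) k)%:R.
have tk_bnd k w : 0 <= tk k w <= delta * k%:R.
  by rewrite dk0/= ler_pM2l// ler_nat geq_minr.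
have mtk k : measurable_fun setT (tk k).
  rewrite (_ : tk k = fun w => delta * \sum_(i < k) \1_[set w | (i < kappa w)%N] w).
    by apply: measurable_funM => //; apply: measurable_sum => i; exact: measurable_indic.
  apply/funext => w; rewrite /tk; congr (_ * _).
  elim: k => [|k IH]; first by rewrite big_ord0 minn0.
  rewrite big_ord_recr/= -IH indicE.
  have [kw|wk] := ltnP k (kappa w).
    by rewrite mem_set//= (minn_idPr kw) -natr1.
  rewrite memNset/=; last by move=> /=; rewrite ltnNge wk.
  by rewrite addr0 (minn_idPl (leqW wk)).
have step k : (k <= N)%N ->
    v N x <= \int[P x]_w cost (delta * k%:R) B (v (N - k)%N) (tk k) w.
  elim: k => [_|k IH kN'].
    rewrite subn0; have [mv _] := dv N.
    rewrite -[leLHS](integral_at_start x mv) le_eqVlt; apply/orP; left; apply/eqP.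
    apply: eq_Rintegral => w _.
    by rewrite indicT mul1r /cost /stopped_value /tk minn0 mulr0 ltxx.
  apply: le_trans (IH (ltnW kN')) _.
  pose A := [set w | (k < kappa w)%N]; have FA : F (delta * k%:R) A := Fk k kN'.
  have split_cost j := Rintegral_setC_split (mk k)
    (integrable_cost C0 (dk0 j) cB BC (dv (N - j)%N) (tk_bnd j) (mtk j) x).
  rewrite !split_cost; apply: lerD.
    rewrite (@eq_Rintegral_indic _ _ _ (fun w => expR (run (delta * k%:R) w) *
        v (N - k)%N (X (delta * k%:R) w))); last first.
      move=> w Aw; rewrite /cost /stopped_value /tk (minn_idPr (ltnW Aw)).
      by rewrite ltxx.
    rewrite [leRHS](@eq_Rintegral_indic _ _ _ (fun w => expR (run (delta * k%:R + delta) w) *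
        v (N - k.+1)%N (X (delta * k%:R + delta) w))); last first.
      move=> w Aw; rewrite /cost /stopped_value /tk (minn_idPr Aw).
      by rewrite ltxx -natr1 mulrDr mulr1.
    have mc := markov_cost x (dk0 k) d0' FA C0 (dv (N - k.+1)%N).
    rewrite [leRHS]mc.
    have ind0 w : 0 <= (\1_A w : R) by rewrite indicE.
    have DQ := growth_everywhere_integrable X_markov g_cont c_ge0 g_bounds d0'
      (dominated_everywhere_integrable C0 (dv (N - k.+1)%N)).
    have [mQ Q0 _] := DQ.
    have mr := measurable_running X_markov g_cont c_ge0 g_bounds (dk0 k).
    have rb w := running_bounds X_markov g_cont c_ge0 g_bounds w (dk0 k).
    have mi := measurable_indic (R := R) (D := setT) (mk k).
    have bI w : `|\1_A w| <= 1 :> R by rewrite indicE; case: (w \in A); rewrite ?normr1// normr0.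
    have integ (u : E -> R) : everywhere_integrable X P u ->
       (P x).-integrable setT (EFin \o (fun w => \1_A w * (expR (run (delta * k%:R) w) * u (X (delta * k%:R) w)))).
      move=> [mu u0 iu].
      apply: (@dominated_integrable_fun _ _ _ (P x) _ (fun w => expR (M * (delta * k%:R)) * u (X (delta * k%:R) w))).
      - apply: measurable_funM => //; apply: measurable_funM; first exact: measurableT_comp.
        exact: (measurable_comp_X X_markov).
      - move=> w; rewrite normrM -[leRHS]mul1r; apply: ler_pM => //.
        rewrite ger0_norm ?mulr_ge0 ?expR_ge0// ler_wpM2r// ler_expR.
        by have /andP[] := rb w.
      - exact/integrable_scale/iu.
    apply: le_Rintegral => //.
    - exact/integ/(dominated_everywhere_integrable C0 (dv _)).
    - exact: integ.
    - move=> w _; rewrite ler_wpM2l// ler_wpM2l ?expR_ge0//.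
      by rewrite (_ : (N - k)%N = (N - k.+1).+1) ?vQ// subnSK.
  apply: le_Rintegral => //.
  - exact: (integrable_cost_indic C0 (dk0 _) cB BC (dv _) (tk_bnd _) (mtk _) x (measurableC (mk k))).
  - exact: (integrable_cost_indic C0 (dk0 _) cB BC (dv _) (tk_bnd _) (mtk _) x (measurableC (mk k))).
  - move=> w _; rewrite indicE; case: (boolP (w \in ~` A)); last by rewrite !mul0r.
    rewrite inE /A/= => /negP; rewrite -leqNgt => wk; rewrite !mul1r.
    rewrite /cost /stopped_value /tk (minn_idPl wk) (minn_idPl (leqW wk)).
    rewrite ler_wpM2l ?expR_ge0// !ltr_pM2l// !ltr_nat ltnS wk.
    by case: ltnP => // kw; rewrite (_ : k = kappa w) ?vB//; apply/eqP; rewrite eqn_leq kw wk.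
have := step N (leqnn N); rewrite subnn => h; apply: le_trans h _.
rewrite le_eqVlt; apply/orP; left; apply/eqP; apply: eq_Rintegral => w _.
by rewrite /tk /cost /stopped_value (minn_idPl (kN w)).
Qed.

(** * Refinement of the grid *)

Lemma expG_continuous : continuous expG.
Proof. by move=> y; apply: continuous_cvg; [exact: continuous_expR|exact: G_cont]. Qed.

Lemma dominated_expG : dominated 1 expG.
Proof.
split; first by apply: continuous_measurable_borel; exact: expG_continuous.
by move=> y; rewrite expR_ge0 mul1r lexx.
Qed.

Lemma dominated_continuous (f : E -> R) : continuous f ->
  (forall y, 1 <= f y <= expR (G y)) -> dominated 1 f.
Proof.
move=> cf f1; split; first exact: continuous_measurable_borel.
by move=> y; rewrite mul1r; have /andP[h ->] := f1 y; rewrite (le_trans ler01).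
Qed.

(** This is [exp_cont] for the exponent [ln f], which is between 0 and [G]. *)
Lemma growth_continuous (f : E -> R) h : 0 <= h -> continuous f ->
  (forall y, 1 <= f y <= expR (G y)) -> continuous (Q h f).
Proof.
move=> h0 cf f1.
have f0 y : 0 < f y by have /andP[h1 _] := f1 y; exact: lt_le_trans h1.
have df := dominated_continuous cf f1.
have Df := dominated_everywhere_integrable ler01 df.
have [mf _ iD] := Df.
have lncont : continuous (fun y => ln (f y)).
  by move=> y; apply: continuous_cvg; [exact: continuous_ln|exact: cf].
have lnG y : 0 <= ln (f y) <= G y.
  have /andP[h1 h2] := f1 y; rewrite ln_ge0//=.
  by rewrite -[leRHS]expRK ler_ln// posrE// expR_gt0.
have cE := exp_cont h0 lncont lnG.
have eE y : 'E_(P y)[fun w => expR (run h w + ln (f (X h w)))]%E = (Q h f y)%:E.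
  rewrite unlock /growth /Rintegral fineK.
    by apply: eq_integral => w _; rewrite expRD lnK// posrE.
  by apply: integrable_fin_num => //; exact: (integrable_growth X_markov g_cont c_ge0 g_bounds y h0 Df).
rewrite (funext eE) in cE.
by move=> y; have /fine_cvg := cE y.
Qed.

Lemma growth_ge1 (f : E -> R) h y : 0 <= h -> continuous f ->
  (forall y, 1 <= f y <= expR (G y)) -> 1 <= Q h f y.
Proof.
move=> h0 cf f1; have df := dominated_continuous cf f1.
have Df := dominated_everywhere_integrable ler01 df.
have /andP[+ _] := growth_bounds X_markov g_cont c_ge0 g_bounds y h0 Df.
apply: le_trans; rewrite -[leLHS](transition_cst X P h 1 y).
apply: le_Rintegral => //.
- by apply: finite_measure_integrable_cst.
- by have [_ _ iD] := Df; exact: iD.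
- by move=> w _; have /andP[] := f1 (X h w).
Qed.

Lemma bellman_continuous (psi f : E -> R) h : 0 <= h -> continuous psi -> continuous f ->
  (forall y, 1 <= psi y <= expR (G y)) -> (forall y, 1 <= f y <= expR (G y)) ->
  continuous (bellman psi h f) /\ forall y, 1 <= bellman psi h f y <= expR (G y).
Proof.
move=> h0 cpsi cf psi1 f1; split.
  by move=> y; apply: (@continuous_min _ _ psi (Q h f)); [exact: cpsi|exact: growth_continuous].
move=> y; have /andP[p1 pG] := psi1 y; rewrite /bellman le_min p1 growth_ge1//=.
by rewrite ge_min pG.
Qed.

Lemma iter_bellman_continuous (psi f : E -> R) h n : 0 <= h -> continuous psi -> continuous f ->
  (forall y, 1 <= psi y <= expR (G y)) -> (forall y, 1 <= f y <= expR (G y)) ->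
  continuous (iter n (bellman psi h) f) /\ forall y, 1 <= iter n (bellman psi h) f y <= expR (G y).
Proof.
move=> h0 cpsi cf psi1 f1; elim: n => //= n [cn n1]; exact: bellman_continuous.
Qed.

Section grid.
Context (h T : R) (N : nat) (B f : E -> R) (C : R) (tau : Omega -> R).
Hypothesis h_gt0 : 0 < h.
Hypothesis N_gt0 : (0 < N)%N.
Hypothesis T_def : T = N%:R * h.
Hypothesis C_ge0 : 0 <= C.
Hypothesis B_cont : continuous B.
Hypothesis B_dom : forall y, 0 <= B y <= C * expR (G y).
Hypothesis f_dom : dominated C f.
Hypothesis tau_stop : finite_stopping_time F tau.
Hypothesis tau_le : forall w, tau w <= T.

Definition mesh m : R := h / m.+1%:R.

(** Rounding up, strictly except at the horizon, so that right-continuity applies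
and that the events [k < grid_index m] are known at the time of step [k]. *)
Definition grid_index m (w : Omega) : nat :=
  minn (N * m.+1) (Num.truncn (tau w / mesh m)).+1.

Lemma mesh_gt0 m : 0 < mesh m.
Proof. by rewrite divr_gt0. Qed.

Lemma mesh_horizon m : mesh m * (N * m.+1)%:R = T.
Proof. by rewrite /mesh natrM T_def mulrC -mulrA [m.+1%:R * _]mulrC divfK. Qed.

Lemma grid_index_F m k : (k < N * m.+1)%N ->
  F (mesh m * k%:R) [set w | (k < grid_index m w)%N].
Proof.
move=> kN; have m0 := mesh_gt0 m.
rewrite (_ : [set _ | _] = [set w | mesh m * k%:R <= tau w]).
  by apply: (stopping_ge X_markov tau_stop); rewrite mulr_ge0// ltW.
have [tau0 _] := tau_stop.
have q0 w : 0 <= tau w / mesh m by rewrite divr_ge0// ltW.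
by apply/seteqP; split => w /=; rewrite /grid_index ltn_min kN/= ltnS;
  rewrite (truncn_ge_nat _ (q0 w)) ler_pdivlMr// mulrC.
Qed.

Lemma grid_time_bounds m w : 0 <= mesh m * (grid_index m w)%:R <= T.
Proof.
apply/andP; split; first by rewrite mulr_ge0// ltW// mesh_gt0.
by rewrite -(mesh_horizon m) ler_pM2l ?mesh_gt0// ler_nat geq_minl.
Qed.

Let T_ge0 : 0 <= T. Proof. by rewrite T_def mulr_ge0// ltW. Qed.

Lemma grid_index_lt m w : tau w < T -> next_tick (mesh m) (tau w) < T ->
  mesh m * (grid_index m w)%:R = next_tick (mesh m) (tau w).
Proof.
move=> tT nT; rewrite /grid_index /next_tick; congr (_ * _%:R).
apply/minn_idPr; move: nT; rewrite /next_tick -(mesh_horizon m) ltr_pM2l ?mesh_gt0// ltr_nat.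
exact: ltnW.
Qed.

Lemma measurable_grid_time m : measurable_fun setT (fun w => mesh m * (grid_index m w)%:R).
Proof.
have [tau0 _] := tau_stop.
rewrite (_ : (fun w => _) = fun w => Num.min T (next_tick (mesh m) (tau w))).
  apply: measurable_minr => //.
  apply: (@measurable_next_tick _ _ _ (fun t _ => t)) => //; first exact: mesh_gt0.
  exact: (measurable_stopping X_markov).
apply/funext => w; rewrite /grid_index /next_tick -(mesh_horizon m).
by rewrite -minr_pMr ?ltW ?mesh_gt0// -natr_min.
Qed.

(** If [tau = T], the rounded times are equal to [T] as well; if [tau < T], they
are eventually less than [T] and tend to [tau] from the right, so that only the
right-continuity of [B] along the path matters. *)
Lemma cvg_grid_cost x :
  \int[P x]_w cost (mesh m * (N * m.+1)%:R) B f (fun w => mesh m * (grid_index m w)%:R) w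
    @[m --> \oo] --> \int[P x]_w cost T B f tau w.
Proof.
have [tau0 _] := tau_stop.
have [D [mD hD iD]] := dominator_exists X_markov G_cont G_sup T_ge0.
apply: (@cvg_Rintegral _ _ _ (P x) _ _ (fun w => C * expR (M * T) * D w)).
- move=> m; rewrite mesh_horizon.
  exact: (measurable_cost T_ge0 B_cont f_dom (grid_time_bounds m) (measurable_grid_time m)).
- move=> w; under eq_fun do rewrite mesh_horizon.
  have := tau_le w; rewrite le_eqVlt => /predU1P[tT|tT].
    rewrite (_ : (fun m => _) = (fun=> cost T B f tau w)); first exact: cvg_cst.
    apply/funext => m; rewrite /cost /stopped_value.
    suff -> : mesh m * (grid_index m w)%:R = tau w by [].
    have e : T / mesh m = (N * m.+1)%:R.
      by rewrite -(mesh_horizon m) mulrC mulKf// gt_eqF// mesh_gt0.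
    by rewrite /grid_index tT e natrK (minn_idPl (leqnSn _)) mesh_horizon.
  pose Y s := expR (run s w) * B (X s w).
  have rY : right_continuous_from0 Y.
    move=> t t0; apply: cvgM; last first.
      have hB : right_continuous_from0 (fun t => B (X t w)) by exact: (path_right_continuous X_markov).
      exact: hB.
    apply: continuous_cvg; first exact: continuous_expR.
    exact: (running_right_continuous X_markov g_cont c_ge0 g_bounds t0).
  have cY := cvg_right_next_tick h_gt0 (tau0 w) (rY _ (tau0 w)).
  have -> : cost T B f tau w = Y (tau w) by rewrite /cost /stopped_value tT.
  apply: cvg_trans cY; apply: near_eq_cvg.
  have ct := cvg_next_tick h_gt0 (tau0 w).
  near=> m.
  have nT : next_tick (mesh m) (tau w) < T.
    by near: m; exact: (cvgr_lt (tau w)).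
  by rewrite /cost /stopped_value grid_index_lt// nT.
- move=> m w; rewrite mesh_horizon.
  have mg := measurable_grid_time m.
  have /andP[h1 h2] := cost_bounds C_ge0 T_ge0 B_dom f_dom (grid_time_bounds m) w hD.
  by rewrite ger0_norm.
- exact/integrable_scale/iD.
Unshelve. all: by end_near. Qed.

Lemma verification_limit (v : nat -> nat -> E -> R) x a :
  (forall m, v m 0%N = f) -> (forall m i, dominated C (v m i)) ->
  (forall m i y, v m i y <= B y) ->
  (forall m i y, v m i.+1 y <= Q (mesh m) (v m i) y) ->
  (forall m, a <= v m (N * m.+1)%N x) -> a <= \int[P x]_w cost T B f tau w.
Proof.
move=> v0 dv vB vQ av.
rewrite -(cvg_lim (@Rhausdorff R) (@cvg_grid_cost x)); apply: limr_ge.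
  by apply/cvg_ex; eexists; exact: cvg_grid_cost.
apply: nearW => m; rewrite (le_trans (av m))// -(v0 m).
apply: (verification (C := C)) => //.
- exact: mesh_gt0.
- by move=> w; exact: geq_minl.
- by move=> k; exact: grid_index_F.
Qed.

End grid.

(** * The upper value *)

Lemma payoffE (tau : Omega -> R) (T : R) w : tau w <= T ->
  payoff X g G (fun w => (tau w)%:E) w = (cost T expG expG tau w)%:E.
Proof.
move=> tT; rewrite /payoff /cost /stopped_value expRD; case: ltP => // Tt.
by have -> : tau w = T by apply/eqP; rewrite eq_le tT Tt.
Qed.

Lemma payoff_beforeE (tau : Omega -> R) (T : R) w : tau w <= T ->
  payoff_before X g G T (fun w => (tau w)%:E) w = (cost T expG (cst 1) tau w)%:E.
Proof.
move=> tT; rewrite /payoff_before /cost /stopped_value expRD; case: ltP => // Tt.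
by rewrite expR0.
Qed.

Lemma bounded_stopping_timeP (T : R) (tau : Omega -> \bar R) : bounded_stopping_time F T tau ->
  exists tau' : Omega -> R, [/\ finite_stopping_time F tau', forall w, tau' w <= T &
    tau = fun w => (tau' w)%:E].
Proof.
move=> [st tT]; have [tau0 _] := st.
have tauE : tau = fun w => (fine (tau w))%:E.
  apply/funext => w; rewrite fineK// ge0_fin_numE//.
  exact: le_lt_trans (tT w) (ltry T).
exists (fun w => fine (tau w)); split => //.
  by have := st; rewrite [X in stopping_time F X -> _]tauE => /finite_stopping_timeP.
by move=> w; have := tT w; rewrite {1}tauE lee_fin.
Qed.

Lemma bounded_stopping_time_EFin (T : R) (tau : Omega -> R) : finite_stopping_time F tau ->
  (forall w, tau w <= T) -> bounded_stopping_time F T (fun w => (tau w)%:E).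
Proof.
by move=> st tT; split; [exact/finite_stopping_timeP|move=> w; rewrite lee_fin].
Qed.

Lemma integral_costE (T C : R) (phi f : E -> R) tau x : 0 <= C -> 0 <= T -> continuous phi ->
  (forall y, 0 <= phi y <= C * expR (G y)) -> dominated C f ->
  finite_stopping_time F tau -> (forall w, tau w <= T) ->
  (\int[P x]_w (cost T phi f tau w)%:E)%E = (\int[P x]_w cost T phi f tau w)%:E.
Proof.
move=> C0 T0 cphi phiC df st tT; rewrite /Rintegral fineK//.
have [tau0 _] := st.
apply: integrable_fin_num => //.
apply: (integrable_cost C0 T0 cphi phiC df).
  by move=> w; rewrite tau0 tT.
exact: (measurable_stopping X_markov).
Qed.

Lemma expG_bounds y : 1 <= expR (G y) <= expR (G y).
Proof. by rewrite lexx andbT -expR0 ler_expR. Qed.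

Lemma expG_dominated y : 0 <= expR (G y) <= 1 * expR (G y).
Proof. by rewrite expR_ge0 mul1r lexx. Qed.

Lemma upper_value_T_le (S T : R) x : S <= T ->
  (upper_value_T F X P g G T x <= upper_value_T F X P g G S x)%E.
Proof.
move=> ST; apply: le_ereal_inf => _ [tau [st tS] <-]; exists tau => //; split => // w.
by rewrite (le_trans (tS w))// lee_fin.
Qed.

Lemma upper_value_T_cvg x : upper_value_T F X P g G T x @[T --> +oo] -->
  ereal_inf (range (fun T => upper_value_T F X P g G T x)).
Proof. by apply: nonincreasing_cvge => S T; exact: upper_value_T_le. Qed.

Lemma upper_valueE x : upper_value F X P g G x =
  ereal_inf (range (fun T => upper_value_T F X P g G T x)).
Proof. by apply/cvg_lim => //; exact: upper_value_T_cvg. Qed.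

(** [tau /\ T] is a bounded stopping time, and a stopping time bounded by [T0] is
equal to [tau /\ T] for [T >= T0]. *)
Lemma value_wE x : value_w F X P g G x = upper_value F X P g G x.
Proof.
rewrite upper_valueE; apply/eqP; rewrite eq_le; apply/andP; split.
  apply: le_ereal_inf_tmp => _ [T _ <-].
  apply: le_ereal_inf_tmp => _ [tau [st tT] <-].
  apply: (@le_trans _ _ (limf_einf (fun T0 : R =>
      lne (\int[P x]_w payoff X g G (fun w => mine (tau w) T0%:E) w)%E) (+oo%R : set_system R))).
    by apply: ereal_inf_lbound; exists tau.
  rewrite limf_einfE; apply: ge_ereal_sup => _ [V [m [_ mV]] <-].
  apply: ereal_inf_lbound; exists (Num.max (m + 1) T).
    by apply: mV; rewrite lt_max ltrDl ltr01.
  congr lne; apply: eq_integral => w _; congr payoff.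
  apply/funext => w'; rewrite min_l// (le_trans (tT w'))// lee_fin le_max lexx orbT//.
apply: le_ereal_inf_tmp => _ [tau st <-].
rewrite limf_einfE; apply: (@le_trans _ _ (ereal_inf ((fun T0 : R =>
      lne (\int[P x]_w payoff X g G (fun w => mine (tau w) T0%:E) w)%E) @` [set t | 0 < t]))).
  apply: le_ereal_inf_tmp => _ [T /= T0 <-].
  apply: (@le_trans _ _ (upper_value_T F X P g G T x)); first by apply: ereal_inf_lbound; exists T.
  apply: ereal_inf_lbound; exists (fun w => mine (tau w) T%:E) => //.
  exact: (stopping_time_min X_markov (ltW T0)).
by apply: ereal_sup_ubound; exists [set t | 0 < t] => //; exists 0; split => //; exact: num_real.
Qed.

Lemma lne_lt_expR (r a : R) : 0 < r -> (lne r%:E < a%:E)%E = (r < expR a).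
Proof.
by move=> r0; rewrite lne_EFin// lte_fin -[in RHS](lnK r0) ltr_expR.
Qed.

(** By [verification_limit] some grid iterate is less than [e^a] at [x], hence near
[x] by continuity, and by [bellman_attained] it is the cost of a stopping time
at each point. *)
Lemma value_w_upper_semicontinuous : upper_semicontinuous (value_w F X P g G).
Proof.
move=> x a; rewrite value_wE upper_valueE => /ereal_inf_lt[_ [T0 _ <-]].
move=> /ereal_inf_lt[_ [tau0 /bounded_stopping_timeP[tau [st tauT0 ->]] <-]] ltar.
have [tau_ge0 _] := st.
(* A positive horizon, even if tau = 0. *)
pose T := T0 + 1.
have T00 : 0 <= T0 by rewrite (le_trans (tau_ge0 point)).
have T_gt0 : 0 < T by rewrite ltr_wpDl.
have T_ge0 := ltW T_gt0.
have tauT w : tau w <= T by rewrite (le_trans (tauT0 w))// lerDl.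
have cexp := expG_continuous.
have dexp := dominated_expG.
have intE tau' y : finite_stopping_time F tau' -> (forall w, tau' w <= T) ->
    (\int[P y]_w payoff X g G (fun w => (tau' w)%:E) w)%E = (\int[P y]_w cost T expG expG tau' w)%:E.
  move=> st' tT'; rewrite -(integral_costE y ler01 T_ge0 cexp expG_dominated dexp st' tT').
  by apply: eq_integral => w _; apply: payoffE.
have v_prop m := iter_bellman_continuous m.+1
   (ltW (mesh_gt0 T_gt0 m)) cexp cexp expG_bounds expG_bounds.
have int_ge1 tau' y : finite_stopping_time F tau' -> (forall w, tau' w <= T) ->
    1 <= \int[P y]_w cost T expG expG tau' w.
  move=> st' tT'; have [tau'0 _] := st'.
  rewrite -[leLHS](transition_cst X P 0 1 y); apply: le_Rintegral => //.
  - by apply: finite_measure_integrable_cst.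
  - apply: (integrable_cost ler01 T_ge0 cexp expG_dominated dexp).
      by move=> w; rewrite tau'0 tT'.
    exact: (measurable_stopping X_markov).
  - move=> w _; rewrite /cost -[leLHS]mulr1; apply: ler_pM => //.
      by rewrite -expR0 ler_expR (running_ge0 X_markov g_cont c_ge0 g_bounds).
    by rewrite /stopped_value; case: ifP => _; rewrite -[leLHS]expR0 ler_expR.
move: ltar; rewrite intE// lne_lt_expR; last exact: lt_le_trans ltr01 (int_ge1 tau x st tauT).
move=> lta.
have [m vm] : exists m, iter (1 * m.+1) (bellman expG (mesh T m)) expG x < expR a.
  apply: contrapT => nex; move: lta; apply/negP; rewrite -leNgt.
  apply: (@verification_limit T T 1 expG expG 1
    tau T_gt0 _ ler01 cexp expG_dominated dexp st tauT
    (fun m i => iter i (bellman expG (mesh T m)) expG)) => //.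
  - by rewrite mul1r.
  - move=> m i; apply: dominated_iter_bellman => //.
      by apply: ltW; exact: mesh_gt0.
    by move=> y; rewrite expR_ge0 lexx.
  - by move=> m [|i] y //=; rewrite /bellman ge_min lexx.
  - by move=> m i y /=; rewrite /bellman ge_min lexx orbT.
  - by move=> m; rewrite leNgt; apply/negP => h; apply: nex; exists m.
rewrite mul1n in vm; have [cv v1] := v_prop m.
exists [set y | iter m.+1 (bellman expG (mesh T m)) expG y < expR a].
  have : \forall y \near x, iter m.+1 (bellman expG (mesh T m)) expG y < expR a.
    by apply: (cvgr_lt (iter m.+1 (bellman expG (mesh T m)) expG x)) => //; exact: cv.
  exact.
move=> y /= vy.
have FT := F_setT X_markov (lexx 0).
have e0 z : 0 <= expR (G z) <= expR (G z) by rewrite expR_ge0 lexx.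
have [tau' [st' bnd' int']] := bellman_attained m.+1
  (mesh_gt0 T_gt0 m) cexp e0 dexp (lexx 0) FT.
have TE : 0 + m.+1%:R * mesh T m = T by rewrite add0r mulrC divfK.
rewrite TE in bnd' int'.
have tT' w : tau' w <= T by have /andP[] := bnd' w.
rewrite value_wE upper_valueE; apply: (@le_lt_trans _ _ (upper_value_T F X P g G T y)).
  by apply: ereal_inf_lbound; exists T.
apply: (@le_lt_trans _ _ (lne (\int[P y]_w payoff X g G (fun w => (tau' w)%:E) w)%E)).
  by apply: ereal_inf_lbound; exists (fun w => (tau' w)%:E); first exact: bounded_stopping_time_EFin.
rewrite intE// lne_lt_expR; last exact: lt_le_trans ltr01 (int_ge1 tau' y st' tT').
suff <- : iter m.+1 (bellman expG (mesh T m)) expG y = \int[P y]_w cost T expG expG tau' w by [].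
have := int' y.
rewrite (_ : \int[P y]_w (\1_setT w * cost T expG expG tau' w) = \int[P y]_w cost T expG expG tau' w); last first.
  by apply: eq_Rintegral => w _; rewrite indicT mul1r.
move=> <-; have [mv _ _] : everywhere_integrable X P (iter m.+1 (bellman expG (mesh T m)) expG).
  apply: (dominated_everywhere_integrable ler01); exact: (dominated_continuous cv v1).
exact/esym/integral_at_start.
Qed.

(** * Truncated rewards *)

Section truncation.

Notation T := (transition_semigroup X P).

(** The rewards [psi j] approximate [e^G] from below, locally with equality.
[m j] is the number of grid steps per unit of time; during one step the
semigroup increases [psi j] by a factor at most [1 + 1 / j.+1]. *)
Definition truncation (psi : nat -> E -> R) (m : nat -> nat) :=
  [/\ forall j, continuous (psi j),
      forall j y, 1 <= psi j y <= expR (G y),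
      forall y : E, exists n, nbhs y [set z | forall j, (n <= j)%N -> psi j z = expR (G z)],
      forall j, (j < m j)%N &
      forall j (r : R) y, 0 <= r -> r <= (m j)%:R^-1 ->
        T r (psi j) y <= (1 + j.+1%:R^-1) * psi j y].

(** Take [psi j = 1 + chi j] with [chi j = min (e^G - 1, j * rho j)], which has
compact support.  Around [y], where [rho n] stays above a constant [e > 0] for
some [n], the second term [j * rho j >= j * e] exceeds [e^G] for [j] large.  A
bound [T r chi <= chi + 1 / j.+1] gives the factor because [psi j >= 1]. *)
Lemma truncation_exists : locally_compact [set: E] -> separable E -> C0_feller X P ->
  exists psi m, truncation psi m.
Proof.
move=> lc sep X_feller; have [rho rhoP] := cutoff_sequence_exists lc sep.
have [crho rho0 rhoS rhoK rho_pos] := rhoP.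
have cexp := expG_continuous.
pose chi j y := Num.min (expR (G y) - 1) (j%:R * rho j y).
have expG1 y : 1 <= expR (G y) by rewrite -expR0 ler_expR.
have chi0 j y : 0 <= chi j y by rewrite /chi le_min subr_ge0 expG1 mulr_ge0.
have chiG j y : chi j y <= expR (G y) - 1 by rewrite /chi ge_min lexx.
have cchi j : continuous (chi j).
  move=> y; apply: (@continuous_min _ _ (fun y => expR (G y) - 1) (fun y => j%:R * rho j y)).
    by apply: cvgB; [exact: cexp|exact: cvg_cst].
  by apply: cvgM; [exact: cvg_cst|exact: crho].
have Cchi j : C0 (chi j).
  split=> //; have [K cK Kz] := rhoK j; apply: (vanishing_of_compact_support cK) => y /Kz e.
  by rewrite /chi e mulr0 min_r// subr_ge0.
pose psi j y := 1 + chi j y.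
have psi1 j y : 1 <= psi j y <= expR (G y).
  by rewrite /psi lerDl chi0/= addrC -lerBrDr.
have cpsi j : continuous (psi j) by move=> y; apply: cvgD; [exact: cvg_cst|exact: cchi].
have dpsi j : dominated 1 (psi j) := dominated_continuous (cpsi j) (psi1 j).
have small j : exists k, (j < k)%N /\ forall r y, 0 <= r -> r <= k%:R^-1 ->
    T r (psi j) y <= (1 + j.+1%:R^-1) * psi j y.
  have e0 : 0 < (j.+1%:R^-1 : R) by rewrite invr_gt0.
  have [h h0 hT] := transition_uniform_upper X_markov X_feller rhoP (Cchi j) e0.
  exists (maxn j.+1 (Num.truncn h^-1).+1); split; first by rewrite leq_max ltnSn.
  move=> r y r0 rk; apply: (@le_trans _ _ (psi j y + j.+1%:R^-1)); last first.
    rewrite mulrDl mul1r lerD2l ler_peMr ?invr_ge0//.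
    by have /andP[] := psi1 j y.
  have rh : r <= h.
    apply: (le_trans rk); rewrite -[leRHS]invrK lef_pV2 ?posrE ?invr_gt0//.
      apply: (@le_trans _ _ ((Num.truncn h^-1).+1)%:R); first exact/ltW/truncnS_gt.
      by rewrite ler_nat leq_maxr.
  have := hT r y r0 rh; suff -> : T r (psi j) y = 1 + T r (chi j) y by rewrite /psi -addrA lerD2l.
  rewrite /transition_semigroup /psi RintegralD//.
  - by congr (_ + _); rewrite -[RHS](transition_cst X P r 1 y).
  - by apply: finite_measure_integrable_cst.
  - exact: (C0_integrable X_markov).
have [m mP] := choice small.
exists psi, m; split => //; last 2 first.
- by move=> j; have [] := mP j.
- by move=> j; have [] := mP j.
move=> y; have [n ny] := rho_pos y.
have rho_le z : nondecreasing_seq (rho ^~ z) by apply/nondecreasing_seqP.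
pose e := rho n y / 2; have e0 : 0 < e by rewrite divr_gt0.
(* Beyond N, the factor j alone makes j * rho j exceed e^G around y. *)
pose N := maxn n (Num.truncn (expR (G y) / e)).+1.
have NG : expR (G y) < N%:R * e.
  rewrite -ltr_pdivrMr//; apply: (@lt_le_trans _ _ ((Num.truncn (expR (G y) / e)).+1)%:R).
    exact: truncnS_gt.
  by rewrite ler_nat leq_maxr.
exists N; have n1 : \forall z \near y, e < rho n z.
  by apply: (cvgr_gt (rho n y)); [exact: crho|rewrite /e; lra].
have n2 : \forall z \near y, expR (G z) < N%:R * e.
  by apply: (cvgr_lt (expR (G y))); first exact: cexp.
apply: filterS2 n1 n2 => z /= z1 z2 j Nj.
rewrite /psi /chi min_l; first by rewrite addrC subrK.
apply: (@le_trans _ _ (N%:R * e)); first by rewrite lerBlDr (le_trans (ltW z2))// lerDl.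
apply: ler_pM => //; first exact: ltW.
- by rewrite ler_nat.
- by rewrite (le_trans (ltW z1))// rho_le// (leq_trans (leq_maxl _ _) Nj).
Qed.

End truncation.

(** * The lower value *)

Context (psi : nat -> E -> R) (m : nat -> nat).
Hypothesis psiP : truncation psi m.

Let step j : R := (m j)%:R^-1.
Let cpsi j : continuous (psi j). Proof. by have [] := psiP. Qed.
Let psi1 j y : 1 <= psi j y <= expR (G y). Proof. by have [] := psiP. Qed.
Let m_gt0 j : (0 < m j)%N. Proof. by have [_ _ _ jm _] := psiP; exact: leq_ltn_trans (jm j). Qed.
Let step_gt0 j : 0 < step j. Proof. by rewrite invr_gt0 ltr0n. Qed.
Let M_ge0 : 0 <= M.
Proof. by have /andP[h1 h2] := g_bounds point; rewrite (le_trans c_ge0)// (le_trans h1). Qed.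
Let c1 : continuous (cst 1 : E -> R). Proof. by move=> y; exact: cvg_cst. Qed.
Let one1 (y : E) : 1 <= (cst 1 : E -> R) y <= expR (G y).
Proof. by rewrite lexx/= -expR0 ler_expR. Qed.
Let d1 : dominated 1 (cst 1). Proof. exact: dominated_continuous c1 one1. Qed.

(** The value after [k] steps of the grid with the reward [psi j] and the terminal
reward 1 of the lower problem. *)
Definition truncated_value j k : E -> R := iter k (bellman (psi j) (step j)) (cst 1).
Local Notation v := truncated_value.

Lemma truncated_value_continuous j k : continuous (v j k).
Proof.
by have [] := iter_bellman_continuous k
  (ltW (step_gt0 j)) (@cpsi j) c1 (psi1 j) one1.
Qed.

Lemma truncated_value_bounds j k y : 1 <= v j k y <= expR (G y).
Proof.
have [_ b] := iter_bellman_continuous k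
  (ltW (step_gt0 j)) (@cpsi j) c1 (psi1 j) one1.
exact: b.
Qed.

Lemma dominated_truncated_value j k : dominated 1 (v j k).
Proof. exact: (dominated_continuous (@truncated_value_continuous j k) (truncated_value_bounds j k)). Qed.

Let Dv j k : everywhere_integrable X P (v j k).
Proof. exact: (dominated_everywhere_integrable ler01 (dominated_truncated_value j k)). Qed.

Lemma truncated_value_le_psi j k y : v j k y <= psi j y.
Proof.
case: k => [|k] /=; first by have /andP[] := psi1 j y.
by rewrite /bellman ge_min lexx.
Qed.

Lemma truncated_value_nondecreasing j k k' y : (k <= k')%N -> v j k y <= v j k' y.
Proof.
move=> /subnK <-; elim: (k' - k)%N => [|i IH] //; rewrite addSn (le_trans IH)//.
elim: (i + k)%N y {IH} => [|n IH] y.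
  by have /andP[] := truncated_value_bounds j 1 y.
rewrite /= /bellman le_min ge_min lexx/= ge_min.
rewrite (growth_le X_markov g_cont c_ge0 g_bounds y (ltW (step_gt0 j)) (Dv j n) (Dv j n.+1))// ?orbT//.
Qed.

(** What growing for at most one grid step may add to a function below [psi j]: the
potential over a time at most [1 / j.+1], and the increase of [psi j]. *)
Definition truncation_error j : R := expR (M / j.+1%:R) * (1 + j.+1%:R^-1).
Local Notation kappa := truncation_error.

Lemma truncation_error_ge1 j : 1 <= kappa j.
Proof.
rewrite /truncation_error -[leLHS]mulr1 ler_pM// ?lerDl//.
by rewrite -expR0 ler_expR divr_ge0.
Qed.

Lemma cvg_truncation_error : kappa j @[j --> \oo] --> (1 : R).
Proof.
have c0 : (j.+1%:R^-1 : R) @[j --> \oo] --> (0 : R).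
  exact: cvg_harmonic.
have -> : (1 : R) = expR (M * 0) * (1 + 0) by rewrite mulr0 expR0 addr0 mulr1.
apply: cvgM; last by apply: cvgD => //; exact: cvg_cst.
apply: continuous_cvg; first exact: continuous_expR.
by apply: cvgMr.
Qed.

Lemma growth_truncated_value_le j k r y : 0 <= r -> r <= step j ->
  0 <= Q r (v j k) y <= kappa j * expR (G y).
Proof.
move=> r0 rh; have [_ _ _ jm Tpsi] := psiP.
have Dpsi : everywhere_integrable X P (psi j).
  apply: (dominated_everywhere_integrable ler01); exact: (dominated_continuous (@cpsi j) (psi1 j)).
apply/andP; split; first by have [_ q0 _] := growth_everywhere_integrable X_markov g_cont c_ge0 g_bounds r0 (Dv j k).
apply: (le_trans (growth_le X_markov g_cont c_ge0 g_bounds y r0 (Dv j k) Dpsi _)).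
  by move=> z; exact: truncated_value_le_psi.
have /andP[_ q] := growth_bounds X_markov g_cont c_ge0 g_bounds y r0 Dpsi.
apply: (le_trans q); rewrite /truncation_error -mulrA; apply: ler_pM.
- exact: expR_ge0.
- exact: (transition_ge0 _ _ Dpsi).
- rewrite ler_expR ler_wpM2l// (le_trans rh)//.
  by rewrite lef_pV2 ?posrE ?ltr0n// ler_nat; exact: jm.
apply: (le_trans (Tpsi j r y r0 rh)); rewrite ler_wpM2l//.
by have /andP[] := psi1 j y.
Qed.

(** To bound the cost of stopping times that are not on the grid of [psi j], the
grid is refined [n.+1] times; between two nodes of the coarse grid the value only
grows. *)
Definition interpolated_value j n i : E -> R :=
  Q (mesh (step j) n * (i %% n.+1)%:R) (v j (i %/ n.+1)).

Lemma interpolated_time_le j n i : 0 <= mesh (step j) n * (i %% n.+1)%:R <= step j.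
Proof.
have mg := mesh_gt0 (step_gt0 j) n.
rewrite mulr_ge0 ?(ltW mg)//=.
rewrite -[leRHS](@mesh_horizon (step j) (step j) 1 (esym (mul1r _)) n).
by rewrite mul1n ler_pM2l// ler_nat ltnW// ltn_pmod.
Qed.

(** Inside a coarse step this is the semigroup property; at the end of a coarse
step the left-hand side is moreover cut by [psi j]. *)
Lemma interpolated_step j n i y :
  interpolated_value j n i.+1 y <= Q (mesh (step j) n) (interpolated_value j n i) y.
Proof.
have mg := ltW (mesh_gt0 (step_gt0 j) n).
have /andP[t0 th] := interpolated_time_le j n i.
rewrite -(growth_semigroup X_markov g_cont c_ge0 g_bounds y mg t0 (Dv j (i %/ n.+1))).
have -> : mesh (step j) n + mesh (step j) n * (i %% n.+1)%:R = mesh (step j) n * (i %% n.+1).+1%:R.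
  by rewrite -natr1 mulrDr mulr1 addrC.
rewrite /interpolated_value.
have := ltn_pmod i (ltn0Sn n); rewrite ltnS leq_eqVlt => /predU1P[e|lt].
  have iE : i.+1 = ((i %/ n.+1).+1 * n.+1)%N.
    by rewrite {1}(divn_eq i n.+1) e mulSn addnC addSn.
  rewrite iE modnMl mulnK// mulr0 e.
  have hE : mesh (step j) n * n.+1%:R = step j.
    by rewrite -[RHS](@mesh_horizon (step j) (step j) 1 (esym (mul1r _)) n) mul1n.
  rewrite hE (growth0 _ X_markov); last by have [] := dominated_truncated_value j (i %/ n.+1).+1.
  by rewrite /= /bellman ge_min lexx orbT.
have iE : i.+1 = (i %/ n.+1 * n.+1 + (i %% n.+1).+1)%N by rewrite addnS -divn_eq.
have -> : (i.+1 %% n.+1 = (i %% n.+1).+1)%N by rewrite {1}iE modnMDl modn_small.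
by rewrite {1}iE divnMDl// (@divn_small (i %% n.+1).+1 n.+1 lt) addn0 lexx.
Qed.

(** The interpolated values are below [kappa j * e^G] at all times, hence
[verification_limit] applies with this reward. *)
Lemma truncated_value_le_cost j (T : nat) tau x : (0 < T)%N -> finite_stopping_time F tau ->
  (forall w, tau w <= T%:R) ->
  v j (T * m j) x <= kappa j * \int[P x]_w cost T%:R expG (cst 1) tau w.
Proof.
move=> T0 st tT; have [tau0 _] := st.
have k1 := truncation_error_ge1 j; have k0 := le_trans ler01 k1.
have cB : continuous (fun y => kappa j * expR (G y)).
  by move=> y; apply: cvgMr; exact: expG_continuous.
have BC y : 0 <= kappa j * expR (G y) <= kappa j * expR (G y).
  by rewrite lexx andbT mulr_ge0 ?expR_ge0.
have dk1 : dominated (kappa j) (cst 1).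
  split; first exact: measurable_cst.
  move=> y; rewrite ler01/= -[leLHS]mulr1 ler_pM//.
  by have /andP[] := one1 y.
have tb w : 0 <= tau w <= T%:R by rewrite tau0 tT.
have mtau := measurable_stopping X_markov st.
have iJ := integrable_cost ler01 (ler0n R T)
  expG_continuous expG_dominated d1 tb mtau x.
apply: (@le_trans _ _ (\int[P x]_w cost T%:R (fun y => kappa j * expR (G y)) (cst 1) tau w)); last first.
  rewrite -RintegralZl//; apply: le_Rintegral => //.
  - exact: (integrable_cost k0 (ler0n R T) cB BC dk1 tb mtau x).
  - exact: integrable_scale.
  - move=> w _; rewrite /cost /stopped_value mulrCA ler_wpM2l ?expR_ge0//.
    by case: ifP => // _; rewrite mulr1.
have v0 n : interpolated_value j n 0 = cst 1.
  by apply/funext => y; rewrite /interpolated_value mod0n div0n mulr0 (growth0 _ X_markov).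
apply: (@verification_limit (step j) T%:R
    (T * m j) (fun y => kappa j * expR (G y)) (cst 1) (kappa j) tau (step_gt0 j) _ k0 cB BC dk1
    st tT (interpolated_value j)) => //.
- by rewrite natrM mulfK// pnatr_eq0 -lt0n.
- move=> n i; have /andP[t0 th] := interpolated_time_le j n i; split.
    exact: (measurable_growth X_markov g_cont c_ge0 g_bounds t0 (Dv _ _)).
  by move=> y; exact: growth_truncated_value_le.
- move=> n i y; have /andP[t0 th] := interpolated_time_le j n i.
  by have /andP[_] := @growth_truncated_value_le j (i %/ n.+1)%N _ y t0 th.
- by move=> n i y; exact: interpolated_step.
- move=> n; rewrite /interpolated_value modnMl mulr0 mulnK// (growth0 _ X_markov)//.
  by have [] := dominated_truncated_value j (T * m j)%N.
Qed.

(** Up to time [T], a given path stays in a region where [psi j] and [e^G] coincide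
for [j] large. *)
Lemma cvg_truncated_cost (T : R) (A : set Omega) (sigma : nat -> Omega -> R)
    (f_ : nat -> E -> R) (f : E -> R) x : 0 <= T -> measurable A ->
  (forall j, measurable_fun setT (sigma j)) -> (forall j w, 0 <= sigma j w <= T) ->
  (forall j, dominated 1 (f_ j)) -> dominated 1 f -> (forall y, f_ j y @[j --> \oo] --> f y) ->
  \int[P x]_w (\1_A w * cost T (psi j) (f_ j) (sigma j) w) -
  \int[P x]_w (\1_A w * cost T expG f (sigma j) w) @[j --> \oo] --> (0 : R).
Proof.
move=> T0 mA msigma bsigma df_ df f_f.
have [_ _ psiloc _ _] := psiP.
have psiG j y : 0 <= psi j y <= 1 * expR (G y).
  by rewrite mul1r; have /andP[p1 ->] := psi1 j y; rewrite (le_trans ler01).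
have i1 j := integrable_cost_indic ler01 T0 (@cpsi j) (psiG j) (df_ j) (bsigma j) (msigma j) x mA.
have i2 j := integrable_cost_indic ler01 T0 expG_continuous expG_dominated df (bsigma j) (msigma j) x mA.
rewrite (_ : (fun j => _) = fun j =>
    \int[P x]_w (\1_A w * cost T (psi j) (f_ j) (sigma j) w - \1_A w * cost T expG f (sigma j) w)); last first.
  by apply/funext => j; rewrite RintegralB.
have <- : \int[P x]_w (0 : R) = 0 by rewrite /Rintegral integral0.
have [D [mD hD iD]] := dominator_exists X_markov G_cont G_sup T0.
apply: (@cvg_Rintegral _ _ _ (P x) _ _ (fun w => 1 * expR (M * T) * D w)).
- move=> j; apply: measurable_funB.
    exact/measurable_EFinP/(measurable_int _ (i1 j)).
  exact/measurable_EFinP/(measurable_int _ (i2 j)).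
- move=> w.
  have [||n hn] := path_increasing_cover X_markov
    (U := fun n => [set z | forall j, (n <= j)%N -> psi j z = expR (G z)]) w T.
  + by move=> n z /= hz j nj; apply: hz; exact: ltnW.
  + exact: psiloc.
  apply/cvgr0Pnorm_le => e e0.
  have eM : 0 < e / expR (M * T) by rewrite divr_gt0 ?expR_gt0.
  have near_f : \forall j \near \oo, `|f_ j (X T w) - f (X T w)| <= e / expR (M * T).
    by have /cvgr_distC_le := f_f (X T w); exact.
  near=> j; rewrite -mulrBr normrM.
  have b1 : `|\1_A w : R| <= 1 by rewrite indicE; case: (_ \in _); rewrite ?normr1 ?normr0.
  apply: (@le_trans _ _ (1 * `|cost T (psi j) (f_ j) (sigma j) w - cost T expG f (sigma j) w|)).
    by rewrite ler_wpM2r.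
  rewrite mul1r /cost -mulrBr normrM (ger0_norm (expR_ge0 _)).
  have /andP[s0 sT] := bsigma j w.
  have r1 : expR (run (sigma j w) w) <= expR (M * T).
    rewrite ler_expR; have /andP[_ q] := running_bounds X_markov g_cont c_ge0 g_bounds w s0.
    by rewrite (le_trans q)// ler_wpM2l.
  apply: (@le_trans _ _ (expR (M * T) * (e / expR (M * T)))).
    apply: ler_pM => //.
    rewrite /stopped_value; case: ifP => _; last by near: j.
    rewrite hn ?s0//; first by rewrite subrr normr0 ltW.
    by near: j; exact: nbhs_infty_ge.
  by rewrite mulrC divfK// gt_eqF// expR_gt0.
- move=> j w.
  have /andP[p1 p2] := cost_bounds ler01 T0 (psiG j) (df_ j) (bsigma j) w hD.
  have /andP[q1 q2] := cost_bounds ler01 T0 expG_dominated df (bsigma j) w hD.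
  rewrite -mulrBr indicE; case: (_ \in _); last by rewrite mul0r normr0 (le_trans p1).
  by rewrite mulr1n [1 * (_ - _)]mul1r ler_norml; apply/andP; split; lra.
- exact/integrable_scale/iD.
Unshelve. all: by end_near. Qed.

Lemma truncated_value_attained j T k t (A : set Omega) : 0 <= t -> F t A ->
  exists sigma : Omega -> R, [/\ finite_stopping_time F sigma,
    forall w, t <= sigma w <= t + T%:R &
    forall x, \int[P x]_w (\1_A w * (expR (run t w) * v j (T * m j + k) (X t w))) =
              \int[P x]_w (\1_A w * cost (t + T%:R) (psi j) (v j k) sigma w)].
Proof.
move=> t0 FA.
have psi0 y : 0 <= psi j y <= expR (G y).
  by have /andP[p1 ->] := psi1 j y; rewrite (le_trans ler01).
have := bellman_attained (T * m j) (step_gt0 j)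
  (@cpsi j) psi0 (dominated_truncated_value j k) t0 FA.
have -> : (T * m j)%:R * step j = T%:R :> R by rewrite natrM mulfK// pnatr_eq0 -lt0n.
by rewrite /truncated_value iterD.
Qed.

(** [v j] is attained by a stopping time for the reward [psi j], thus nearly for
[e^G], and [truncated_value_le_cost] at the fixed index [i] bounds its cost from
below. *)
Lemma truncated_value_asymptotic_le i T x e : (0 < T)%N -> 0 < e ->
  \forall j \near \oo, v i (T * m i) x / kappa i <= v j (T * m j) x + e.
Proof.
move=> T0 e0.
have [sigma sigmaP] := choice (fun j => @truncated_value_attained j T 0%N 0 setT (lexx 0) (F_setT X_markov (lexx 0))).
have sb j w : 0 <= sigma j w <= T%:R.
  by have [_ b _] := sigmaP j; have := b w; rewrite add0r.
have ms j : measurable_fun setT (sigma j).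
  by have [st _ _] := sigmaP j; exact: (measurable_stopping X_markov).
have cc (y : E) : (cst 1 y : R) @[j --> \oo] --> (cst 1 y : R) by exact: cvg_cst.
have := @cvg_truncated_cost T%:R setT sigma (fun j => cst 1) (cst 1) x (ler0n R T) measurableT ms sb
  (fun j => d1) d1 cc.
move=> /cvgr0Pnorm_lt/(_ e e0); apply: filterS => j.
have [st _ /(_ x)] := sigmaP j.
rewrite add0r addn0 integral_at_start; last by have [] := dominated_truncated_value j (T * m j)%N.
move=> <-.
rewrite [X in _ - X](_ : _ = \int[P x]_w cost T%:R expG (cst 1) (sigma j) w); last first.
  by apply: eq_Rintegral => w _; rewrite indicT mul1r.
rewrite ltr_norml => /andP[lt _].
have sT w : sigma j w <= T%:R by have /andP[] := sb j w.
have k0 : 0 < kappa i by rewrite (lt_le_trans ltr01)// truncation_error_ge1.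
have := truncated_value_le_cost i x T0 st sT.
rewrite mulrC -ler_pdivrMr// => /le_trans; apply.
lra.
Qed.

(** These continuous functions minorize the exponentials of the lower values, for
which the horizon [j.+1] is available. *)
Definition value_approximation j y : R := v j (j.+1 * m j) y / kappa j.

Definition limit_value y : R := sup (range (fun j => value_approximation j y)).
Local Notation V := limit_value.

Let kappa_gt0 j : 0 < kappa j.
Proof. by rewrite (lt_le_trans ltr01)// truncation_error_ge1. Qed.

Lemma value_approximation_gt0 j y : 0 < value_approximation j y.
Proof.
rewrite divr_gt0//; have /andP[v1 _] := truncated_value_bounds j (j.+1 * m j) y.
exact: lt_le_trans ltr01 v1.
Qed.

Let vbar_le j y : value_approximation j y <= expR (G y).
Proof.
have /andP[v1 vG] := truncated_value_bounds j (j.+1 * m j) y.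
rewrite /value_approximation ler_pdivrMr// (le_trans vG)// ler_peMr ?expR_ge0//.
exact: truncation_error_ge1.
Qed.

Lemma value_approximation_le_limit j y : value_approximation j y <= V y.
Proof.
apply: ub_le_sup; last by exists j.
by exists (expR (G y)) => _ [i _ <-]; exact: vbar_le.
Qed.

Lemma limit_value_le_expG y : V y <= expR (G y).
Proof.
apply: ge_sup; first by exists (value_approximation 0 y), 0%N.
by move=> _ [i _ <-]; exact: vbar_le.
Qed.

Let V_gt0 y : 0 < V y.
Proof. exact: lt_le_trans (value_approximation_gt0 0 y) (value_approximation_le_limit 0 y). Qed.

(** From below, [V y] is nearly reached by some [value_approximation i y], to which
[truncated_value_asymptotic_le] applies; from above, [v j <= kappa j * V] with
[kappa j] tending to 1.  The cases [T j = j.+1] and [T j = j] are used for the time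
left at the beginning and at the end of a stage. *)
Lemma cvg_truncated_value (T : nat -> nat) y : (forall j, j <= T j <= j.+1)%N ->
  v j (T j * m j) y @[j --> \oo] --> V y.
Proof.
move=> Tj; apply/cvgrPdist_le => e e0.
have e20 : 0 < e / 2 by rewrite divr_gt0.
have [_ [i _ <-]] : exists2 r, range (fun j => value_approximation j y) r & V y - e / 2 < r.
  apply: sup_adherent => //; split; first by exists (value_approximation 0 y), 0%N.
  by exists (expR (G y)) => _ [i _ <-]; exact: vbar_le.
move=> iV.
have n1 := truncated_value_asymptotic_le i y (ltn0Sn i) e20.
have n2 : \forall j \near \oo, kappa j * V y <= V y + e.
  have : kappa j * V y @[j --> \oo] --> 1 * V y by apply: cvgMl; exact: cvg_truncation_error.
  by rewrite mul1r => /cvgr_le; apply; rewrite ltrDl.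
near=> j; rewrite ler_distlC; apply/andP; split.
  have : V y - e / 2 <= v j (i.+1 * m j) y + e / 2.
    by apply: le_trans (ltW iV) _; rewrite -/(value_approximation i y); near: j.
  have ij : (i.+1 <= j)%N by near: j; exact: nbhs_infty_ge.
  have : v j (i.+1 * m j) y <= v j (T j * m j) y.
    apply: truncated_value_nondecreasing; rewrite leq_mul2r; apply/orP; right.
    by have /andP[jT _] := Tj j; exact: leq_trans ij jT.
  lra.
apply: (@le_trans _ _ (kappa j * V y)); last by near: j.
apply: (@le_trans _ _ (v j (j.+1 * m j) y)).
  apply: truncated_value_nondecreasing; rewrite leq_mul2r; apply/orP; right.
  by have /andP[] := Tj j.
by rewrite mulrC -ler_pdivrMr//; exact: value_approximation_le_limit.
Unshelve. all: by end_near. Qed.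

Lemma limit_value_ge1 y : 1 <= V y.
Proof.
have cv := @cvg_truncated_value id y (fun j => introT andP (conj (leqnn j) (leqnSn j))).
rewrite -(cvg_lim (@Rhausdorff R) cv); apply: limr_ge; first by apply/cvg_ex; exists (V y).
by apply: nearW => j; have /andP[] := truncated_value_bounds j (id j * m j)%N y.
Qed.

Lemma dominated_limit_value : dominated 1 V.
Proof.
split.
  apply: (@measurable_fun_cvg _ (borel E) R setT (fun j => v j (id j * m j))).
    by move=> j; have [] := dominated_truncated_value j (id j * m j)%N.
  by move=> y _; apply: cvg_truncated_value => j; rewrite leqnn leqnSn.
by move=> y; rewrite ltW//= mul1r limit_value_le_expG.
Qed.

Lemma value_approximation_continuous j : continuous (value_approximation j).
Proof. by move=> y; apply: cvgMl; exact: truncated_value_continuous. Qed.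

Lemma cost_at_horizon t (phi f : E -> R) w : cost t phi f (fun=> t) w = expR (run t w) * f (X t w).
Proof. by rewrite /cost /stopped_value ltxx. Qed.

Section stages.
Context (x : E) (eps : R).
Hypothesis eps_gt0 : 0 < eps.

(** At stage [n] the decisions up to time [n] have been taken, and [V] stands for
the optimal cost of what remains. *)
Definition near_optimal n (tau : Omega -> R) :=
  [/\ finite_stopping_time F tau, forall w, tau w <= n%:R &
   \int[P x]_w cost n%:R expG V tau w <= V x + eps * (1 - (2 ^+ n)^-1)].

Lemma near_optimal0 : near_optimal 0 (fun=> 0).
Proof.
split=> //; first exact: (finite_stopping_cst X_markov).
rewrite expr0 invr1 subrr mulr0 addr0.
have [mV _] := dominated_limit_value.
rewrite -[leRHS](integral_at_start x mV) le_eqVlt; apply/orP; left; apply/eqP.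
by apply: eq_Rintegral => w _; rewrite cost_at_horizon indicT mul1r.
Qed.

(** On the event that nothing has been decided before time [n], follow during one
unit of time a stopping time attaining the truncated value of index [j].  As
[j] tends to infinity, its initial and terminal values tend to [V] and the reward
[psi j] to [e^G], so that the loss is less than any given [e]. *)
Lemma near_optimal_extend n tau : near_optimal n tau -> exists tau', near_optimal n.+1 tau' /\
  forall w, tau w <= tau' w /\ (tau w < n%:R -> tau' w = tau w).
Proof.
move=> [st tn tauV]; have [tau0 _] := st; have dV := dominated_limit_value.
have n0 := ler0n R n; have n10 := ler0n R n.+1.
pose A := [set w | n%:R <= tau w].
have FA : F n%:R A by exact: (stopping_ge X_markov st n0).
have mA : measurable A by exact: (filtration_measurable (smp_filtration X_markov) n0).
have nS : n%:R + 1%:R = n.+1%:R :> R by rewrite -natrD addn1.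
have [sigma sigmaP] := choice (fun j => @truncated_value_attained j 1%N (j * m j)%N _ A n0 FA).
rewrite nS in sigmaP.
have sn j w : n%:R <= sigma j w <= n.+1%:R by have [_ + _] := sigmaP j; exact.
have ssigma j : finite_stopping_time F (sigma j) by have [] := sigmaP j.
have sb j w : 0 <= sigma j w <= n.+1%:R.
  by have /andP[s1 ->] := sn j w; rewrite (le_trans _ s1).
have l1 := @cvg_truncated_cost n%:R A (fun=> fun=> n%:R) (fun j => v j (j.+1 * m j)) V x n0 mA
  (fun _ => @measurable_cst _ _ _ _ _ _) (fun _ _ => introT andP (conj n0 (lexx _)))
  (fun j => dominated_truncated_value j (j.+1 * m j)) dV
  (fun y => @cvg_truncated_value succn y (fun j => introT andP (conj (leqnSn j) (leqnn _)))).
have l2 := @cvg_truncated_cost n.+1%:R A sigma (fun j => v j (j * m j)) V x n10 mA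
  (fun j => measurable_stopping X_markov (ssigma j)) sb
  (fun j => dominated_truncated_value j (j * m j)) dV
  (fun y => @cvg_truncated_value id y (fun j => introT andP (conj (leqnn j) (leqnSn j)))).
(* The losses of all the stages add up to eps. *)
pose e := eps * (2 ^+ n.+1)^-1; have e0 : 0 < e by rewrite mulr_gt0// invr_gt0 exprn_gt0.
have [j jA] : exists j, \int[P x]_w (\1_A w * cost n.+1%:R expG V (sigma j) w) <=
    \int[P x]_w (\1_A w * cost n%:R expG V (fun=> n%:R) w) + e.
  have e20 : 0 < e / 2 by rewrite divr_gt0.
  have /cvgr0Pnorm_lt/(_ _ e20) h1 := l1.
  have /cvgr0Pnorm_lt/(_ _ e20) h2 := l2.
  have [j [jj1 jj2]] := filter_ex (filterI h1 h2); move: jj1 jj2 => /=.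
  rewrite !ltr_norml => /andP[_ a1] /andP[a2 _]; exists j.
  have [_ _ /(_ x)] := sigmaP j; rewrite mul1n -mulSn.
  under eq_Rintegral do rewrite -(cost_at_horizon _ (psi j)).
  move: a1 a2; lra.
pose tau' w := if w \in A then sigma j w else tau w.
have st' : finite_stopping_time F tau'.
  apply: (finite_stopping_piece X_markov n0 FA st (ssigma j)) => // w _.
  by have /andP[] := sn j w.
have tn' w : tau' w <= n.+1%:R.
  rewrite /tau'; case: ifP => _; first by have /andP[] := sb j w.
  by rewrite (le_trans (tn w))// ler_nat.
exists tau'; split; last first.
  move=> w; rewrite /tau'; case: (boolP (w \in A)) => [|_]; last by rewrite lexx.
  rewrite inE /A/= => nt; split; last by rewrite ltNge nt.
  by have /andP[s1 _] := sn j w; rewrite (le_trans (tn w)).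
split=> //.
have tb w : 0 <= tau w <= n%:R by rewrite tau0 tn.
have tb' w : 0 <= tau' w <= n.+1%:R by have [t0 _] := st'; rewrite t0 tn'.
have iJ' := integrable_cost ler01 n10 expG_continuous expG_dominated dV tb' (measurable_stopping X_markov st') x.
have iJ := integrable_cost ler01 n0 expG_continuous expG_dominated dV tb (measurable_stopping X_markov st) x.
rewrite (Rintegral_setC_split mA iJ'); rewrite (Rintegral_setC_split mA iJ) in tauV.
have E1 : \int[P x]_w (\1_A w * cost n.+1%:R expG V tau' w) = \int[P x]_w (\1_A w * cost n.+1%:R expG V (sigma j) w).
  by apply: eq_Rintegral_indic => w Aw; rewrite /cost /stopped_value /tau' mem_set.
have E2 : \int[P x]_w (\1_A w * cost n%:R expG V tau w) = \int[P x]_w (\1_A w * cost n%:R expG V (fun=> n%:R) w).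
  apply: eq_Rintegral_indic => w Aw; have e1 : tau w = n%:R by apply/eqP; rewrite eq_le tn.
  by rewrite /cost /stopped_value e1.
have E3 : \int[P x]_w (\1_(~` A) w * cost n.+1%:R expG V tau' w) = \int[P x]_w (\1_(~` A) w * cost n%:R expG V tau w).
  apply: eq_Rintegral_indic => w nA; rewrite /cost /stopped_value /tau' memNset//.
  have tn1 : tau w < n%:R by rewrite ltNge; apply/negP.
  by rewrite tn1 (lt_trans tn1)// ltr_nat.
rewrite E1 E3; rewrite E2 in tauV.
have -> : eps * (1 - (2 ^+ n.+1)^-1) = eps * (1 - (2 ^+ n)^-1) + e.
  have -> : (2 ^+ n)^-1 = 2 * (2 ^+ n.+1)^-1 :> R by rewrite exprS invfM mulrA mulfV ?mul1r.
  by rewrite /e; ring.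
rewrite addrA -lerBlDr; apply: le_trans tauV.
by rewrite addrAC lerD2r lerBlDr.
Qed.

Lemma near_optimal_sequence : exists tau : nat -> Omega -> R,
  (forall n, near_optimal n (tau n)) /\
  forall n w, tau n w <= tau n.+1 w /\ (tau n w < n%:R -> tau n.+1 w = tau n w).
Proof.
have /choice[next nextP] : forall p : nat * (Omega -> R), exists tau', near_optimal p.1 p.2 ->
    near_optimal p.1.+1 tau' /\ forall w, p.2 w <= tau' w /\ (p.2 w < p.1%:R -> tau' w = p.2 w).
  move=> [n tau].
  have [/near_optimal_extend[tau' h']|nt] := pselect (near_optimal n tau); first by exists tau'.
  by exists tau.
pose tau := fix tau n := if n is n'.+1 then next (n', tau n') else fun=> 0.
have tauP n : near_optimal n (tau n).
  by elim: n => [|n IH]; [exact: near_optimal0|have [] := nextP (n, tau n) IH].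
by exists tau; split => // n; have [] := nextP (n, tau n) (tauP n).
Qed.

End stages.

(** The integral of a nonnegative function is the supremum of the integrals of the
simple functions below it. *)
Lemma ge0_integral_mono (mu : {measure set Omega -> \bar R}) (f1 f2 : Omega -> \bar R) :
  (forall w, 0 <= f1 w)%E -> (forall w, f1 w <= f2 w)%E ->
  (\int[mu]_w f1 w <= \int[mu]_w f2 w)%E.
Proof.
move=> f10 f12; have f20 w : (0 <= f2 w)%E := le_trans (f10 w) (f12 w).
rewrite !ge0_integralTE//; apply: ereal_sup_le => _ [k kf1 <-].
by exists k => // w; exact: le_trans (kf1 w) (f12 w).
Qed.

Lemma payoff_ge0 tau w : (0 <= payoff X g G tau w)%E.
Proof. by rewrite /payoff; case: (tau w) => [t||] //; rewrite lee_fin expR_ge0. Qed.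

Lemma payoff_before_ge0 T tau w : (0 <= payoff_before X g G T tau w)%E.
Proof. by rewrite /payoff_before; case: (tau w) => [t||] //; rewrite lee_fin expR_ge0. Qed.

Lemma le_lne_integral (mu : {measure set Omega -> \bar R}) (f1 f2 : Omega -> \bar R) :
  (forall w, 0 <= f1 w)%E -> (forall w, f1 w <= f2 w)%E ->
  (lne (\int[mu]_w f1 w) <= lne (\int[mu]_w f2 w))%E.
Proof.
move=> f10 f12; have f20 w : (0 <= f2 w)%E := le_trans (f10 w) (f12 w).
rewrite lee_lne ?in_itv/= ?leey ?andbT ?integral_ge0//.
exact: ge0_integral_mono.
Qed.

(** Stopping at [S] without terminal reward saves a nonnegative reward and a
nonnegative running cost. *)
Lemma payoff_before_min S T tau w : S <= T -> (0 <= tau w)%E -> 0 <= S ->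
  (payoff_before X g G S (fun w => mine (tau w) S%:E) w <= payoff_before X g G T tau w)%E.
Proof.
move=> ST; rewrite /payoff_before; case: (tau w) => [t| |] // t0 S0; last by rewrite leey.
rewrite lee_fin in t0; rewrite -EFin_min lee_fin ler_expR.
have [tS|St] := ltP t S; first by rewrite tS (lt_le_trans tS ST).
rewrite ltxx lerD//; last by case: ifP.
exact: (running_nondecreasing X_markov g_cont c_ge0 g_bounds).
Qed.

Lemma payoff_before_le T tau w : (payoff_before X g G T tau w <= payoff X g G tau w)%E.
Proof.
rewrite /payoff_before /payoff; case: (tau w) => [t| |] //; rewrite lee_fin ler_expR lerD2l.
by case: ifP.
Qed.

Lemma lower_value_T_le (S T : R) x : 0 <= S -> S <= T ->
  (lower_value_T F X P g G S x <= lower_value_T F X P g G T x)%E.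
Proof.
move=> S0 ST; apply: le_ereal_inf_tmp => _ [tau [st tT] <-]; have [tau0 _] := st.
apply: (@le_trans _ _ (lne (\int[P x]_w payoff_before X g G S (fun w => mine (tau w) S%:E) w)%E)).
  by apply: ereal_inf_lbound; exists (fun w => mine (tau w) S%:E) => //; exact: (stopping_time_min X_markov).
apply: le_lne_integral => w; first exact: payoff_before_ge0.
exact: payoff_before_min.
Qed.

Lemma lower_value_T_le_value_u (T : R) x : 0 <= T ->
  (lower_value_T F X P g G T x <= value_u F X P g G x)%E.
Proof.
move=> T0; apply: le_ereal_inf_tmp => _ [tau st <-]; have [tau0 _] := st.
apply: (@le_trans _ _ (lne (\int[P x]_w payoff_before X g G T (fun w => mine (tau w) T%:E) w)%E)).
  by apply: ereal_inf_lbound; exists (fun w => mine (tau w) T%:E) => //; exact: (stopping_time_min X_markov).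
apply: le_lne_integral => w; first exact: payoff_before_ge0.
by apply: (le_trans (payoff_before_min _ _ _)) (payoff_before_le T _ _).
Qed.

(** The lower value is monotone in the horizon from 0 on; a negative horizon admits
no stopping time, and its value is the infimum of the empty set. *)
Lemma lower_value_T_cvg x : lower_value_T F X P g G T x @[T --> +oo] -->
  ereal_sup (range (fun T => lower_value_T F X P g G (Num.max 0 T) x)).
Proof.
have := @nondecreasing_cvge R (fun T => lower_value_T F X P g G (Num.max 0 T) x).
have nd : {homo (fun T => lower_value_T F X P g G (Num.max 0 T) x) : S T / S <= T >-> (S <= T)%E}.
  move=> S T ST; apply: lower_value_T_le; first by rewrite le_max lexx.
  by rewrite ge_max !le_max lexx/= ST orbT.
move=> /(_ nd); apply: cvg_trans; apply: near_eq_cvg.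
near=> T; rewrite max_r//.
Unshelve. all: by end_near. Qed.

Lemma lower_valueE x : lower_value F X P g G x =
  ereal_sup (range (fun T => lower_value_T F X P g G (Num.max 0 T) x)).
Proof. by apply/cvg_lim => //; exact: lower_value_T_cvg. Qed.

Lemma lower_value_le_value_u x : (lower_value F X P g G x <= value_u F X P g G x)%E.
Proof.
rewrite lower_valueE; apply: ge_ereal_sup => _ [T _ <-].
by apply: lower_value_T_le_value_u; rewrite le_max lexx.
Qed.

Lemma value_approximation_le_lower_value j x :
  ((ln (value_approximation j x))%:E <= lower_value F X P g G x)%E.
Proof.
apply: (@le_trans _ _ (lower_value_T F X P g G j.+1%:R x)); last first.
  rewrite lower_valueE; apply: ereal_sup_ubound; exists j.+1%:R; [by []|].
  by rewrite max_r.
apply: le_ereal_inf_tmp => _ [_ /bounded_stopping_timeP[tau [st tT ->]] <-].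
have le_int : value_approximation j x <= \int[P x]_w cost j.+1%:R expG (cst 1) tau w.
  rewrite /value_approximation ler_pdivrMr// mulrC.
  exact: truncated_value_le_cost.
have v0 := value_approximation_gt0 j x.
rewrite (_ : integral _ _ _ = (\int[P x]_w cost j.+1%:R expG (cst 1) tau w)%:E); last first.
  rewrite -(integral_costE x ler01 (ler0n R j.+1)
    expG_continuous expG_dominated d1 st tT).
  by apply: eq_integral => w _; apply: payoff_beforeE.
by rewrite lne_EFin ?(lt_le_trans v0)// lee_fin ler_ln// posrE (lt_le_trans v0).
Qed.

Hypothesis c_gt0 : 0 < c.

(** The supremum of the times of the stages is [tau n] as soon as [tau n < n], and
infinite if [tau n = n] for all [n].  In the second case the cost at stage [n] is
at least [e^(c n)], so in both cases the costs at the stages converge to the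
payoff, and Fatou's lemma applies. *)
Lemma value_u_le_limit x : (value_u F X P g G x <= (ln (V x))%:E)%E.
Proof.
suff near_le eps : 0 < eps -> (value_u F X P g G x <= lne (V x + eps)%:E)%E.
  apply/lee_addgt0Pr => e e0.
  have := near_le (V x * expR e - V x); rewrite (addrC (V x)) subrK subr_gt0 ltr_pMr// -expR0 ltr_expR.
  by move=> /(_ e0); rewrite lne_EFin ?mulr_gt0 ?expR_gt0// lnM ?posrE ?expR_gt0// expRK EFinD.
move=> eps0; have [tau [tauP tauS]] := near_optimal_sequence x eps0.
have st n : finite_stopping_time F (tau n) by have [] := tauP n.
have tn n w : tau n w <= n%:R by have [_ + _] := tauP n; exact.
have tau0 n w : 0 <= tau n w by have [] := st n.
have tau_nd w : nondecreasing_seq (tau ^~ w).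
  by apply/nondecreasing_seqP => n; have [] := tauS n w.
have tau_stat n k w : (n <= k)%N -> tau n w < n%:R -> tau k w = tau n w.
  move=> /subnK <- tlt; elim: (k - n)%N => // i IH; rewrite addSn -IH.
  have [_ ->//] := tauS (i + n)%N w.
  by rewrite IH (lt_le_trans tlt)// ler_nat leq_addl.
pose tauoo w := ereal_sup (range (fun n => (tau n w)%:E)).
have stoo : stopping_time F tauoo.
  split; first by move=> w; apply: ereal_sup_ge; exists (tau 0 w)%:E; [exists 0%N|rewrite lee_fin].
  move=> t t0; rewrite (_ : [set _ | _] = ~` \bigcup_n ~` [set w | tau n w <= t]).
    apply: (F_setC X_markov) => //; apply: (F_bigcup X_markov) => // n; apply: (F_setC X_markov) => //.
    by have [_ stF] := st n; exact: stF.
  rewrite setC_bigcup; apply/seteqP; split => w /=.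
    move=> h n _; rewrite setCK/= -lee_fin; apply: le_trans h.
    by apply: ereal_sup_ubound; exists n.
  move=> h; apply: ge_ereal_sup => _ [n _ <-]; rewrite lee_fin.
  by have := h n I; rewrite setCK.
apply: (@le_trans _ _ (lne (\int[P x]_w payoff X g G tauoo w)%E)).
  by apply: ereal_inf_lbound; exists tauoo.
have dV := dominated_limit_value; rewrite lee_lne ?in_itv/= ?leey ?andbT ?integral_ge0//; last 2 first.
- by move=> w _; exact: payoff_ge0.
- by rewrite lee_fin addr_ge0 ?ltW.
have cvgJ w : (cost n%:R expG V (tau n) w)%:E @[n --> \oo] --> payoff X g G tauoo w.
  have [[n nlt]|ge_all] := pselect (exists n, tau n w < n%:R).
    have too : tauoo w = (tau n w)%:E.
      apply/eqP; rewrite eq_le; apply/andP; split; last by apply: ereal_sup_ubound; exists n.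
      apply: ge_ereal_sup => _ [k _ <-]; rewrite lee_fin.
      have [kn|nk] := leqP k n; first exact: tau_nd.
      by rewrite (tau_stat n k)// ltnW.
    have -> : payoff X g G tauoo w = (cost n%:R expG V (tau n) w)%:E.
      by rewrite /payoff too /cost /stopped_value nlt expRD.
    apply: cvg_near_cst; near=> k.
    have nk : (n <= k)%N by near: k; exact: nbhs_infty_ge.
    rewrite /cost /stopped_value (tau_stat n k)// nlt (lt_le_trans nlt)//.
    by rewrite ler_nat.
  have tE n : tau n w = n%:R.
    by apply/eqP; rewrite eq_le tn leNgt; apply/negP => h; apply: ge_all; exists n.
  have too : tauoo w = +oo%E.
    apply/eqyP => r _; apply: (@le_trans _ _ (tau (Num.truncn r).+1 w)%:E).
      by rewrite lee_fin tE ltW// truncnS_gt.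
    by apply: ereal_sup_ubound; exists (Num.truncn r).+1.
  rewrite /payoff too; apply/cvgeyPge => r; near=> n.
  rewrite lee_fin /cost /stopped_value tE ltxx.
  apply: (@le_trans _ _ (c * n%:R)).
    rewrite mulrC -ler_pdivrMr//; near: n; exact: nbhs_infty_ger.
  apply: (@le_trans _ _ (expR (c * n%:R))); first by rewrite (le_trans _ (expR_ge1Dx _))// lerDr.
  rewrite -[leLHS]mulr1; apply: ler_pM => //; rewrite ?expR_ge0 ?limit_value_ge1// ler_expR.
  by have /andP[] := running_bounds X_markov g_cont c_ge0 g_bounds w (ler0n R n).
rewrite (eq_integral (fun w => limn_einf (fun n => (cost n%:R expG V (tau n) w)%:E))); last first.
  by move=> w _; have [-> _] := cvg_limn_einf_sup (cvgJ w).
have tb n w : 0 <= tau n w <= n%:R by rewrite tau0 tn.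
have mt n := measurable_stopping X_markov (st n).
apply: (le_trans (fatou _ _ _ _)) => //.
- by move=> n; apply/measurable_EFinP;
   exact: (measurable_cost (ler0n R n) expG_continuous dV (tb n) (mt n)).
- move=> n w _; rewrite lee_fin; apply: cost_ge0; [exact: expG_dominated|exact: dV].
rewrite limn_einf_lim; apply: lime_le; first exact: is_cvg_einfs.
apply: nearW => n; apply: (@le_trans _ _ (\int[P x]_w (cost n%:R expG V (tau n) w)%:E)%E).
  by apply: ereal_inf_lbound; exists n => //=.
rewrite (integral_costE x ler01 (ler0n R n) expG_continuous expG_dominated dV (st n) (tn n)).
rewrite lee_fin; have [_ _ /le_trans] := tauP n; apply.
by rewrite lerD2l ler_piMr ?(ltW eps0)// gerBl invr_ge0 exprn_ge0.
Unshelve. all: by end_near. Qed.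

Lemma limit_value_le_lower_value x : ((ln (V x))%:E <= lower_value F X P g G x)%E.
Proof.
have cln : (ln (value_approximation j x))%:E @[j --> \oo] --> (ln (V x))%:E.
  apply/cvg_EFin; first exact: nearW.
  apply: continuous_cvg; first exact: continuous_ln.
  rewrite -[V x]divr1; apply: cvgM; last by apply: cvgV; [exact: oner_neq0|exact: cvg_truncation_error].
  by apply: (@cvg_truncated_value succn) => j; rewrite leqnSn leqnn.
rewrite -(cvg_lim (@ereal_hausdorff R) cln); apply: lime_le.
  by apply/cvg_ex; exists (ln (V x))%:E.
by apply: nearW => j; exact: value_approximation_le_lower_value.
Qed.

Lemma value_uE x : value_u F X P g G x = (ln (V x))%:E.
Proof.
apply/eqP; rewrite eq_le value_u_le_limit/=.
exact: le_trans (limit_value_le_lower_value x) (lower_value_le_value_u x).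
Qed.

Lemma value_u_lower_value x : value_u F X P g G x = lower_value F X P g G x.
Proof.
apply/eqP; rewrite eq_le lower_value_le_value_u andbT value_uE.
exact: limit_value_le_lower_value.
Qed.

Lemma value_u_lower_semicontinuous : lower_semicontinuous (value_u F X P g G).
Proof.
move=> x a; rewrite value_uE lte_fin -ltr_expR lnK ?posrE// => aV.
have [_ [j _ <-] aj] : exists2 r, range (fun j => value_approximation j x) r & expR a < r.
  by apply: sup_gt => //; exists (value_approximation 0 x), 0%N.
exists [set y | expR a < value_approximation j y].
  have : \forall y \near x, expR a < value_approximation j y.
    by apply: (cvgr_gt (value_approximation j x)) => //; exact: value_approximation_continuous.
  exact.
move=> y /= ay; rewrite value_uE lte_fin -ltr_expR lnK ?posrE//.
exact: lt_le_trans ay (value_approximation_le_limit j y).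
Qed.

End optimal_stopping.

(** * The theorem *)

(* [lim] is total, so the existence of the two limits over [T] is asserted
   along with the identities. *)
Theorem theorem4p2 (R : realType) (d : measure_display)
  (Omega : measurableType d) (E : pmetricType R)
  (F : R -> set_system Omega) (X : R -> Omega -> E)
  (P : E -> probability Omega R) (g G : E -> R) (c : R)
  (E_locally_compact : locally_compact [set: E])
  (E_separable : separable E)
  (X_standard : standard_markov_process F X P)
  (X_feller : C0_feller X P)
  (G_continuous : continuous G) (G_ge0 : forall x, 0 <= G x)
  (g_continuous : continuous g) (g_ge0 : forall x, 0 <= g x)
  (g_bounded : exists M, forall x, g x <= M)
  (c_gt0 : 0 < c) (g_ge : forall x, c <= g x)
  (G_sup_integrable : forall (T : R) x, 0 <= T ->
    (\int[P x]_w ereal_sup [set (expR (G (X t w)))%:E | t in `[0%R, T]]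
      < +oo)%E)
  (exp_functional_continuous : forall (T : R) (h : E -> R), 0 <= T -> continuous h ->
    (forall x, 0 <= h x <= G x) ->
    continuous (fun x =>
      'E_(P x)[fun w => expR (running X g T w + h (X T w))]%E)) :
  [/\ forall x, cvg (lower_value_T F X P g G T x @[T --> +oo]) /\
                value_u F X P g G x = lower_value F X P g G x,
      forall x, cvg (upper_value_T F X P g G T x @[T --> +oo]) /\
                value_w F X P g G x = upper_value F X P g G x,
      lower_semicontinuous (value_u F X P g G)
    & upper_semicontinuous (value_w F X P g G)].
Proof.
have [M gM] := g_bounded.
have g_bounds x : c <= g x <= M by rewrite g_ge gM.
have c_ge0 := ltW c_gt0.
have [psi [m psiP]] := truncation_exists X_standard G_continuous G_ge0
  E_locally_compact E_separable X_feller.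
split.
- move=> x; split; first exact/cvgP/(lower_value_T_cvg X_standard g_continuous c_ge0 g_bounds G_ge0).
  exact: (value_u_lower_value X_standard g_continuous c_ge0 g_bounds G_continuous G_ge0
    G_sup_integrable exp_functional_continuous psiP c_gt0).
- move=> x; split; first exact/cvgP/upper_value_T_cvg.
  exact: value_wE.
- exact: (value_u_lower_semicontinuous X_standard g_continuous c_ge0 g_bounds G_continuous G_ge0
    G_sup_integrable exp_functional_continuous psiP c_gt0).
- exact: (value_w_upper_semicontinuous X_standard g_continuous c_ge0 g_bounds G_continuous G_ge0
    G_sup_integrable exp_functional_continuous).
Qed.
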